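(* Chromatic Sum is NP-complete for distance-hereditary graphs, and thus also for graphs of clique-width at most $3$.
   Context: All graphs are finite, undirected and simple. A colouring of a graph $G=(V,E)$ is a function $c:V\to\{1,2,\ldots\}$ with $c(u)\neq c(v)$ for every edge $uv\in E$; its sum is $\sum_{v\in V}c(v)$. The decision problem Chromatic Sum takes a graph $G$ and an integer $k$ and asks whether $G$ admits a colouring with sum at most $k$; ''for'' a graph class means that input graphs are restricted to that class. A graph is distance-hereditary if it can be obtained from a single vertex by a sequence of the following operations: adding a pendant vertex (a new vertex adjacent to exactly one existing vertex), creating a true twin (a new vertex adjacent to an existing vertex $v$ and to exactly the neighbours of $v$), or creating a false twin (a new vertex adjacent to exactly the neighbours of an existing vertex $v$, and not to $v$). Clique-width is the standard graph parameter: the minimum number of labels needed to construct the graph by creating single labelled vertices, taking disjoint unions, adding all edges between vertices of label $i$ and vertices of label $j$ ($i\ne j$), and relabelling all vertices of label $i$ to label $j$. *)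

(* Defs.v *)
From mathcomp Require Import all_boot all_order all_algebra.

Set Implicit Arguments.
Unset Strict Implicit.
Unset Printing Implicit Defensive.

(** * Deterministic multi-tape Turing machines *)

Variant move := Lft | Stay | Rgt.

(* [None] is the blank; [aux] holds the non-input tape symbols. *)
Definition symbol (aux : finType) : finType := option (bool + aux)%type.

Record machine := Machine {
  ntapes : nat;  (* the machine has [ntapes.+1] tapes *)
  aux : finType;
  state : finType;
  start : state;
  halting : pred state;
  trans : state -> {ffun 'I_ntapes.+1 -> symbol aux} ->
          state * {ffun 'I_ntapes.+1 -> symbol aux * move}
}.

(* A two-way infinite tape: [(l, r)] has [l] (nearest cell first) to the left of
   the head and [r] (scanned cell first) from the head on; all else is blank. *)
Definition tape (A : finType) : Type := (seq (symbol A) * seq (symbol A))%type.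

Definition scanned (A : finType) (t : tape A) : symbol A := head None t.2.

Definition write_move (A : finType) (t : tape A) (am : symbol A * move) :=
  let: (l, r) := t in let: (a, m) := am in
  match m with
  | Lft => (behead l, head None l :: a :: behead r)
  | Stay => (l, a :: behead r)
  | Rgt => (a :: l, behead r)
  end.

Definition config (M : machine) : Type :=
  (state M * {ffun 'I_(ntapes M).+1 -> tape (aux M)})%type.

(* Halting configurations are stationary, so a run that halts within [t] steps
   is one whose configuration after exactly [t] steps is halting. *)
Definition step (M : machine) (c : config M) : config M :=
  let: (q, ts) := c in
  if halting q then c else
  let: (q', act) := trans q [ffun i => scanned (ts i)] in
  (q', [ffun i => write_move (ts i) (act i)]).

(* The [i]-th input string is written on tape [i], with the head on its first
   bit; the other tapes are blank. *)
Definition init (M : machine) (inputs : seq (seq bool)) : config M :=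
  (start M,
   [ffun i : 'I_(ntapes M).+1 =>
      ([::], [seq Some (inl b) | b <- nth [::] inputs i])]).

Fixpoint leading_bits (A : finType) (s : seq (symbol A)) : seq bool :=
  if s is Some (inl b) :: s' then b :: leading_bits s' else [::].

(* The output is the maximal bit string starting at the head of tape 0. *)
Definition computes_within (M : machine) (inputs : seq (seq bool)) (t : nat)
    (output : seq bool) : Prop :=
  let: (q, ts) := iter t (@step M) (init M inputs) in
  halting q /\ leading_bits (ts ord0).2 = output.

(** * Polynomial time and NP-completeness *)

(* Every polynomial is dominated by some [poly_bound c d]. *)
Definition poly_bound (c d n : nat) : nat := c * n.+1 ^ d.

Definition polytime (f : seq bool -> seq bool) : Prop :=
  exists M c d, forall x,
    computes_within M [:: x] (poly_bound c d (size x)) (f x).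

Definition polytime_rel (V : seq bool -> seq bool -> bool) : Prop :=
  exists M c d, forall x w,
    computes_within M [:: x; w] (poly_bound c d (size x + size w)) [:: V x w].

(* A decision problem is a collection of instances, encoded as bit strings, with
   a yes/no question about them. Restricting the inputs of a problem means
   shrinking [instance]: nothing is asked about other bit strings. A language
   [L] is the problem [Problem id L]. *)
Record problem := Problem {
  instance : Type;
  encode : instance -> seq bool;
  yes : instance -> Prop
}.

Definition in_NP (P : problem) : Prop :=
  exists V c d, polytime_rel V /\
    forall x : instance P,
      yes x <-> exists w, size w <= poly_bound c d (size (encode x)) /\
                          V (encode x) w.

(* Polynomial-time many-one (Karp) reductions, from instances to instances. *)
Definition reduces (P Q : problem) : Prop :=
  exists f, polytime f /\
    forall x : instance P, exists y : instance Q,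
      f (encode x) = encode y /\ (yes x <-> yes y).

Definition NP_hard (P : problem) : Prop := forall Q, in_NP Q -> reduces Q P.

Definition NP_complete (P : problem) : Prop := in_NP P /\ NP_hard P.

(** * Graphs and chromatic sum *)

Record sgraph (T : finType) := SGraph {
  adj :> rel T;
  adj_sym : symmetric adj;
  adj_irr : irreflexive adj
}.

Definition graph_class := forall T : finType, sgraph T -> Prop.

Definition colouring (T : finType) (G : sgraph T) (c : T -> nat) : Prop :=
  (forall v, 1 <= c v) /\ (forall u v, G u v -> c u != c v).

Record chromatic_sum_instance (C : graph_class) := ChromaticSumInstance {
  nvertices : nat;
  graph : sgraph 'I_nvertices;
  graph_in_class : C _ graph;
  target : int
}.

(* Little-endian, without leading zeros; 0 is the empty string. *)
Definition bits (m : nat) : seq bool :=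
  mkseq (fun i => odd (m %/ 2 ^ i)) (up_log 2 m.+1).

Definition encode_int (k : int) : seq bool := (k < 0)%R :: bits `|k|%N.

(* The order in unary, a separator, the adjacency matrix row by row, and the
   target in signed binary. *)
Definition encode_instance (C : graph_class) (I : chromatic_sum_instance C) :=
  nseq (nvertices I) true ++ false ::
  [seq graph I u v | u <- enum 'I_(nvertices I), v <- enum 'I_(nvertices I)] ++
  encode_int (target I).

Definition chromatic_sum (C : graph_class) : problem :=
  Problem (@encode_instance C)
    (fun I => exists c : 'I_(nvertices I) -> nat,
       colouring (graph I) c /\ ((\sum_v c v)%N%:Z <= target I)%R).

(** * Distance-hereditary graphs *)

(* [dh_built G A]: the subgraph of [G] induced by [A] can be obtained from a
   single vertex by the three operations. As these only add a vertex, all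
   intermediate graphs are induced subgraphs of the final one, and the
   neighbours of the new vertex [v] need only be prescribed inside [A]. *)
Inductive dh_built (T : finType) (G : sgraph T) : {set T} -> Prop :=
| dh_single (v : T) : dh_built G [set v]
| dh_pendant (A : {set T}) (u v : T) :
    dh_built G A -> u \in A -> v \notin A ->
    {in A, forall w, G v w = (w == u)} -> dh_built G (v |: A)
| dh_true_twin (A : {set T}) (u v : T) :
    dh_built G A -> u \in A -> v \notin A ->
    {in A, forall w, G v w = (w == u) || G u w} -> dh_built G (v |: A)
| dh_false_twin (A : {set T}) (u v : T) :
    dh_built G A -> u \in A -> v \notin A ->
    {in A, forall w, G v w = G u w} -> dh_built G (v |: A).

Definition distance_hereditary : graph_class :=
  fun T G => dh_built G [set: T].

(** * Clique-width *)

Inductive cwexpr (T : finType) (k : nat) :=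
| cw_vertex (v : T) (i : 'I_k)
| cw_union (e1 e2 : cwexpr T k)
| cw_join (i j : 'I_k) (e : cwexpr T k)
| cw_relabel (i j : 'I_k) (e : cwexpr T k).

(* [None] on the elements of [T] that are not vertices of the built graph. *)
Fixpoint cw_label (T : finType) (k : nat) (e : cwexpr T k) (x : T) :
    option 'I_k :=
  match e with
  | cw_vertex v i => if x == v then Some i else None
  | cw_union e1 e2 => if cw_label e1 x is Some i then Some i else cw_label e2 x
  | cw_join _ _ e1 => cw_label e1 x
  | cw_relabel i j e1 =>
      if cw_label e1 x == Some i then Some j else cw_label e1 x
  end.

Fixpoint cw_adj (T : finType) (k : nat) (e : cwexpr T k) (x y : T) : bool :=
  match e with
  | cw_vertex _ _ => false
  | cw_union e1 e2 => cw_adj e1 x y || cw_adj e2 x y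
  | cw_join i j e1 =>
      [|| cw_adj e1 x y,
          (cw_label e1 x == Some i) && (cw_label e1 y == Some j) |
          (cw_label e1 x == Some j) && (cw_label e1 y == Some i)]
  | cw_relabel _ _ e1 => cw_adj e1 x y
  end.

(* Unions must be disjoint and joins must be between distinct labels. *)
Fixpoint cw_wf (T : finType) (k : nat) (e : cwexpr T k) : bool :=
  match e with
  | cw_vertex _ _ => true
  | cw_union e1 e2 =>
      [&& cw_wf e1, cw_wf e2 &
          [forall x, (cw_label e1 x == None) || (cw_label e2 x == None)]]
  | cw_join i j e1 => (i != j) && cw_wf e1
  | cw_relabel _ _ e1 => cw_wf e1
  end.

Definition cw_constructible (T : finType) (G : sgraph T) (k : nat) : Prop :=
  exists e : cwexpr T k,
    [/\ cw_wf e, forall x, cw_label e x != None & cw_adj e =2 G].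

Definition cliquewidth (T : finType) (G : sgraph T) (k : nat) : Prop :=
  cw_constructible G k /\ forall j, cw_constructible G j -> k <= j.

Definition cliquewidth_at_most (k : nat) : graph_class :=
  fun T G => exists2 w, cliquewidth G w & w <= k.

(* Main.v *)
(* Hardness is proved in three steps. A polynomial-time computation is a tableau,
   written in coordinates relative to the heads, so that each of its cells is
   determined by the scanned cell and three neighbours in the previous row; the
   tableau is valid when no forbidden pattern of five cells occurs. Next, such a
   constraint problem is a list colouring problem on a complete bipartite graph:
   a cell picks the colour (cell, symbol), and a forbidden pattern must pick one
   of its own pairs that no cell has picked. Finally, lists are expressed by
   costs. The gadget [S_j] is a root joined to two cliques of [j - 1] vertices;
   its root prefers colour [j], and any other choice costs at least 1 more, the
   colour [j + 1] exactly 1. Attached by its root to a vertex [v], it charges 1 to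
   [v] for having colour [j]. With [D - c] gadgets [S_c] at [v] for each permitted
   colour [c <= D] and one more for each forbidden one, all permitted colours cost
   [D] and all others more. Leaves pendant at [v] make all gadgets equally large.
   The graph arises from the bipartite one by pendant and twin operations.

   Distance-hereditary graphs have clique-width at most 3: a new vertex is added
   to an expression by replacing the leaf of the old vertex, a third label being
   kept for vertices that get no further neighbours.

   Turing machines are obtained by compiling an arithmetical language whose
   values are polynomially bounded and held in unary as head positions. For
   membership in NP, a colouring is given by a square matrix, the colour of a
   vertex being 1 plus the number of ones in its row; colours up to the number
   of vertices suffice. *)

Require Import Defs.
From mathcomp Require Import all_boot all_order all_algebra zify.
From Stdlib Require Import Classical_Prop.

Set Implicit Arguments.
Unset Strict Implicit.
Unset Printing Implicit Defensive.

(** * Polynomial bounds and Turing machine components *)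

(** A gadget needs two cliques. Root and one clique form a complete graph on [j] vertices, whose
    cheapest colourings leave the colour of the root open. With two cliques, a root coloured [r < j]
    saves [j - r] once but costs each clique [j - r], and a root coloured [r > j] costs [r - j]
    more; every deviation is charged [|r - j|]. Colour 1 is withheld from the lists because the
    pendant padding leaves use it.

    On several tapes the heads drift apart; in coordinates relative to them one scanned cell fixes
    the move on every tape. Each constraint then refers to a possibly distant centre cell, which is
    harmless, since a complete bipartite graph has no notion of locality.

    The language has no unbounded loop and no variable exponent, so polynomial time follows by
    structural recursion. The price is that binary numbers must be handled without computing large
    powers of 2. *)

Definition poly_bounded (f : nat -> nat) :=
  exists c d, forall n, f n <= poly_bound c d n.

Lemma leq_poly_bound c c' d d' n n' :
  c <= c' -> d <= d' -> n <= n' -> poly_bound c d n <= poly_bound c' d' n'.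
Proof.
move=> cc dd nn; rewrite /poly_bound leq_mul //.
by apply: (leq_trans (leq_pexp2l _ dd)) => //; case: d' {dd} => // d'; rewrite leq_exp2r.
Qed.

Lemma poly_bounded_const c : poly_bounded (fun=> c).
Proof. by exists c, 0 => n; rewrite /poly_bound expn0 muln1. Qed.

Lemma poly_bounded_id : poly_bounded id.
Proof. by exists 1, 1 => n; rewrite /poly_bound expn1 mul1n. Qed.

Lemma poly_bounded_add f g :
  poly_bounded f -> poly_bounded g -> poly_bounded (fun n => f n + g n).
Proof.
move=> [c [d Hf]] [c' [d' Hg]]; exists (c + c'), (d + d') => n.
rewrite /poly_bound mulnDl leq_add //.
  by apply: leq_trans (Hf n) _; apply: leq_poly_bound => //; lia.
by apply: leq_trans (Hg n) _; apply: leq_poly_bound => //; lia.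
Qed.

Lemma poly_bounded_mul f g :
  poly_bounded f -> poly_bounded g -> poly_bounded (fun n => f n * g n).
Proof.
move=> [c [d Hf]] [c' [d' Hg]]; exists (c * c'), (d + d') => n.
by rewrite /poly_bound expnD mulnACA leq_mul.
Qed.

Lemma poly_bounded_comp f g :
  poly_bounded f -> poly_bounded g -> poly_bounded (fun n => f (g n)).
Proof.
move=> [c [d Hf]] [c' [d' Hg]]; exists (c * c'.+1 ^ d), (d' * d) => n.
apply: leq_trans (Hf _) _; rewrite /poly_bound -mulnA leq_mul2l; apply/orP; right.
rewrite expnM -expnMn; case: d {Hf} => // d; rewrite leq_exp2r // mulSn addnC -addn1 leq_add //.
by rewrite expn_gt0.
Qed.

Notation marked := (symbol unit).

Definition marker : marked := Some (inr tt).

Section Components.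

Variable K : nat.
Notation scans := {ffun 'I_K.+1 -> marked}.
Notation acts := {ffun 'I_K.+1 -> marked * move}.
Notation tapes := {ffun 'I_K.+1 -> tape unit}.

Record component := Component {
  cstate : finType;
  cstart : cstate;
  chalt : pred cstate;
  ctrans : cstate -> scans -> cstate * acts
}.

Definition machine_of (C : component) : machine :=
  @Machine K unit (cstate C) (cstart C) (@chalt C) (@ctrans C).

Definition scan (ts : tapes) : scans := [ffun i => scanned (ts i)].
Definition act (ts : tapes) (a : acts) : tapes :=
  [ffun i => write_move (ts i) (a i)].

Inductive exec (C : component) : cstate C -> tapes -> nat -> tapes -> Prop :=
| exec_halt q ts : chalt q -> exec q ts 0 ts
| exec_step q ts t ts' : ~~ chalt q ->
    exec (ctrans q (scan ts)).1 (act ts (ctrans q (scan ts)).2) t ts' ->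
    exec q ts t.+1 ts'.

Lemma exec_iter (C : component) (q : cstate C) ts t ts' : exec q ts t ts' ->
  exists2 q', chalt q' & iter t (@step (machine_of C)) (q, ts) = (q', ts').
Proof.
elim=> {q ts t ts'} [q ts hq|q ts t ts' hq _ [q' hq' IH]]; first by exists q.
exists q' => //; rewrite iterSr -IH; congr (iter _ _ _).
rewrite /step /= (negbTE hq) /scan; case: ctrans => a b /=.
by [].
Qed.

Definition idle (s : scans) : acts := [ffun i => (s i, Stay)].

Definition cone (g : scans -> acts) : component :=
  @Component bool false id (fun _ s => (true, g s)).

Definition cseq (C1 C2 : component) : component :=
  @Component (cstate C1 + cstate C2)%type (inl (cstart C1))
    (fun q => if q is inr q2 then chalt q2 else false)
    (fun q s => match q with
       | inl q1 => if chalt q1 then (inr (cstart C2), idle s)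
                   else let: (q', a) := ctrans q1 s in (inl q', a)
       | inr q2 => let: (q', a) := ctrans q2 s in (inr q', a)
       end).

Definition cwhile (P : scans -> bool) (C : component) : component :=
  @Component (bool + cstate C)%type (inl false)
    (fun q => if q is inl b then b else false)
    (fun q s => match q with
       | inl _ => if P s then (inr (cstart C), idle s) else (inl true, idle s)
       | inr q1 => if chalt q1 then (inl false, idle s)
                   else let: (q', a) := ctrans q1 s in (inr q', a)
       end).

(** Passing control takes an idle step, which need not be the identity: on an empty list it writes
    an explicit blank. Tapes therefore agree only cell by cell, and assertions have to be
    [stable]. *)
Definition idled ts := act ts (idle (scan ts)).

Lemma exec_cone g ts : @exec (cone g) false ts 1 (act ts (g (scan ts))).
Proof. by apply: exec_step => //; apply: exec_halt. Qed.

Lemma exec_cseq C1 C2 q ts t1 ts1 t2 ts2 :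
  @exec C1 q ts t1 ts1 -> @exec C2 (cstart C2) (idled ts1) t2 ts2 ->
  @exec (cseq C1 C2) (inl q) ts (t1 + t2.+1) ts2.
Proof.
move=> E1 E2; elim: E1 E2 => {q ts t1 ts1} [q ts hq|q ts t ts' hq _ IH] E2.
  rewrite add0n; apply: exec_step => //=; rewrite hq /= -/(idled _).
  elim: E2 => {q ts ts2 hq t2} [q ts hq|q ts t ts' hq _ IH]; first exact: exec_halt.
  by apply: exec_step => //=; case: ctrans IH.
by rewrite addSn; apply: exec_step => //=; rewrite (negbTE hq); case: ctrans IH => q' a; apply.
Qed.

Lemma exec_cwhile_stop (P : scans -> bool) C ts : ~~ P (scan ts) ->
  @exec (cwhile P C) (inl false) ts 1 (idled ts).
Proof. by move=> nP; apply: exec_step => //=; rewrite (negbTE nP); exact: exec_halt. Qed.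

Lemma exec_cwhile_loop (P : scans -> bool) C ts t1 ts1 t2 ts2 : P (scan ts) ->
  @exec C (cstart C) (idled ts) t1 ts1 ->
  @exec (cwhile P C) (inl false) (idled ts1) t2 ts2 ->
  @exec (cwhile P C) (inl false) ts (t1 + t2).+2 ts2.
Proof.
move=> Pt E1 E2; apply: exec_step => //=; rewrite Pt /= -/(idled _) -addnS.
elim: E1 E2 => {Pt ts t1 ts1} [q ts hq|q ts t ts' hq _ IH] E2.
  by apply: exec_step => //=; rewrite hq.
by rewrite addSn; apply: exec_step => //=; rewrite (negbTE hq); case: ctrans IH => q' a; apply.
Qed.

Variant triple (C : component) (P : tapes -> Prop) (t : nat) (Q : tapes -> Prop) : Prop :=
  Triple of forall ts, P ts -> exists ts' t',
    [/\ t' <= t, exec (cstart C) ts t' ts' & Q ts'].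

Definition stable (P : tapes -> Prop) := forall ts, P ts -> P (idled ts).

Lemma triple_seq C1 C2 P t1 Q t2 R : stable Q ->
  triple C1 P t1 Q -> triple C2 Q t2 R -> triple (cseq C1 C2) P (t1 + t2).+1 R.
Proof.
move=> sQ [H1] [H2]; split=> ts r; have [ts1 [t1' [l1 E1 R1]]] := H1 ts r.
have [ts2 [t2' [l2 E2 R2]]] := H2 _ (sQ _ R1).
exists ts2, (t1' + t2'.+1); split=> //; last exact: exec_cseq E1 E2.
by rewrite addnS ltnS leq_add.
Qed.

(** The invariant is indexed by the number of completed rounds. Besides its body, each round pays
    one step for entering and one for returning to the test. *)
Lemma triple_while (P : scans -> bool) C n t (S : nat -> tapes -> Prop) :
  (forall k, stable (S k)) ->
  (forall k, k < n -> (forall ts, S k ts -> P (scan ts)) /\ triple C (S k) t (S k.+1)) ->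
  (forall ts, S n ts -> ~~ P (scan ts)) ->
  triple (cwhile P C) (S 0) (n * t.+2).+1 (S n).
Proof.
move=> sS; elim: n S sS => [|n IH] S sS H1 H2; split=> ts r.
  exists (idled ts), 1; split=> //; last exact: sS.
  by apply: exec_cwhile_stop; apply: H2.
have [P0 [S0]] := H1 0 isT.
have [ts1 [t1 [l1 E1 R1]]] := S0 _ (sS _ _ r).
have [||IHS] := IH (S \o succn) _ _ H2; first by move=> k; apply: sS.
  by move=> k lt; apply: (H1 k.+1).
have [ts2 [t2 [l2 E2 R2]]] := IHS _ (sS _ _ R1).
exists ts2, (t1 + t2).+2; split=> //; first by rewrite mulSn; lia.
by apply: exec_cwhile_loop E1 E2; apply: P0.
Qed.

Lemma triple_cone g (P Q : tapes -> Prop) :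
  (forall ts, P ts -> Q (act ts (g (scan ts)))) -> triple (cone g) P 1 Q.
Proof.
by move=> H; split=> ts Pt; eexists; exists 1; split=> //; [exact: exec_cone|exact: H].
Qed.

(** * Tapes as registers *)

Definition cell (d : seq bool) (n : nat) : marked :=
  if n is m.+1 then nth None [seq Some (inl b) | b <- d] m else marker.

Arguments cell : simpl never.

(* A tape holding the marker followed by [d], with the head [p] cells to the
   right of the marker; what is left of the marker is irrelevant. *)
Definition holds (t : tape unit) (dp : seq bool * nat) :=
  (forall k, nth None t.2 k = cell dp.1 (dp.2 + k)) /\
  (forall k, k < dp.2 -> nth None t.1 k = cell dp.1 (dp.2 - k.+1)).

Lemma cell_marker d p : (cell d p == marker) = (p == 0).
Proof.
case: p => [|p]; rewrite /cell ?eqxx //.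
by elim: d p => [|b d IH] [|p] //=; rewrite IH.
Qed.

Lemma holds_scanned t dp : holds t dp -> scanned t = cell dp.1 dp.2.
Proof. by move=> [H _]; rewrite /scanned -nth0 H addn0. Qed.

Definition move_by (m : move) (p : nat) :=
  match m with Lft => p.-1 | Stay => p | Rgt => p.+1 end.

(** Left moves stop at the marker, so that they act on register values as the truncated
    predecessor. *)
Definition safe_move (m : move) (s : marked) : move :=
  if (if m is Lft then s == marker else false) then Stay else m.

Lemma holds_move t d p m : holds t (d, p) ->
  holds (write_move t (scanned t, safe_move m (scanned t))) (d, move_by m p).
Proof.
move=> H; rewrite (holds_scanned H) /safe_move /=.
case: t H => l r [/= H1 H2].
have r0 := H1 0; rewrite addn0 in r0.
case: m => /=; [case: p H1 H2 r0 => [|p] H1 H2 r0; rewrite ?eqxx ?cell_marker /=|..].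
- by split=> //= -[|k] //=; rewrite nth_behead H1.
- split=> [[|[|k]]|k lk] /=.
  + by rewrite -nth0 H2 // subn1 addn0.
  + by rewrite addn1.
  + by rewrite nth_behead H1 addSn !addnS.
  + by rewrite nth_behead H2.
- by split=> [[|k]|k lk] /=; [rewrite addn0|rewrite nth_behead H1|exact: H2].
- split=> [k|[|k] lk] /=; first by rewrite nth_behead H1 addSn addnS.
  + by rewrite subn1.
  + by rewrite H2.
Qed.

Lemma holds_append t d b : holds t (d, (size d).+1) ->
  holds (write_move t (Some (inl b), Rgt)) (rcons d b, (size (rcons d b)).+1).
Proof.
case: t => l r [/= H1 H2].
have cr n : n <= size d -> cell (rcons d b) n = cell d n.
  by case: n => // n lt; rewrite /cell map_rcons nth_rcons size_map lt.
rewrite size_rcons; split=> [k|[|k] lk] /=.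
rewrite nth_behead H1 !addSn /cell map_rcons nth_rcons nth_default ?size_map ?leq_addr //.
  rewrite ltnNge -addnS leq_addr /=; case: eqP => //; lia.
- by rewrite subn1 /cell /= map_rcons nth_rcons size_map ltnn eqxx.
- rewrite H2 // subSS cr //; lia.
Qed.

Lemma holds_idle t dp : holds t dp -> holds (write_move t (scanned t, Stay)) dp.
Proof. by case: dp => d p /(holds_move Stay). Qed.

Definition store : Type := ((nat -> nat) * seq bool)%type.

Variables x w : seq bool.

(* Tape 0 is the output tape; the other tapes are registers, whose value is the
   head position. The inputs [w] and [x] are written on registers 1 and 2. *)
Definition content (i : nat) := nth [::] [:: [::]; w; x] i.

Definition at_tape (s : store) (i : nat) :=
  if i == 0 then (s.2, (size s.2).+1) else (content i, s.1 i).

Definition rep (ts : tapes) (s : store) :=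
  forall i : 'I_K.+1, holds (ts i) (at_tape s i).

Definition store_scan (s : store) : scans :=
  [ffun i : 'I_K.+1 => cell (at_tape s i).1 (at_tape s i).2].

Lemma rep_scan ts s : rep ts s -> scan ts = store_scan s.
Proof. by move=> H; apply/ffunP=> i; rewrite !ffunE (holds_scanned (H i)). Qed.

Lemma rep_idled ts s : rep ts s -> rep (idled ts) s.
Proof. by move=> H i; rewrite !ffunE; apply: holds_idle. Qed.

Definition spec (C : component) (s : store) (t : nat) (s' : store) : Prop :=
  triple C (rep^~ s) t (rep^~ s').

Lemma spec_ext C s t s' t2 s2 : spec C s t s' -> t <= t2 -> s2.2 = s'.2 ->
  (forall i, s2.1 i = s'.1 i) -> spec C s t2 s2.
Proof.
move=> [H] tt e2 e1; split=> ts r; have [ts' [t' [lt E R]]] := H ts r.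
exists ts', t'; split=> //; first exact: leq_trans tt.
by move=> i; move: (R i); rewrite /at_tape e1 e2.
Qed.

Lemma spec_seq C1 C2 s t1 s1 t2 s2 :
  spec C1 s t1 s1 -> spec C2 s1 t2 s2 -> spec (cseq C1 C2) s (t1 + t2).+1 s2.
Proof. by apply: triple_seq => ts; apply: rep_idled. Qed.

Lemma spec_while (P : scans -> bool) C n t (S : nat -> store) :
  (forall k, k < n -> P (store_scan (S k)) /\ spec C (S k) t (S k.+1)) ->
  ~~ P (store_scan (S n)) ->
  spec (cwhile P C) (S 0) (n * t.+2).+1 (S n).
Proof.
move=> H1 H2; apply: (triple_while (S := fun k => rep^~ (S k))).
- by move=> k ts; apply: rep_idled.
- by move=> k lt; have [P1 S1] := H1 _ lt; split=> // ts R; rewrite (rep_scan R).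
- by move=> ts R; rewrite (rep_scan R).
Qed.

Definition moves (f : scans -> nat -> move) : component :=
  cone (fun s => [ffun i : 'I_K.+1 =>
    (s i, if i == 0 :> nat then Stay else safe_move (f s i) (s i))]).

Lemma spec_moves f r o :
  spec (moves f) (r, o) 1 (fun k => move_by (f (store_scan (r, o)) k) (r k), o).
Proof.
apply: triple_cone => ts R.
move=> i; rewrite !ffunE -(rep_scan R); move: (R i); rewrite /at_tape /=.
by case: eqP => /= [_|_]; [exact: holds_idle|exact: holds_move].
Qed.

Definition nonzero (i : nat) (s : scans) := s (inord i) != marker.

Lemma store_scanE s i : 0 < i <= K -> store_scan s (inord i) = cell (content i) (s.1 i).
Proof. by case: i => // i lt; rewrite ffunE inordK //= /at_tape. Qed.

Lemma nonzeroE s i : 0 < i <= K -> nonzero i (store_scan s) = (s.1 i != 0).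
Proof. by move=> lt; rewrite /nonzero store_scanE // cell_marker. Qed.

(** The basic loop of compiled code: while register [a] is nonzero, all register heads move
    simultaneously. Depending on [m] this copies, adds, subtracts or clears. *)
Definition drain (a : nat) (m : nat -> move) :=
  cwhile (nonzero a) (moves (fun=> m)).

Lemma spec_drain a m r o : 0 < a <= K -> m a = Lft ->
  spec (drain a m) (r, o) (3 * r a).+1
       (fun k => iter (r a) (move_by (m k)) (r k), o).
Proof.
move=> la ma; have itL n p : iter n predn p = p - n.
  by elim: n => [|n IH] /=; [rewrite subn0|rewrite IH subnS].
have := @spec_while (nonzero a) (moves (fun=> m)) (r a) 1
  (fun n => (fun k => iter n (move_by (m k)) (r k), o)).
rewrite mulnC; apply=> [k lt|]; last first.
  by rewrite nonzeroE //= ma itL subnn.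
split; first by rewrite nonzeroE //= ma itL; lia.
exact: spec_moves.
Qed.

Definition emit (i : nat) : component :=
  cone (fun s => [ffun j : 'I_K.+1 =>
    if j == 0 :> nat then (Some (inl (nonzero i s)), Rgt) else (s j, Stay)]).

Lemma spec_emit i r o : 0 < i <= K ->
  spec (emit i) (r, o) 1 (r, rcons o (r i != 0)).
Proof.
move=> li; apply: triple_cone => ts R j; rewrite !ffunE (rep_scan R) nonzeroE //.
by move: (R j); rewrite /at_tape /=; case: eqP => _; [exact: holds_append|exact: holds_idle].
Qed.

End Components.

(** * An expression language and its compiler *)

(* A small language of arithmetical expressions whose values are polynomially
   bounded by construction. [Sum x a b] is the sum of [b] over [x < a];
   [Bit true], [Len true] read the first input string, [Bit false], [Len false]
   the second one; [Out a] appends the bit [a != 0] to the output. *)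
Inductive expr :=
| Var of nat
| One
| Add of expr & expr
| Monus of expr & expr
| Sum of nat & expr & expr
| Bit of bool & expr
| Len of bool
| Out of expr.

Definition upd (r : nat -> nat) (x v k : nat) := if k == x then v else r k.

Fixpoint var_bound (e : expr) : nat :=
  match e with
  | Var i => i.+1
  | One | Len _ => 0
  | Add a b | Monus a b => maxn (var_bound a) (var_bound b)
  | Sum x a b => maxn x.+1 (maxn (var_bound a) (var_bound b))
  | Bit _ a | Out a => var_bound a
  end.

Lemma flatten_iotaS (T : Type) (f : nat -> seq T) k :
  flatten [seq f i | i <- iota 0 k.+1] = flatten [seq f i | i <- iota 0 k] ++ f k.
Proof. by rewrite -addn1 iotaD map_cat flatten_cat /= cats0. Qed.

Section Semantics.

Variables x w : seq bool.

Definition input (t : bool) := if t then x else w.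

Fixpoint eval (e : expr) (r : nat -> nat) : nat :=
  match e with
  | Var i => r i
  | One => 1
  | Add a b => eval a r + eval b r
  | Monus a b => eval a r - eval b r
  | Sum x a b => \sum_(i < eval a r) eval b (upd r x i)
  | Bit t a => nth false (input t) (eval a r)
  | Len t => size (input t)
  | Out a => 0
  end.

Fixpoint output (e : expr) (r : nat -> nat) : seq bool :=
  match e with
  | Add a b | Monus a b => output a r ++ output b r
  | Sum x a b =>
      output a r ++ flatten [seq output b (upd r x i) | i <- iota 0 (eval a r)]
  | Bit _ a => output a r
  | Out a => rcons (output a r) (eval a r != 0)
  | Var _ | One | Len _ => [::]
  end.

Lemma eval_ext e r r' : (forall k, k < var_bound e -> r k = r' k) ->
  eval e r = eval e r' /\ output e r = output e r'.
Proof.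
elim: e r r' => /= [i||a IHa b IHb|a IHa b IHb|y a IHa b IHb|t a IHa|//|a IHa] r r' H //.
- by rewrite H.
- have [-> ->] := IHa _ _ (fun k l => H k (leq_trans l (leq_maxl _ _))).
  by have [-> ->] := IHb _ _ (fun k l => H k (leq_trans l (leq_maxr _ _))).
- have [-> ->] := IHa _ _ (fun k l => H k (leq_trans l (leq_maxl _ _))).
  by have [-> ->] := IHb _ _ (fun k l => H k (leq_trans l (leq_maxr _ _))).
- have [|-> ->] := IHa r r'; first by move=> k l; apply: H; lia.
  have E i : eval b (upd r y i) = eval b (upd r' y i) /\
             output b (upd r y i) = output b (upd r' y i).
    by apply: IHb => k l; rewrite /upd; case: eqP => // _; apply: H; lia.
  split; first by apply: eq_bigr => i _; case: (E i).
  by congr (_ ++ flatten _); apply: eq_map => i; case: (E i).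
- by have [-> ->] := IHa _ _ H.
- by have [-> ->] := IHa _ _ H.
Qed.

End Semantics.

(** [B] bounds the inputs and the variables. A bound variable stays below the value of its range, so
    the body is evaluated with the enlarged bound [B + value_bound a B]; polynomials are closed
    under this composition. *)
Fixpoint value_bound (e : expr) (B : nat) : nat :=
  match e with
  | Var _ | Len _ => B
  | One | Bit _ _ => 1
  | Add a b => value_bound a B + value_bound b B
  | Monus a b => value_bound a B
  | Sum _ a b => value_bound a B * value_bound b (B + value_bound a B)
  | Out a => 0
  end.

Lemma poly_bounded_value_bound e : poly_bounded (value_bound e).
Proof.
have H1 := poly_bounded_const; have H2 := poly_bounded_id.
elim: e => //= [a Ha b Hb|_ a Ha b Hb]; first exact: poly_bounded_add.
by apply: poly_bounded_mul => //; apply: (poly_bounded_comp Hb); apply: poly_bounded_add.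
Qed.

Definition bounded_store (x w : seq bool) (n : nat) (r : nat -> nat) (B : nat) :=
  [/\ size x <= B, size w <= B & forall k, k < n -> r k <= B].

Lemma bounded_store_upd x w n m r B y v b : m <= n -> v <= b ->
  bounded_store x w n r B -> bounded_store x w m (upd r y v) (B + b).
Proof.
move=> mn vb [hx hw hr]; split; [exact: leq_trans hx (leq_addr _ _)|
  exact: leq_trans hw (leq_addr _ _)|] => k l; rewrite /upd; case: eqP => _; first lia.
by apply: leq_trans (hr k _) (leq_addr _ _); lia.
Qed.

Lemma eval_value_bound x w e r B : bounded_store x w (var_bound e) r B ->
  eval x w e r <= value_bound e B.
Proof.
have sub n m b r' : n <= m -> bounded_store x w m r' b -> bounded_store x w n r' b.
  by move=> l [? ? H]; split=> // k lk; apply: H; lia.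
elim: e r B => /= [i||a IHa b IHb|a IHa b IHb|y a IHa b IHb|t a IHa|t|a IHa] r B H //.
- by case: H => _ _; apply.
- by apply: leq_add; [apply: IHa|apply: IHb]; apply: sub H; lia.
- by apply: leq_trans (leq_subr _ _) _; apply: IHa; apply: sub H; lia.
- have Ha : eval x w a r <= value_bound a B by apply: IHa; apply: sub H; lia.
  apply: leq_trans (_ : eval x w a r * value_bound b (B + value_bound a B) <= _); last first.
    by rewrite leq_mul2r Ha orbT.
  rewrite -[X in X * _]card_ord -sum_nat_const; apply: leq_sum => i _.
  apply: IHb; apply: bounded_store_upd H; [lia|].
  by apply: leq_trans Ha; exact: ltnW.
- exact: leq_b1.
- by case: H => hx hw _; case: t.
Qed.

Definition shift (ls rs : seq nat) (k : nat) :=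
  if k \in ls then Lft else if k \in rs then Rgt else Stay.

Definition input_reg (t : bool) := t.+1.

(** * Compilation into register operations *)

Section Compiler.

Variable K : nat.

Definition shifts (ls rs : seq nat) : component K := moves (fun=> shift ls rs).

Definition scans_bit (b : bool) (i : nat) (s : {ffun 'I_K.+1 -> marked}) :=
  s (inord i) == Some (inl b).

(** Variable [i] lives in register [i.+3], after the output and the two inputs. The value is
    delivered in register [d]; the registers from [d] on are expected to be 0, and those above [d]
    are scratch space left at 0 again. Draining is destructive, hence a variable is drained into two
    registers and restored from one of them. *)
Fixpoint code (e : expr) (d : nat) : component K :=
  match e with
  | Var i => cseq (drain K i.+3 (shift [:: i.+3] [:: d; d.+1]))
                  (drain K d.+1 (shift [:: d.+1] [:: i.+3]))
  | One => shifts [::] [:: d]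
  | Add a b => cseq (code a d) (cseq (code b d.+1)
                 (drain K d.+1 (shift [:: d.+1] [:: d])))
  | Monus a b => cseq (code a d) (cseq (code b d.+1)
                 (drain K d.+1 (shift [:: d.+1; d] [::])))
  | Sum x a b =>
      cseq (code a d)
     (cseq (drain K x.+3 (shift [:: x.+3] [:: d.+1]))
     (cseq (cwhile (nonzero d)
              (cseq (shifts [:: d] [::])
              (cseq (code b d.+3)
              (cseq (drain K d.+3 (shift [:: d.+3] [:: d.+2]))
                    (shifts [::] [:: x.+3])))))
     (cseq (drain K x.+3 (shift [:: x.+3] [::]))
     (cseq (drain K d.+1 (shift [:: d.+1] [:: x.+3]))
           (drain K d.+2 (shift [:: d.+2] [:: d]))))))
  | Bit t a =>
      cseq (code a d)
     (cseq (shifts [::] [:: input_reg t])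
     (cseq (drain K d (shift [:: d] [:: input_reg t]))
     (cseq (moves (fun s => shift [::] (nseq (scans_bit true (input_reg t) s) d)))
           (drain K (input_reg t) (shift [:: input_reg t] [::])))))
  | Len t =>
      cseq (shifts [::] [:: input_reg t])
     (cseq (cwhile (fun s => scans_bit true (input_reg t) s || scans_bit false (input_reg t) s)
              (shifts [::] [:: input_reg t; d]))
           (drain K (input_reg t) (shift [:: input_reg t] [::])))
  | Out a => cseq (code a d) (cseq (emit K d) (drain K d (shift [:: d] [::])))
  end.

Fixpoint reg_bound (e : expr) (d : nat) : nat :=
  match e with
  | Var _ => d.+1
  | One | Len _ => d
  | Add a b | Monus a b => maxn (reg_bound a d) (maxn d.+1 (reg_bound b d.+1))
  | Sum _ a b => maxn (reg_bound a d) (maxn d.+3 (reg_bound b d.+3))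
  | Bit _ a | Out a => maxn d (reg_bound a d)
  end.

Fixpoint time_bound (e : expr) (B : nat) : nat :=
  match e with
  | Var _ => 6 * B + 3
  | One => 1
  | Add a b | Monus a b =>
      time_bound a B + time_bound b B + 3 * value_bound b B + 3
  | Sum _ a b =>
      let n := value_bound a B in let B' := B + n in
      time_bound a B + n * (time_bound b B' + 3 * value_bound b B' + 8) +
      6 * B + 3 * n + 3 * (n * value_bound b B') + 11
  | Bit _ a => time_bound a B + 6 * value_bound a B + 11
  | Len _ => 6 * B + 8
  | Out a => time_bound a B + 3 * value_bound a B + 4
  end.

Lemma poly_bounded_time_bound e : poly_bounded (time_bound e).
Proof.
elim: e => //= [_||a Ha b Hb|a Ha b Hb|_ a Ha b Hb|_ a Ha|_|a Ha];
  repeat first [exact: poly_bounded_const | exact: poly_bounded_id | assumption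
    | apply: poly_bounded_add | apply: poly_bounded_mul | exact: poly_bounded_value_bound
    | apply: (poly_bounded_comp Hb) | apply: (poly_bounded_comp (poly_bounded_value_bound b))].
Qed.

Variables x w : seq bool.
Notation spec := (@spec K x w).

Lemma spec_shifts ls rs r o :
  spec (shifts ls rs) (r, o) 1
    (fun k => if k \in ls then (r k).-1 else if k \in rs then (r k).+1 else r k, o).
Proof.
apply: (spec_ext (spec_moves _ _ _ _ _)) => // k /=; rewrite /shift.
by case: ifP => // _; case: ifP.
Qed.

Lemma spec_drain_shift a ls rs r o : 0 < a <= K -> a \in ls ->
  spec (drain K a (shift ls rs)) (r, o) (3 * r a).+1
    (fun k => if k \in ls then r k - r a else
              if k \in rs then r k + r a else r k, o).
Proof.
move=> la al; apply: (spec_ext (spec_drain _ _ _ _ la _)) => [|||k] //=; first by rewrite /shift al.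
rewrite /shift; case: ifP => _; last case: ifP => _.
- by elim: (r a) => [|n IH] /=; [rewrite subn0|rewrite -IH subnS].
- by elim: (r a) => [|n IH] /=; [rewrite addn0|rewrite -IH addnS].
- by elim: (r a).
Qed.

Lemma content_input t : content x w (input_reg t) = input x w t.
Proof. by case: t. Qed.

Ltac cases_reg :=
  rewrite /= ?inE /upd /=; repeat (case: eqP => ? //=); subst => //; try lia.

Lemma scans_bitE b i p r o : 0 < i <= K -> r i = p.+1 ->
  scans_bit b i (store_scan K x w (r, o)) =
  (p < size (content x w i)) && (nth false (content x w i) p == b).
Proof.
move=> li ri; rewrite /scans_bit store_scanE // /= ri /cell.
case: ltnP => [l|l]; first by rewrite (nth_map false).
by rewrite nth_default ?size_map.
Qed.

Lemma bounded_store_sub n m r B : n <= m ->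
  bounded_store x w m r B -> bounded_store x w n r B.
Proof. by move=> l [? ? H]; split=> // k lk; apply: H; lia. Qed.

Ltac solve_reg rB rr r0 :=
  first [ lia | by cases_reg | by apply: bounded_store_sub rB; lia
        | by rewrite /= /upd ?eqxx; lia
        | by move=> ?; cases_reg
        | by move=> ? ?; cases_reg; (apply: rr + apply: r0); lia ].

(* [r] is the register file and [r'] the environment it represents. *)
Lemma spec_code e d r r' o B :
  (var_bound e).+3 <= d -> reg_bound e d <= K -> 2 <= K ->
  (forall k, d <= k -> r k = 0) -> r 1 = 0 -> r 2 = 0 ->
  (forall k, k < var_bound e -> r k.+3 = r' k) ->
  bounded_store x w (var_bound e) r' B ->
  spec (code e d) (r, o) (time_bound e B)
    (upd r d (eval x w e r'), o ++ output x w e r').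
Proof.
elim: e d r r' o B => /= [i||a IHa b IHb|a IHa b IHb|y a IHa b IHb|t a IHa|t|a IHa]
  d r r' o B dv dK K2 r0 r1 r2 rr rB.
- have ri : r' i <= B by case: rB => _ _; apply.
  have rri := rr i (ltnSn i).
  have rd := r0 d (leqnn _); have rd1 := r0 d.+1 (leqnSn _).
  apply: (spec_ext (spec_seq (spec_drain_shift _ _ _ _ _) (spec_drain_shift _ _ _ _ _)));
    rewrite ?inE ?eqxx ?cats0 //=; try lia.
    by cases_reg.
  by move=> k; cases_reg.
- have rd := r0 d (leqnn _).
  apply: (spec_ext (spec_shifts _ _ _ _)) => //=; first by rewrite cats0.
  by move=> k; rewrite /shift; cases_reg.
- have rd1 := r0 d.+1 (leqnSn _).
  have Bb : bounded_store x w (var_bound b) r' B by apply: bounded_store_sub rB; lia.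
  have lb := eval_value_bound Bb.
  apply: (spec_ext (spec_seq (IHa d r r' o B _ _ _ _ _ _ _ _)
    (spec_seq (IHb d.+1 _ r' _ B _ _ _ _ _ _ _ Bb) (spec_drain_shift _ _ _ _ _))));
    rewrite ?inE ?eqxx ?catA //;
    solve_reg rB rr r0.
- have rd1 := r0 d.+1 (leqnSn _).
  have Bb : bounded_store x w (var_bound b) r' B by apply: bounded_store_sub rB; lia.
  have lb := eval_value_bound Bb.
  apply: (spec_ext (spec_seq (IHa d r r' o B _ _ _ _ _ _ _ _)
    (spec_seq (IHb d.+1 _ r' _ B _ _ _ _ _ _ _ Bb) (spec_drain_shift _ _ _ _ _))));
    rewrite ?inE ?eqxx ?catA ?orbT //;
    solve_reg rB rr r0.
- have Ba : bounded_store x w (var_bound a) r' B by apply: bounded_store_sub rB; lia.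
  set n := eval x w a r'; have ln : n <= value_bound a B := eval_value_bound Ba.
  set B' := B + value_bound a B.
  have Bb i : i < n -> bounded_store x w (var_bound b) (upd r' y i) B'.
    by move=> l; apply: bounded_store_upd rB; lia.
  have ry : r y.+3 <= B by rewrite rr; [case: rB => _ _; apply|]; lia.
  have rd1 := r0 d.+1 (leqnSn _); have rd2 : r d.+2 = 0 by apply: r0; lia.
  have rd3 : r d.+3 = 0 by apply: r0; lia.
  (* Invariant after [k] rounds: [d] counts down, the register of [y] counts up and serves as the
     bound variable, [d.+1] keeps its outer value, [d.+2] accumulates the sum. *)
  pose S k : store := (fun j => if j == d then n - k else if j == y.+3 then k
     else if j == d.+1 then r y.+3
     else if j == d.+2 then \sum_(i < k) eval x w b (upd r' y i) else r j,
     (o ++ output x w a r') ++ flatten [seq output x w b (upd r' y i) | i <- iota 0 k]).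
  have lS k : k <= n -> \sum_(i < k) eval x w b (upd r' y i) <= k * value_bound b B'.
    move=> l; rewrite -[k in k * _]card_ord -sum_nat_const; apply: leq_sum => i _.
    by apply: eval_value_bound; apply: Bb; apply: leq_trans l.
  have loop : spec (cwhile (nonzero d)
              (cseq (shifts [:: d] [::])
              (cseq (code b d.+3)
              (cseq (drain K d.+3 (shift [:: d.+3] [:: d.+2]))
                    (shifts [::] [:: y.+3]))))) (S 0)
      (n * (time_bound b B' + 3 * value_bound b B' + 6).+2).+1 (S n).
    apply: spec_while => [k lk|]; last by rewrite nonzeroE ?subnn /= ?eqxx //; lia.
    split; first by rewrite nonzeroE /= ?eqxx; lia.
    have lb := eval_value_bound (Bb _ lk).
    have Sk : \sum_(i < k.+1) eval x w b (upd r' y i) =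
      \sum_(i < k) eval x w b (upd r' y i) + eval x w b (upd r' y k) by rewrite big_ord_recr.
    pose s1 j := if j == d then n - k.+1 else (S k).1 j.
    set v := eval x w b (upd r' y k) in lb Sk.
    pose s2 j := if j == y.+3 then k else (S k.+1).1 j.
    have h1 : spec (shifts [:: d] [::]) (S k) 1 (s1, (S k).2).
      by apply: (spec_ext (spec_shifts _ _ _ _)) => // j; rewrite /s1; cases_reg.
    have h2 : spec (code b d.+3) (s1, (S k).2) (time_bound b B') (upd s1 d.+3 v, (S k.+1).2).
      have -> : (S k.+1).2 = (S k).2 ++ output x w b (upd r' y k).
        by have /= E := flatten_iotaS (fun i => output x w b (upd r' y i)) k; rewrite /S /= E !catA.
      apply: IHb (Bb _ lk); rewrite /s1 /=; solve_reg rB rr r0.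
    have h3 : spec (drain K d.+3 (shift [:: d.+3] [:: d.+2])) (upd s1 d.+3 v, (S k.+1).2)
      (3 * value_bound b B').+1 (s2, (S k.+1).2).
      apply: (spec_ext (spec_drain_shift _ _ _ _ _)); rewrite ?inE ?eqxx //; rewrite /s1 /s2; solve_reg rB rr r0.
    have h4 : spec (shifts [::] [:: y.+3]) (s2, (S k.+1).2) 1 (S k.+1).
      by apply: (spec_ext (spec_shifts _ _ _ _)) => // j; rewrite /s2; cases_reg.
    by apply: (spec_ext (spec_seq h1 (spec_seq h2 (spec_seq h3 h4)))) => //; lia.
  have start : spec (drain K y.+3 (shift [:: y.+3] [:: d.+1]))
      (upd r d n, o ++ output x w a r') (3 * B).+1 (S 0).
    apply: (spec_ext (spec_drain_shift _ _ _ _ _)); rewrite ?inE ?eqxx //; try solve_reg rB rr r0.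
      by rewrite /S /= cats0.
    by move=> k; rewrite /S /= big_ord0; cases_reg.
  have lSn := lS n (leqnn n); have := leq_mul ln (leqnn (value_bound b B')).
  have := leq_mul ln (leqnn (time_bound b B' + 3 * value_bound b B' + 8)) => ln1 ln2.
  apply: (spec_ext (spec_seq (IHa d r r' o B _ _ _ _ _ _ _ Ba)
    (spec_seq start (spec_seq loop (spec_seq (spec_drain_shift _ _ _ _ _)
    (spec_seq (spec_drain_shift _ _ _ _ _) (spec_drain_shift _ _ _ _ _)))))));
    rewrite ?inE ?eqxx ?catA //; try solve_reg rB rr r0.
    have [-> -> -> ->] : [/\ (y.+3 == d) = false, (d.+1 == y.+3) = false,
      (d.+1 == d) = false & (d.+2 == d) = false] by split; apply/eqP; lia.
    have [-> ->] : (d.+2 == y.+3) = false /\ (d.+2 == d.+1) = false by split; apply/eqP; lia.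
    rewrite ?inE /=; have -> : (time_bound b B' + 3 * value_bound b B' + 6).+2 =
      time_bound b B' + 3 * value_bound b B' + 8 by lia.
    move: (n * (_ + 8)) (value_bound a B * (_ + 8)) ln1 => p q pq.
    by move: (n * value_bound b B') (value_bound a B * _) (\sum_(i < n) _) lSn ln2; lia.
- have lv := eval_value_bound rB; set v := eval x w a r' in lv *.
  set T := input_reg t; have [T0 T3] : 0 < T /\ T < 3 by rewrite /T; case: (t).
  have rT : r T = 0 by rewrite /T; case: (t).
  have rd := r0 d (leqnn _).
  (* Bit [v] lies in cell [v.+1], cell 0 being the marker. The input head gets there by stepping to
     1 and then absorbing register [d]. *)
  pose s1 j := if j == T then v.+1 else r j.
  set c := nth false (input x w t) v.
  have bt o' : scans_bit true T (store_scan K x w (s1, o')) = c.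
    rewrite (@scans_bitE _ _ v) /s1 ?eqxx ?content_input //; last by lia.
    by rewrite eqb_id; case: ltnP => // l; rewrite /c nth_default.
  pose s2 j := if j == d then c : nat else s1 j.
  have h1 o' : spec (shifts [::] [:: T]) (upd r d v, o') 1
     (fun j => if j == T then 1 else upd r d v j, o').
    by apply: (spec_ext (spec_shifts _ _ _ _)) => // j; cases_reg.
  have h2 o' : spec (drain K d (shift [:: d] [:: T]))
      (fun j => if j == T then 1 else upd r d v j, o') (3 * v).+1 (s1, o').
    apply: (spec_ext (spec_drain_shift _ _ _ _ _)); rewrite ?inE ?eqxx //; rewrite /s1;
      solve_reg rB rr r0.
  have h3 o' : spec (moves (fun s => shift [::] (nseq (scans_bit true T s) d)))
      (s1, o') 1 (s2, o').
    apply: (spec_ext (spec_moves _ _ _ _ _)) => // j; rewrite bt /s2 /s1.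
    by case: (c); rewrite /shift; cases_reg.
  have h4 o' : spec (drain K T (shift [:: T] [::])) (s2, o') (3 * v.+1).+1 (upd r d c, o').
    apply: (spec_ext (spec_drain_shift _ _ _ _ _)); rewrite ?inE ?eqxx //; rewrite /s2 /s1;
      solve_reg rB rr r0.
  apply: (spec_ext (spec_seq (IHa d r r' o B _ _ _ _ _ _ _ _) (spec_seq (h1 _)
    (spec_seq (h2 _) (spec_seq (h3 _) (h4 _)))))) => //; solve_reg rB rr r0.
- set T := input_reg t; have [T0 T3] : 0 < T /\ T < 3 by rewrite /T; case: (t).
  have rT : r T = 0 by rewrite /T; case: (t).
  have rd := r0 d (leqnn _); set n := size (input x w t).
  have ln : n <= B by case: rB => ? ? _; rewrite /n; case: (t).
  pose S k : store := (fun j => if j == T then k.+1 else if j == d then k else r j, o).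
  have scE b k : scans_bit b T (store_scan K x w (S k)) =
      (k < n) && (nth false (input x w t) k == b).
    by rewrite (@scans_bitE _ _ k) /= ?eqxx ?content_input //; lia.
  have h1 : spec (shifts [::] [:: T]) (r, o) 1 (S 0).
    by apply: (spec_ext (spec_shifts _ _ _ _)) => // j; cases_reg.
  have h2 : spec (cwhile (fun s => scans_bit true T s || scans_bit false T s)
      (shifts [::] [:: T; d])) (S 0) (n * 3).+1 (S n).
    apply: spec_while => [k lk|]; rewrite !scE ?ltnn // lk; split; first by case: nth.
    by apply: (spec_ext (spec_shifts _ _ _ _)) => // j; cases_reg.
  have h3 : spec (drain K T (shift [:: T] [::])) (S n) (3 * n.+1).+1 (upd r d n, o ++ [::]).
    apply: (spec_ext (spec_drain_shift _ _ _ _ _)); rewrite ?inE ?eqxx ?cats0 //;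
      solve_reg rB rr r0.
  by apply: (spec_ext (spec_seq h1 (spec_seq h2 h3))) => //; lia.
- have rd := r0 d (leqnn _); have lv := eval_value_bound rB.
  apply: (spec_ext (spec_seq (IHa d r r' o B _ _ _ _ _ _ _ _)
    (spec_seq (spec_emit _ _ _ _ _) (spec_drain_shift _ _ _ _ _))));
    rewrite ?inE ?eqxx //; try solve_reg rB rr r0.
  by rewrite /= /upd eqxx rcons_cat.
Qed.
End Compiler.

(** * Complete programs *)

Section Program.

Variable K : nat.
Hypothesis K2 : 2 <= K.
Notation scans := {ffun 'I_K.+1 -> marked}.
Notation tapes := {ffun 'I_K.+1 -> tape unit}.

Definition read_bit (s : marked) := if s is Some (inl _) then true else false.

(** Tape 0 carries [x] but has to become the output tape, so [x] will be copied to tape 2. On tape 1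
    the marker belongs to the left of [w], which takes two steps: move left, then write. *)
Definition place_markers : component K :=
  cseq (cone (fun s => [ffun i : 'I_K.+1 => match nat_of_ord i with
          | 0 => (s i, Stay) | 1 => (s i, Lft) | 2 => (marker, Rgt) | _ => (marker, Stay)
        end]))
       (cone (fun s => [ffun i : 'I_K.+1 =>
          if i == 1 :> nat then (marker, Stay) else (s i, Stay)])).

Definition copy_input : component K :=
  cwhile (fun s => read_bit (s ord0))
    (cone (fun s => [ffun i : 'I_K.+1 => match nat_of_ord i with
       | 0 => (s i, Rgt) | 2 => (s ord0, Rgt) | _ => (s i, Stay) end])).

(** The head of tape 0 has just passed [x], which stays behind: nothing to the left of a marker is
    ever looked at. *)
Definition open_output : component K :=
  cone (fun s => [ffun i : 'I_K.+1 => if i == ord0 then (marker, Rgt) else (s i, Stay)]).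

Definition load_input : component K :=
  cseq (cseq place_markers (cseq copy_input open_output))
       (drain K 2 (shift [:: 2] [::])).

Definition rewind_output : component K :=
  cseq (cwhile (fun s => s ord0 != marker)
         (cone (fun s => [ffun i : 'I_K.+1 =>
            (s i, if i == ord0 then Lft else Stay)])))
       (cone (fun s => [ffun i : 'I_K.+1 =>
            (s i, if i == ord0 then Rgt else Stay)])).

Definition run_program (e : expr) : component K :=
  cseq load_input (cseq (code K e (var_bound e).+3) rewind_output).

Variables x w : seq bool.

Lemma content_reg i : content x w i.+3 = [::].
Proof. by rewrite /content /= nth_nil. Qed.

Definition initial (ts : tapes) : Prop :=
  forall i : 'I_K.+1, ts i = ([::], [seq Some (inl b) | b <- nth [::] [:: x; w] i]).

Definition loading (k : nat) (ts : tapes) : Prop :=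
  (forall j, nth None (ts ord0).2 j = nth None [seq Some (inl b) | b <- x] (k + j)) /\
  forall i : 'I_K.+1, i != ord0 -> holds (ts i) (
    if i == 2 :> nat then (take k x, (size (take k x)).+1) else (content x w i, 0)).

Definition finished (o : seq bool) (p : nat) (ts : tapes) : Prop :=
  holds (ts ord0) (o, p).

Lemma idledE (ts : tapes) i : idled ts i = write_move (ts i) (scanned (ts i), Stay).
Proof. by rewrite !ffunE. Qed.

Lemma nth_idle (t : tape unit) k :
  nth None (write_move t (scanned t, Stay)).2 k = nth None t.2 k.
Proof. by case: t k => l [|s r] [|k] //=; rewrite !nth_nil. Qed.

Lemma stable_loading k : stable (loading k).
Proof.
move=> ts [H1 H2]; split=> [j|i ni]; rewrite idledE; last exact/holds_idle/H2.
by rewrite nth_idle.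
Qed.

Lemma stable_finished o p : stable (finished o p).
Proof. by move=> ts H; rewrite /finished idledE; apply: holds_idle. Qed.

Lemma triple_place_markers : triple place_markers initial 3 (loading 0).
Proof.
pose mid (ts : tapes) := exists2 ts0 : tapes, initial ts0 &
  (forall k, nth None (ts ord0).2 k = nth None (ts0 ord0).2 k) /\
  forall i : 'I_K.+1, i != ord0 -> if i == 1 :> nat then
    (forall k, nth None (ts i).2 k.+1 = nth None (ts0 i).2 k)
  else holds (ts i) ([::], i == 2 :> nat : nat).
have smid : stable mid.
  move=> ts [ts0 I [H0 H]]; exists ts0 => //; split=> [k|i ni].
    by rewrite idledE nth_idle.
  rewrite idledE; have := H i ni; case: eqP => _; last exact: holds_idle.
  by move=> H1 k; rewrite nth_idle.
apply: (triple_seq (t1 := 1) (t2 := 1) smid); apply: triple_cone => ts.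
  move=> I; exists ts => //; split=> [k|i]; rewrite !ffunE I.
    by rewrite -I nth_idle.
  case: i => -[|[|[|i]]] //= li _; rewrite ?I /scanned /=.
  + by case=> [|k]; case: (w) => //= *; rewrite ?nth_nil.
  + by split=> [k|[|k]] //=; rewrite /cell nth_nil.
  + by split=> // -[|k] //=; rewrite /cell nth_nil.
move=> [ts0 I [H0 H]]; split=> [k|i ni]; rewrite !ffunE.
  by rewrite nth_idle H0 I.
have := H i ni; case: i ni => -[|[|[|i]]] //= li _.
- rewrite I /=; case: (ts _) => l r /= H1; split=> // -[|k] //=.
  by rewrite nth_behead H1.
- by move/holds_idle; rewrite take0.
- by move/holds_idle; rewrite content_reg.
Qed.

Lemma triple_copy_input :
  triple copy_input (loading 0) (size x * 3).+1 (loading (size x)).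
Proof.
apply: (triple_while (t := 1)) => [|k lk|ts [H _]]; first exact: stable_loading.
  split=> [ts [H _]|]; first by rewrite ffunE /scanned -nth0 H addn0 (nth_map false).
  apply: triple_cone => ts [H1 H2].
  have sc : scanned (ts ord0) = Some (inl (nth false x k)).
    by rewrite /scanned -nth0 H1 addn0 (nth_map false).
  split=> [j|i ni]; rewrite !ffunE.
    by rewrite /=; case: (ts ord0) H1 => l r /= H1; rewrite nth_behead H1 addnS.
  have := H2 i ni; case: i ni => -[|[|[|i]]] //= li _; try exact: holds_idle.
  move/(@holds_append _ _ (nth false x k)); by rewrite -take_nth // sc.
by rewrite ffunE /scanned -nth0 H addn0 nth_default // size_map.
Qed.

Lemma triple_open_output : triple open_output (loading (size x)) 1
  (fun ts => rep x w ts (fun i => if i == 2 then (size x).+1 else 0, [::])).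
Proof.
apply: triple_cone => ts [H1 H2] i; rewrite !ffunE /at_tape.
case: eqP => [->|/eqP ni] /=.
  split=> [k|[|k]] //=; case: (ts ord0) H1 => l r //= H1.
  by rewrite nth_behead H1 nth_default ?size_map ?leq_addr // addnC /cell /= nth_nil.
case: ifP => [/eqP e|_]; first by case/eqP: ni; apply/val_inj.
by apply: holds_idle; have := H2 i ni; case: eqP => [->|_]; rewrite ?take_size.
Qed.

Lemma triple_load_input : triple load_input initial (6 * size x + 20)
  (fun ts => rep x w ts (fun=> 0, [::])).
Proof.
have d : spec x w (drain K 2 (shift [:: 2] [::]))
    (fun i => if i == 2 then (size x).+1 else 0, [::]) (3 * (size x).+1).+1 (fun=> 0, [::]).
  apply: (spec_ext (@spec_drain_shift K x w 2 [:: 2] [::] _ _ _ _)) => //=.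
  by move=> i; rewrite !inE; case: eqP => _ //=; rewrite subnn.
have stl := @stable_loading; have rst s : @stable K (fun ts => rep x w ts s).
  by move=> ts; apply: rep_idled.
have [H] := triple_seq (rst _) (triple_seq (stl _) triple_place_markers
  (triple_seq (stl _) triple_copy_input triple_open_output)) d.
split=> ts I; have [ts' [t' [l E R]]] := H ts I.
by exists ts', t'; split=> //; apply: leq_trans l _; lia.
Qed.

Lemma leading_bits_map (A : finType) (o : seq bool) (s : seq (symbol A)) :
  (forall k, nth None s k = nth None [seq Some (inl b) | b <- o] k) -> leading_bits s = o.
Proof.
elim: o s => [|b o IH] [|s0 s] H //=.
- by have /= := H 0; case: s0 H => [[]|].
- by have := H 0.
- have /= -> := H 0; by rewrite IH // => k; apply: (H k.+1).
Qed.

Lemma triple_rewind_output r o : triple rewind_output (fun ts => rep x w ts (r, o))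
  (3 * size o + 10) (fun ts => leading_bits (ts ord0).2 = o).
Proof.
have loop : triple (cwhile (fun s => s ord0 != marker)
   (cone (fun s => [ffun i : 'I_K.+1 => (s i, if i == ord0 then Lft else Stay)])))
   (finished o (size o).+1) ((size o).+1 * 3).+1 (finished o 0).
  have := @triple_while K (fun s => s ord0 != marker)
   (cone (fun s => [ffun i : 'I_K.+1 => (s i, if i == ord0 then Lft else Stay)]))
   (size o).+1 1 (fun k => finished o ((size o).+1 - k)).
  rewrite subn0 subnn; apply=> [k|k lk|ts H].
  - exact: stable_finished.
  - split=> [ts H|]; first by rewrite ffunE (holds_scanned H) cell_marker /=; lia.
    apply: triple_cone => ts H; rewrite /finished !ffunE eqxx.
    have := holds_move Lft H; rewrite (holds_scanned H) /safe_move cell_marker /=.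
    have /negbTE -> : (size o).+1 - k != 0 by lia.
    by rewrite subnS.
  - by rewrite ffunE (holds_scanned H) cell_marker.
have last : triple (cone (fun s => [ffun i : 'I_K.+1 => (s i, if i == ord0 then Rgt else Stay)]))
    (finished o 0) 1 (fun ts => leading_bits (ts ord0).2 = o).
  apply: triple_cone => ts H; rewrite !ffunE eqxx; apply: leading_bits_map => k.
  by have [-> _] := holds_move Rgt H.
have [H] := triple_seq (@stable_finished _ _) loop last.
split=> ts R; have [|ts' [t' [l E Q]]] := H ts; first exact: (R ord0).
by exists ts', t'; split=> //; apply: leq_trans l _; lia.
Qed.

(** The final rewinding takes time proportional to the output, whose length the time bound dominates
    because each emitted bit is charged there. *)
Lemma size_output e r B : bounded_store x w (var_bound e) r B ->
  size (output x w e r) <= time_bound e B.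
Proof.
elim: e r B => //= [a IHa b IHb|a IHa b IHb|y a IHa b IHb|t a IHa|a IHa] r B H.
- have Ha : bounded_store x w (var_bound a) r B by apply: bounded_store_sub H; lia.
  have Hb : bounded_store x w (var_bound b) r B by apply: bounded_store_sub H; lia.
  by rewrite size_cat; have := IHa _ _ Ha; have := IHb _ _ Hb; lia.
- have Ha : bounded_store x w (var_bound a) r B by apply: bounded_store_sub H; lia.
  have Hb : bounded_store x w (var_bound b) r B by apply: bounded_store_sub H; lia.
  by rewrite size_cat; have := IHa _ _ Ha; have := IHb _ _ Hb; lia.
- have Ha : bounded_store x w (var_bound a) r B by apply: bounded_store_sub H; lia.
  have la := IHa _ _ Ha; have lv := eval_value_bound Ha.
  have /(_ _ (leqnn _)) : forall n, n <= eval x w a r ->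
      size (flatten [seq output x w b (upd r y i) | i <- iota 0 n]) <=
      n * time_bound b (B + value_bound a B).
    elim=> // n IH ln; rewrite flatten_iotaS size_cat mulSnr leq_add ?IH //; first exact: ltnW.
    by apply: IHb; apply: bounded_store_upd H; lia.
  have := leq_mul lv (leqnn (time_bound b (B + value_bound a B))).
  by rewrite size_cat !mulnDr; lia.
- by have := IHa _ _ H; lia.
- by rewrite size_rcons; have := IHa _ _ H; lia.
Qed.

Lemma triple_run_program e : reg_bound e (var_bound e).+3 <= K ->
  triple (run_program e) initial
    (6 * (size x + size w) + 4 * time_bound e (size x + size w) + 40)
    (fun ts => leading_bits (ts ord0).2 = output x w e (fun=> 0)).
Proof.
move=> eK; set B := size x + size w.
have bs : bounded_store x w (var_bound e) (fun=> 0) B by split; rewrite ?leq_addr ?leq_addl.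
have rst s : @stable K (fun ts => rep x w ts s) by move=> ts; apply: rep_idled.
have run := @spec_code K x w e (var_bound e).+3 (fun=> 0) (fun=> 0) [::] B (leqnn _) eK K2
  (fun _ _ => erefl) erefl erefl (fun _ _ => erefl) bs.
have [H] := triple_seq (rst _) triple_load_input
  (triple_seq (rst _) run (@triple_rewind_output _ _)).
split=> ts I; have [ts' [t' [l E Q]]] := H ts I.
exists ts', t'; split=> //; apply: leq_trans l _; rewrite cat0s.
by have := size_output bs; have := leq_addr (size w) (size x); rewrite -/B; lia.
Qed.

End Program.

Lemma iter_halting (M : machine) (c : config M) n : halting c.1 -> iter n (@step M) c = c.
Proof. by move=> h; elim: n => //= n ->; rewrite /step; case: c h => q ts /= ->. Qed.

(* Inputs [x] and [x; w] are treated at once: a missing [w] is an empty string. *)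
Theorem polytime_output e : exists M c d, forall inputs, size inputs <= 2 ->
  let x := nth [::] inputs 0 in let w := nth [::] inputs 1 in
  computes_within M inputs (poly_bound c d (size x + size w)) (output x w e (fun=> 0)).
Proof.
set K := maxn 2 (reg_bound e (var_bound e).+3).
have [c [d H]] : poly_bounded (fun B => 6 * B + 4 * time_bound e B + 40).
  have te := poly_bounded_time_bound e.
  by do ![exact: poly_bounded_const | exact: poly_bounded_id | assumption
    | apply: poly_bounded_add | apply: poly_bounded_mul].
exists (machine_of (run_program K e)), c, d => inputs s2 x w.
have K2 : 2 <= K by rewrite leq_maxl.
have [R] := @triple_run_program K K2 x w e (leq_maxr _ _).
have [|ts' [t' [l E Q]]] := R (init (machine_of (run_program K e)) inputs).2.
  move=> i; rewrite ffunE; congr (_, map _ _).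
  case: i => -[|[|i]] //= _; rewrite [RHS]nth_nil nth_default //.
  exact: leq_trans s2 _.
have [q hq Hq] := exec_iter E.
have lt := leq_trans l (H _); rewrite /computes_within -(subnK lt) iterD.
have -> : iter t' (@step _) (init (machine_of (run_program K e)) inputs) = (q, ts') := Hq.
by rewrite iter_halting.
Qed.

(** * Derived operations *)

(** Derived operations may duplicate their arguments, as [Eq] does, and would duplicate output as
    well; they are applied to expressions without output only. *)
Fixpoint pure (e : expr) : bool :=
  match e with
  | Var _ | One | Len _ => true
  | Add a b | Monus a b | Sum _ a b => pure a && pure b
  | Bit _ a => pure a
  | Out _ => false
  end.

Lemma output_pure x w e r : pure e -> output x w e r = [::].
Proof.
elim: e r => //= [a IHa b IHb|a IHa b IHb|y a IHa b IHb] r.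
- by case/andP=> /IHa-> /IHb->.
- by case/andP=> /IHa-> /IHb->.
- by case/andP=> /IHa-> pb; elim: iota => //= i s ->; rewrite IHb.
Qed.

Lemma polytime_output1 e : polytime (fun x => output x [::] e (fun=> 0)).
Proof.
have [M [c [d H]]] := polytime_output e.
by exists M, c, d => x; have := H [:: x] isT; rewrite /= addn0.
Qed.

Lemma polytime_eval e : pure e -> polytime_rel (fun x w => eval x w e (fun=> 0) != 0).
Proof.
move=> pe; have [M [c [d H]]] := polytime_output (Out e).
by exists M, c, d => x w; have := H [:: x; w] isT; rewrite /= output_pure.
Qed.

Definition Zero := Monus One One.
Definition Const n := iter n (Add One) Zero.
Definition Not a := Monus One a.
Definition And a b := Not (Add (Not a) (Not b)).
Definition Or a b := Not (Not (Add a b)).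
Definition Le a b := Not (Monus a b).
Definition Lt a b := Le (Add a One) b.
Definition Eq a b := And (Le a b) (Le b a).

(* The bound variable is chosen fresh for the two arguments. *)
Definition Mul a b := Sum (var_bound b) a b.
(** The quotient is the number of positive multiples of [b] that are at most [a]; the first factor
    enforces the value 0 for [b = 0]. *)
Definition Div a b :=
  let x := maxn (var_bound a) (var_bound b) in
  Mul (Not (Not b)) (Sum x a (Le (Mul (Add (Var x) One) b) a)).
Definition Mod a b := Monus a (Mul (Div a b) b).
Definition If c a b := Add (Mul (Not (Not c)) a) (Mul (Not c) b).
Definition Exp a n := iter n (Mul a) One.
(** Arbitrary finite data, such as the transitions of a machine, enter an expression through such a
    lookup. *)
Definition Table s (f : nat -> expr) e :=
  foldr (fun a t => Add (Mul (Eq e (Const a)) (f a)) t) Zero (iota 0 s).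

Lemma sum_ltn_ord n m : m <= n -> \sum_(i < n) ((i < m) : nat) = m.
Proof.
move=> l; have E : \sum_(i < n) ((i < m) : nat) = minn m n; last by rewrite E; lia.
by elim: n {l} => [|n IH]; [rewrite big_ord0 minn0|rewrite big_ord_recr /= IH; lia].
Qed.

Arguments eval : simpl never.

Section Derived.

Variables x w : seq bool.
Notation ev e r := (eval x w e r).

Lemma eval_fresh e y v r : var_bound e <= y -> ev e (upd r y v) = ev e r.
Proof.
move=> l; apply: (proj1 (eval_ext _ _ _)) => k lk; rewrite /upd; case: eqP => // ek.
by rewrite ek ltnNge l in lk.
Qed.

Lemma evalVar i r : ev (Var i) r = r i. Proof. by []. Qed.
Lemma evalOne r : ev One r = 1. Proof. by []. Qed.
Lemma evalAdd a b r : ev (Add a b) r = ev a r + ev b r. Proof. by []. Qed.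
Lemma evalMonus a b r : ev (Monus a b) r = ev a r - ev b r. Proof. by []. Qed.
Lemma evalSum y a b r : ev (Sum y a b) r = \sum_(i < ev a r) ev b (upd r y i).
Proof. by []. Qed.
Lemma evalBit t a r : ev (Bit t a) r = nth false (input x w t) (ev a r).
Proof. by []. Qed.
Lemma evalLen t r : ev (Len t) r = size (input x w t). Proof. by []. Qed.
Lemma evalZero r : ev Zero r = 0. Proof. by []. Qed.

Lemma evalConst n r : ev (Const n) r = n.
Proof. by elim: n => // n IH; rewrite /Const iterS evalAdd -/(Const n) IH. Qed.

Lemma evalNot a r : ev (Not a) r = (ev a r == 0).
Proof. by rewrite /Not evalMonus evalOne; case: (ev a r) => [|[]]. Qed.

Lemma evalAnd a b r : ev (And a b) r = (ev a r != 0) && (ev b r != 0).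
Proof. by rewrite /And !evalNot evalAdd !evalNot; case: (ev a r) (ev b r) => [|?] []. Qed.

Lemma evalOr a b r : ev (Or a b) r = (ev a r != 0) || (ev b r != 0).
Proof. by rewrite /Or !evalNot evalAdd; case: (ev a r) (ev b r) => [|?] []. Qed.

Lemma evalLe a b r : ev (Le a b) r = (ev a r <= ev b r).
Proof. by rewrite /Le evalNot. Qed.

Lemma evalLt a b r : ev (Lt a b) r = (ev a r < ev b r).
Proof. by rewrite /Lt evalLe evalAdd evalOne addn1. Qed.

Lemma evalEq a b r : ev (Eq a b) r = (ev a r == ev b r).
Proof. by rewrite /Eq evalAnd !evalLe [in RHS]eqn_leq; case: (ev a r <= ev b r); case: (ev b r <= ev a r). Qed.

Lemma evalMul a b r : ev (Mul a b) r = ev a r * ev b r.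
Proof.
rewrite evalSum (eq_bigr (fun=> ev b r)) => [|i _]; last exact: eval_fresh.
by rewrite sum_nat_const card_ord.
Qed.

Lemma evalDiv a b r : ev (Div a b) r = ev a r %/ ev b r.
Proof.
rewrite evalMul !evalNot evalSum; case: (posnP (ev b r)) => [e|b0]; first by rewrite e divn0.
rewrite mul1n.
rewrite (eq_bigr (fun i : 'I_(ev a r) => (i < ev a r %/ ev b r) : nat)) => [|i _].
  by rewrite sum_ltn_ord // leq_div.
rewrite evalLe evalMul evalAdd evalVar evalOne addn1 !eval_fresh ?leq_maxl ?leq_maxr //.
by rewrite /upd eqxx leq_divRL.
Qed.

Lemma evalMod a b r : ev (Mod a b) r = ev a r %% ev b r.
Proof.
by rewrite evalMonus evalMul evalDiv {1}(divn_eq (ev a r) (ev b r)) addKn.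
Qed.

Lemma evalIf c a b r : ev (If c a b) r = if ev c r != 0 then ev a r else ev b r.
Proof.
rewrite evalAdd !evalMul !evalNot; case: (ev c r == 0) => /=.
  by rewrite mul0n mul1n.
by rewrite mul0n mul1n addn0.
Qed.

Lemma evalExp a n r : ev (Exp a n) r = ev a r ^ n.
Proof. by elim: n => // n IH; rewrite /Exp iterS evalMul -/(Exp a n) IH expnS. Qed.

Lemma evalTable s f e r : ev (Table s f e) r =
  if ev e r < s then ev (f (ev e r)) r else 0.
Proof.
rewrite /Table; transitivity (if ev e r \in iota 0 s then ev (f (ev e r)) r else 0).
  elim: (iota 0 s) (iota_uniq 0 s) => //= a t IH /andP[at_ ut].
  rewrite evalAdd evalMul evalEq evalConst IH // inE.
  by case: eqP => [->|_] /=; rewrite ?mul1n ?mul0n // (negbTE at_) addn0.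
by rewrite mem_iota.
Qed.

End Derived.

Lemma pureConst n : pure (Const n). Proof. by elim: n. Qed.
Lemma pureExp a n : pure a -> pure (Exp a n).
Proof. by move=> pa; elim: n => // n IH; rewrite /Exp /= pa. Qed.
Lemma pureTable s f e : pure e -> (forall a, pure (f a)) -> pure (Table s f e).
Proof.
move=> pe pf; rewrite /Table; elim: (iota 0 s) => //= a t ->.
by rewrite pe pf pureConst.
Qed.

(* More derived operations come first, since they unfold to the others. *)
Definition evalE := (evalTable, evalIf, evalMod, evalDiv, evalExp, evalMul, evalEq,
  evalLt, evalLe, evalOr, evalAnd, evalNot, evalConst, evalZero,
  evalVar, evalOne, evalAdd, evalMonus, evalSum, evalBit, evalLen).

(** A positive number is a power of 2 when 1 is its only odd divisor. This is a bounded search,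
    whereas powers with a variable exponent would leave the polynomially bounded language. *)
Definition pow2 (n : nat) := (0 < n) &&
  [forall z : 'I_n.+1, ((z : nat) %| n) && odd z ==> (z == 1 :> nat)].

Lemma pow2P n : reflect (exists k, n = 2 ^ k) (pow2 n).
Proof.
apply: (iffP andP) => [[n0 /forallP H]|[k ->]].
  have [//|m cm en] := pfactor_coprime (p := 2) _ n0.
  exists (logn 2 n); rewrite {1}en; have odm : odd m by rewrite -coprime2n.
  have lm : m < n.+1 by rewrite ltnS dvdn_leq // en dvdn_mulr.
  by have := H (Ordinal lm); rewrite /= odm {1}en dvdn_mulr //= => /eqP ->; rewrite mul1n.
rewrite expn_gt0; split=> //; apply/forallP=> -[z lz] /=; apply/implyP => /andP[zd oz].
have : coprime z (2 ^ k) by rewrite coprimeXr // coprimen2.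
by rewrite /coprime; move/gcdn_idPl: zd => ->.
Qed.

Lemma pow2_iota K :
  [seq y <- iota 1 K | pow2 y] = [seq 2 ^ i | i <- iota 0 (up_log 2 K.+1)].
Proof.
apply: (irr_sorted_eq ltn_trans ltnn).
- by apply: sorted_filter; [exact: ltn_trans|exact: iota_ltn_sorted].
- rewrite sorted_map; apply: sub_sorted (iota_ltn_sorted _ _) => i j /= l.
  by rewrite ltn_exp2l.
move=> y; rewrite mem_filter mem_iota add1n ltnS; apply/idP/mapP => [|[i]].
  case/andP=> /pow2P[k ->] /andP[_ lk]; exists k => //.
  rewrite mem_iota add0n /=; rewrite ltnNge; apply/negP => le.
  have := up_logP (p := 2) K.+1 isT; rewrite ltnNge => /negP; apply.
  by apply: leq_trans lk; rewrite leq_exp2l.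
rewrite mem_iota add0n /= => li ->; rewrite expn_gt0 /=.
apply/andP; split; first by apply/pow2P; exists i.
rewrite leqNgt; apply/negP => l; have := up_log_min (p := 2) isT l.
by rewrite leqNgt li.
Qed.

Lemma size_pow2 k : count pow2 (iota 0 (2 ^ k)) = k.
Proof.
rewrite -(prednK (expn_gt0 2 k : 0 < 2 ^ k)) /= add0n -size_filter pow2_iota.
by rewrite size_map size_iota prednK ?expn_gt0 // up_expnK.
Qed.

Lemma bits_pow2 K : bits K = [seq odd (K %/ y) | y <- iota 1 K & pow2 y].
Proof. by rewrite pow2_iota -map_comp. Qed.

Lemma nth_bits K i : nth false (bits K) i = odd (K %/ 2 ^ i).
Proof.
case: (ltnP i (up_log 2 K.+1)) => l; first by rewrite nth_mkseq.
rewrite nth_default ?size_mkseq // divn_small //.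
by apply: (@leq_trans (2 ^ up_log 2 K.+1)); [exact: up_logP|rewrite leq_exp2l].
Qed.

Lemma sum_bits K m : K < 2 ^ m -> \sum_(i < m) odd (K %/ 2 ^ i) * 2 ^ i = K.
Proof.
elim: m K => [|m IH] K; first by rewrite big_ord0; case: K.
rewrite expnS => lK; rewrite big_ord_recl expn0 divn1 muln1 /=.
rewrite -[RHS]odd_double_half; congr (_ + _).
rewrite -[in RHS](IH K./2); last by rewrite -divn2 ltn_divLR // mulnC.
rewrite -muln2 big_distrl /=; apply: eq_bigr => i _.
by rewrite /bump /= add1n expnS divnMA divn2 -mulnA (mulnC 2).
Qed.

(** * Chromatic Sum is in NP *)

Lemma sum_count (T : Type) (p : pred T) s : \sum_(i <- s) (p i : nat) = count p s.
Proof. by rewrite -big_mkcond /= sum1_count. Qed.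

Lemma sum_ord_iota n (F : nat -> nat) : \sum_(i < n) F i = \sum_(i <- iota 0 n) F i.
Proof. by rewrite -(big_mkord xpredT F) /index_iota subn0. Qed.

(** A logarithm by counting powers of 2: the exponent of [n] when [n] is such a power, and the
    binary length of [s] when [n = s + 1]. *)
Definition log_below n := \sum_(i < n) (pow2 i : nat).

Lemma log_belowE n : log_below n.+1 = up_log 2 n.+1.
Proof.
by rewrite /log_below (sum_ord_iota _ (fun i => pow2 i : nat)) sum_count /= add0n -size_filter pow2_iota size_map size_iota.
Qed.

Lemma log_below_pow2 i : log_below (2 ^ i) = i.
Proof. by rewrite /log_below (sum_ord_iota _ (fun i => pow2 i : nat)) sum_count size_pow2. Qed.

(* Compares a number given in unary with one given by its bits: the powers of 2
   exceeding [s] cannot be summed up, but one of them suffices. *)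
Lemma leq_bits s K m : K < 2 ^ m ->
  (s <= \sum_(y < s.+1) pow2 y * y * odd (K %/ 2 ^ log_below y) +
        \sum_(i < m) odd (K %/ 2 ^ i) * (log_below s.+1 <= i) * s) = (s <= K).
Proof.
move=> lK; set L := log_below s.+1.
have low : \sum_(y < s.+1) pow2 y * y * odd (K %/ 2 ^ log_below y) =
    \sum_(i < L) odd (K %/ 2 ^ i) * 2 ^ i.
  rewrite (sum_ord_iota _ (fun y => pow2 y * y * odd (K %/ 2 ^ log_below y))).
  rewrite (sum_ord_iota _ (fun i => odd (K %/ 2 ^ i) * 2 ^ i)) /= big_cons mul0n add0n.
  rewrite /L log_belowE -(big_map (fun i => 2 ^ i) xpredT
    (fun y => odd (K %/ y) * y)) -pow2_iota big_filter [RHS]big_mkcond /=.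
  apply: eq_bigr => y _; case: pow2P => [[i ->]|_]; last by rewrite !mul0n.
  by rewrite log_below_pow2 mul1n mulnC.
have sL : s < 2 ^ L by rewrite /L log_belowE; apply: up_logP.
(* A digit 1 of [K] at or beyond the binary length of [s] makes both sides true: the second sum then
   contributes at least [s]. *)
rewrite low; have [/existsP[i /andP[Li bi]]|] := boolP [exists i : 'I_m, (L <= i) && odd (K %/ 2 ^ i)].
  rewrite (bigD1 i) //= bi Li !mul1n; symmetry.
  rewrite (_ : s <= K) ?(leq_trans (leq_addr _ _) (leq_addl _ _)) //.
  have : 0 < K %/ 2 ^ i by case: (K %/ _) bi.
  rewrite divn_gt0 ?expn_gt0 // => /(leq_trans _); apply.
  by apply: leq_trans (ltnW sL) _; rewrite leq_exp2l.
rewrite negb_exists => /forallP nb; rewrite [X in _ + X]big1 => [|i _]; last first.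
  by have := nb i; rewrite negb_and; case: leqP => /= _; [move/negbTE ->|rewrite muln0].
rewrite addn0; congr (_ <= _).
rewrite -[RHS](@sum_bits _ (L + m)); last first.
  by apply: leq_trans lK _; rewrite leq_exp2l // leq_addl.
rewrite big_split_ord /= [X in _ = _ + X]big1 ?addn0 // => i _.
have [lm|lm] := ltnP (L + i) m.
  by have := nb (Ordinal lm); rewrite /= leq_addr /= => /negbTE ->.
by rewrite divn_small //; apply: leq_trans lK _; rewrite leq_exp2l.
Qed.

(** * The verifier as an expression *)

Definition LeadE := Sum 0 (Len true) (Not (Sum 1 (Add (Var 0) One) (Not (Bit true (Var 1))))).
Definition AdjE u v := Bit true (Add (Add LeadE One) (Add (Mul u LeadE) v)).
Definition ColourE u := Add One (Sum 2 LeadE (Bit false (Add (Mul u LeadE) (Var 2)))).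
Definition ClashE := Sum 3 LeadE (Sum 4 LeadE
  (And (AdjE (Var 3) (Var 4)) (Eq (ColourE (Var 3)) (ColourE (Var 4))))).
Definition CostE := Sum 3 LeadE (ColourE (Var 3)).
Definition Pow2E a := let z := var_bound a in
  And a (Not (Sum z (Add a One)
    (And (Lt One (Var z)) (And (Mod (Var z) (Const 2)) (Not (Mod a (Var z))))))).
Definition SignPosE := Add (Add LeadE One) (Mul LeadE LeadE).
Definition TargetE a := Bit true (Add (Add SignPosE One) a).
Definition LogE a := let z := var_bound a in Sum z a (Pow2E (Var z)).
(** [LowE] and [HighE] are the two sums of [leq_bits], with the cost for [s] and the input length
    for [m], which is at least the number of binary digits of the target. *)
Definition LowE := Sum 5 (Add CostE One)
  (Mul (Mul (Pow2E (Var 5)) (Var 5)) (TargetE (LogE (Var 5)))).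
Definition HighE := Sum 5 (Len true)
  (Mul (Mul (TargetE (Var 5)) (Le (LogE (Add CostE One)) (Var 5))) CostE).
Definition AcceptE :=
  And (Not ClashE) (And (Not (Bit true SignPosE)) (Le CostE (Add LowE HighE))).

Lemma nth_allpairs (S T R : Type) (f : S -> T -> R) s t z a b i j :
  i < size s -> j < size t ->
  nth z [seq f u v | u <- s, v <- t] (i * size t + j) = f (nth a s i) (nth b t j).
Proof.
move=> + lj; elim: s i => // u s IH [|i] li; rewrite allpairs_cons nth_cat size_map.
  by rewrite mul0n add0n lj (nth_map b).
by rewrite mulSn -addnA ltnNge leq_addr /= addKn IH.
Qed.

Lemma upd_eq r y v : upd r y v y = v. Proof. by rewrite /upd eqxx. Qed.

Section Verifier.

Variables x w : seq bool.
Notation ev e r := (eval x w e r).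

Lemma evalPow2E a r : ev (Pow2E a) r = pow2 (ev a r).
Proof.
rewrite /Pow2E !evalE addn1 /pow2 lt0n; case: eqP => //= _.
rewrite eqb0 negbK sum_nat_eq0; congr (nat_of_bool _).
apply: eq_forallb => -[z lz] /=; rewrite !evalE upd_eq eval_fresh // modn2.
rewrite /dvdn.
by case: z lz => [|[|z]] lz; rewrite ?andbF ?implybT //; case: (odd _); case: (_ %% _ == 0).
Qed.

Lemma evalLogE a r : ev (LogE a) r = log_below (ev a r).
Proof. by rewrite /LogE evalE; apply: eq_bigr => i _; rewrite evalPow2E evalE upd_eq. Qed.

Variables (n K : nat) (s : seq bool) (G : rel 'I_n) (sign : bool).
Hypothesis xE : x = nseq n true ++ false ::
  [seq G u v | u <- enum 'I_n, v <- enum 'I_n] ++ sign :: bits K.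

Lemma n_le_x : n <= size x.
Proof. by rewrite xE size_cat size_nseq leq_addr. Qed.

Lemma nth_lead k : k <= n -> nth false x k = (k < n).
Proof.
move=> lk; rewrite xE nth_cat size_nseq nth_nseq; case: ltnP => // le.
by rewrite (_ : k - n = 0) //; lia.
Qed.

Lemma evalLeadE r : ev LeadE r = n.
Proof.
rewrite evalE /= (eq_bigr (fun i : 'I_(ev (Len true) r) => (i < n) : nat)) => [|i _].
  by rewrite sum_ltn_ord // evalLen n_le_x.
rewrite !evalE sum_nat_eq0 upd_eq addn1; congr (nat_of_bool _).
apply/forallP/idP => [H|li j].
  rewrite ltnNge; apply/negP => le.
  have lt : n < i.+1 by [].
  by have := H (Ordinal lt); rewrite !evalE upd_eq /= nth_lead // ltnn.
have lj : j < n by apply: leq_trans (ltn_ord j) li.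
by rewrite !evalE upd_eq /= nth_lead ?lj // ltnW.
Qed.

Lemma nth_adj (i j : 'I_n) :
  nth false [seq G u v | u <- enum 'I_n, v <- enum 'I_n] (i * n + j) = G i j.
Proof.
have sz : size (enum 'I_n) = n by rewrite -cardT card_ord.
by have := nth_allpairs G (s := enum 'I_n) (t := enum 'I_n) false i j (i := i) (j := j); rewrite sz !nth_ord_enum; apply.
Qed.

Lemma evalAdjE (u v : 'I_n) r a b : ev a r = u -> ev b r = v -> ev (AdjE a b) r = G u v.
Proof.
move=> ea eb; rewrite evalBit !evalAdd evalMul !evalLeadE evalOne ea eb /= xE nth_cat size_nseq.
rewrite ifN; last by rewrite -leqNgt; lia.
rewrite (_ : n + 1 + (u * n + v) - n = (u * n + v).+1) /=; last lia.
rewrite nth_cat size_allpairs -!cardT card_ord ifT; first by rewrite nth_adj.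
by have := ltn_ord u; have := ltn_ord v; nia.
Qed.

Definition row_colour (u : nat) := 1 + \sum_(j < n) (nth false w (u * n + j) : nat).

Lemma evalColourE i r : i != 2 -> ev (ColourE (Var i)) r = row_colour (r i).
Proof.
move=> i2; rewrite evalAdd evalSum evalLeadE; congr (_ + _); apply: eq_bigr => j _.
by rewrite evalBit evalAdd evalMul evalLeadE !evalVar upd_eq /upd (negbTE i2).
Qed.

Definition cost := \sum_(u < n) row_colour u.

Lemma evalCostE r : ev CostE r = cost.
Proof. by rewrite evalE evalLeadE; apply: eq_bigr => u _; rewrite evalColourE // upd_eq. Qed.

Lemma evalClashE r : (ev ClashE r == 0) =
  [forall u : 'I_n, forall v : 'I_n, ~~ (G u v && (row_colour u == row_colour v))].
Proof.
rewrite evalE evalLeadE sum_nat_eq0; apply: eq_forallb => u /=.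
rewrite evalE evalLeadE sum_nat_eq0; apply: eq_forallb => v /=.
rewrite evalAnd evalEq !evalColourE // (evalAdjE (u := u) (v := v)) ?upd_eq //.
by rewrite /upd /=; case: (G u v) => //=; case: (row_colour u == row_colour v).
Qed.

Lemma evalSignPosE r : ev SignPosE r = n + 1 + n * n.
Proof. by rewrite !evalAdd evalMul !evalLeadE. Qed.

Lemma evalSign r : ev (Bit true SignPosE) r = sign.
Proof.
rewrite evalE evalSignPosE /= xE nth_cat size_nseq ifN; last by rewrite -leqNgt; lia.
rewrite (_ : n + 1 + n * n - n = (n * n).+1) /=; last lia.
by rewrite nth_cat size_allpairs -!cardT card_ord ltnn subnn.
Qed.

Lemma evalTargetE a r : ev (TargetE a) r = odd (K %/ 2 ^ ev a r).
Proof.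
have E : ev (Add (Add SignPosE One) a) r = n + 1 + n * n + 1 + ev a r.
  by rewrite -[n + 1 + n * n](evalSignPosE r).
rewrite evalBit E; move: (ev a r) => m; rewrite /= xE nth_cat size_nseq ifN; last by rewrite -leqNgt; lia.
rewrite (_ : n + 1 + n * n + 1 + m - n = (n * n + m.+1).+1) /=; last lia.
by rewrite nth_cat size_allpairs -!cardT card_ord ltnNge leq_addr /= addKn /= nth_bits.
Qed.

Lemma eval_bits r : ev (Le CostE (Add LowE HighE)) r = (cost <= K).
Proof.
rewrite evalLe evalAdd evalCostE -(@leq_bits cost K (size x)); last first.
  apply: leq_trans (up_logP (p := 2) K.+1 isT) _; rewrite leq_exp2l //.
  have := size_mkseq (fun i => odd (K %/ 2 ^ i)) (up_log 2 K.+1).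
  by rewrite -/(bits K) => <-; rewrite xE !size_cat /= !size_cat /=; lia.
congr (nat_of_bool (_ <= _ + _)); rewrite evalSum.
  rewrite evalAdd evalCostE evalOne addn1; apply: eq_bigr => i _.
  by rewrite !evalMul evalPow2E evalTargetE evalLogE evalVar upd_eq.
apply: eq_bigr => i _; rewrite !evalMul evalTargetE evalLe evalLogE evalAdd evalCostE.
by rewrite evalOne evalVar upd_eq addn1.
Qed.

Lemma evalAcceptE r : (ev AcceptE r != 0) =
  [&& [forall u : 'I_n, forall v : 'I_n, ~~ (G u v && (row_colour u == row_colour v))],
      ~~ sign & cost <= K].
Proof.
rewrite evalAnd evalNot evalClashE evalAnd evalNot evalSign eval_bits.
by case: [forall u, _]; case: sign; case: (_ <= _).
Qed.

End Verifier.

(** Each colour is replaced by its rank among the colours in use. Ranks are strictly monotone, which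
    preserves properness; they never exceed the original colour, as 0 is not in use, nor the number
    of vertices. *)
Lemma compress_colouring (T : finType) (G : sgraph T) (c : T -> nat) : colouring G c ->
  exists c', [/\ colouring G c', forall v, c' v <= #|T| & forall v, c' v <= c v].
Proof.
move=> [c1 cG]; pose im k := [exists u, c u == k].
pose c' v := \sum_(k < (c v).+1) (im k : nat).
have imc v : im (c v) by apply/existsP; exists v.
have im0 : im 0 = false by apply/existsP=> -[u /eqP e]; have := c1 u; rewrite e.
have mono u v : c u < c v -> c' u < c' v.
  move=> l; rewrite /c' [X in _ < X]big_ord_recr /= imc addn1 ltnS.
  rewrite -!(big_mkord xpredT (fun k => im k : nat)).
  by rewrite [X in _ <= X](big_cat_nat (n := (c u).+1)) //= leq_addr.
exists c'; split=> [|v|v].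
- split=> [v|u v uv]; first by rewrite /c' big_ord_recr /= imc addn1.
  by have := cG _ _ uv; rewrite !neq_ltn => /orP[] /mono->; rewrite ?orbT.
- rewrite /c' -big_mkcond sum1_card.
  have -> : #|[pred k : 'I_(c v).+1 | im k]| = #|[set (inord (c u) : 'I_(c v).+1) | u in [pred u | c u <= c v]]|.
    apply: eq_card => k; rewrite inE; apply/existsP/imsetP => [[u /eqP e]|[u]].
      exists u; first by rewrite inE e -ltnS.
      by apply/val_inj; rewrite /= inordK e // ltnS -ltnS.
    by rewrite inE => le ->; exists u; rewrite inordK.
  exact: leq_trans (leq_imset_card _ _) (max_card _).
- rewrite /c' big_ord_recl im0 add0n.
  by apply: leq_trans (leq_sum _ (fun i _ => leq_b1 _)) _; rewrite sum1_card card_ord.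
Qed.

Lemma size_encode_instance C (I : chromatic_sum_instance C) :
  nvertices I <= size (encode_instance I).
Proof. by rewrite size_cat size_nseq leq_addr. Qed.

Theorem chromatic_sum_in_NP C : in_NP (chromatic_sum C).
Proof.
exists (fun x w => eval x w AcceptE (fun=> 0) != 0), 1, 2; split; first exact: polytime_eval.
case=> n G CG t /=; set x := encode_instance _.
have nx : n <= size x by apply: size_encode_instance.
have acc w := @evalAcceptE x w n `|t|%N G (t < 0)%R erefl (fun=> 0).
have tK s : (s%:Z <= t)%R = ~~ (t < 0)%R && (s <= `|t|%N).
  by case: t {x nx acc} => t /=; lia.
split=> [[c [cG lc]]|[w [lw]]].
  have [c' [c'G c'n c'c]] := compress_colouring cG.
  (* Row [u] has its ones in the first [c' u - 1] columns, which exist because [c' u <= n]. The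
     default 0 is never reached, as [k %/ n < n]. *)
  pose w := mkseq (fun k => (k %% n).+1 < oapp c' 0 (insub (k %/ n))) (n * n).
  have row (u : 'I_n) : row_colour w n u = c' u.
    rewrite /row_colour (eq_bigr (fun j : 'I_n => (j.+1 < c' u) : nat)) => [|j _]; last first.
      have n0 : 0 < n by apply: leq_ltn_trans (ltn_ord u).
      have lj := ltn_ord j; have lu := ltn_ord u.
      by rewrite nth_mkseq ?modnMDl ?divnMDl ?modn_small ?divn_small ?addn0 ?valK //; nia.
    have [c1 _] := c'G; have := c'n u; rewrite card_ord => l.
    rewrite (eq_bigr (fun j : 'I_n => (j < (c' u).-1) : nat)) => [|j _]; last by lia.
    by rewrite sum_ltn_ord; have := c1 u; lia.
  exists w; split; first by rewrite size_mkseq /poly_bound mul1n -mulnn leq_mul // leqW.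
  rewrite acc; apply/and3P; move: lc; rewrite tK => /andP[t0 lc]; split=> //.
    apply/forallP=> u; apply/forallP=> v; rewrite !row; apply/negP => /andP[uv].
    by have [_ /(_ _ _ uv) /negbTE ->] := c'G.
  by apply: leq_trans lc; rewrite /cost (eq_bigr c') => [|u _]; [apply: leq_sum|rewrite row].
(* Any string describes positive colours, missing entries being read as zeros. *)
rewrite acc => /and3P[/forallP G1 t0 lc]; exists (row_colour w n); split.
  split=> [v|u v uv]; first by rewrite /row_colour.
  by have /forallP/(_ v) := G1 u; rewrite uv.
by rewrite tK t0.
Qed.

(** * From list colouring of complete bipartite graphs to Chromatic Sum *)

Lemma sum_ord_mul a b (F : nat -> nat) :
  \sum_(i < a * b) F i = \sum_(i < a) \sum_(j < b) F (i * b + j).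
Proof.
elim: a => [|a IH]; first by rewrite mul0n !big_ord0.
by rewrite big_ord_recr -IH mulSnr big_split_ord.
Qed.

Lemma sum_ord_add a b (F : nat -> nat) :
  \sum_(i < a + b) F i = \sum_(i < a) F i + \sum_(i < b) F (a + i).
Proof. by rewrite big_split_ord. Qed.

(** Count the pairs [i], [k < m] with [k < f i]: each [i] gives at most [f i] of them and each [k]
    at least [m - k], since no more than [k] distinct positive values are at most [k]. *)
Lemma sum_distinct m (f : nat -> nat) :
  (forall i, i < m -> 0 < f i) -> (forall i k, i < k < m -> f i != f k) ->
  m * m.+1 <= 2 * \sum_(i < m) f i.
Proof.
move=> f0 fi; have -> : m * m.+1 = 2 * \sum_(k < m) (m - k).
  elim: m {f0 fi} => [|m IH]; first by rewrite big_ord0.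
  by rewrite big_ord_recl mulnDr subn0 (eq_bigr (fun k : 'I_m => m - k)) // -IH; lia.
rewrite leq_mul2l /=; apply: (@leq_trans (\sum_(i < m) \sum_(k < m) (k < f i))).
  rewrite exchange_big; apply: leq_sum => k _ /=.
  have -> : \sum_(i < m) (k < f i) = m - #|[set i : 'I_m | f i <= k]|.
    have := cardsC [set i : 'I_m | f i <= k]; rewrite card_ord.
    have -> : \sum_(i < m) (k < f i) = #|~: [set i : 'I_m | f i <= k]|; last by lia.
    by rewrite -big_mkcond sum1_card; apply: eq_card => i; rewrite !inE -ltnNge.
  rewrite leq_sub2l //; case: (k : nat) => [|k'].
    rewrite leqn0 cards_eq0; apply/eqP/setP=> i; rewrite !inE.
    by apply/negbTE; rewrite -ltnNge f0.
  rewrite -[X in _ <= X]card_ord.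
  rewrite -(card_in_imset (f := fun i : 'I_m => inord (f i).-1 : 'I_k'.+1)) ?max_card //.
  move=> i j; rewrite !inE => li lj /(congr1 val); rewrite /= !inordK; last 2 first.
  - by have := f0 j (ltn_ord j); lia.
  - by have := f0 i (ltn_ord i); lia.
  move=> e; have {}e : f i = f j by have := f0 i (ltn_ord i); have := f0 j (ltn_ord j); lia.
  apply/val_inj/eqP; case: ltngtP => // lij.
    by have := fi i j; rewrite e eqxx lij ltn_ord => /(_ isT).
  by have := fi j i; rewrite e eqxx lij ltn_ord => /(_ isT).
apply: leq_sum => i _; have [le|lt] := leqP (f i) m; first by rewrite -{2}(sum_ltn_ord le).
apply: leq_trans (leq_sum _ (fun k _ => leq_b1 _)) _.
by rewrite sum1_card card_ord ltnW.
Qed.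

(* A complete bipartite graph with colour lists: the vertices [v < size] are
   divided by [side], and [allow v y] tells that colour [y < hues] is in the
   list of [v]. *)
Record lists := Lists {
  lsize : nat;
  hues : nat;
  side : pred nat;
  allow : nat -> nat -> bool
}.

Definition list_colourable (I : lists) := exists h : nat -> nat,
  (forall v, v < lsize I -> h v < hues I /\ allow I v (h v)) /\
  (forall u v, u < lsize I -> v < lsize I -> side I u -> ~~ side I v -> h u != h v).

Inductive node := Main of nat | Root of nat | Leaf of nat & nat & nat.

Section ListColouring.

Variable I : lists.
Notation m := (lsize I).
Notation D := (hues I).+1.

(* Colour [y] of the lists becomes colour [y.+2] of the graph; [c < D] stands
   for colour [c.+1]. *)
Definition permitted v c := (0 < c) && allow I v c.-1.

(* The gadget [t] of colour [c] at [v]: its root prefers colour [level_at v c t],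
   so a gadget of level [c.+1] charges 1 to [v] for having that colour. *)
Definition level_at v c t := if t < D - c.+1 + ~~ permitted v c then c.+1 else D.+1.

(** In base [D] a gadget number reads [(v, c, t)]: its owner, the colour index it serves and a copy
    number. *)
Definition owner g := g %/ D %/ D.
Definition level g := level_at (owner g) (g %/ D %% D) (g %% D).

Definition gadgets := m * D * D.
Definition gsize := (2 * D).+1.
Definition order := m + gadgets * gsize.

(** Indices follow the order of construction as a distance-hereditary graph: bipartite vertices,
    then the gadgets, each root before its two rows of [D] leaves. *)
Definition root_index g := m + g * gsize.
Definition leaf_index g b q := m + (g * gsize + (b * D + q).+1).

Definition decode i : node :=
  if i < m then Main i else
  let g := (i - m) %/ gsize in let s := (i - m) %% gsize in
  if s == 0 then Root g else Leaf g (s.-1 %/ D) (s.-1 %% D).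

Definition arc (x y : node) : bool :=
  match x, y with
  | Main u, Main v => side I u && ~~ side I v
  | Main u, Root g => owner g == u
  | Main u, Leaf g _ q => (owner g == u) && (level g <= q.+1)
  | Root g, Leaf g' _ q => (g == g') && (q.+1 < level g)
  | Leaf g b q, Leaf g' b' q' =>
      [&& g == g', b == b', q != q', q.+1 < level g & q'.+1 < level g]
  | _, _ => false
  end.

Definition edge i j := arc (decode i) (decode j) || arc (decode j) (decode i).

Lemma edge_sym : symmetric edge.
Proof. by move=> i j; rewrite /edge orbC. Qed.

Lemma edge_irr : irreflexive edge.
Proof.
move=> i; rewrite /edge orbb; case: decode => [v|g|g b q] //=; first by rewrite andbN.
by rewrite !eqxx.
Qed.

Definition list_graph : sgraph 'I_order :=
  @SGraph 'I_order (fun i j => edge i j) (fun i j => edge_sym i j) (fun i => edge_irr i).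

Lemma decode_main v : v < m -> decode v = Main v.
Proof. by rewrite /decode => ->. Qed.

Lemma decode_root g : decode (root_index g) = Root g.
Proof.
rewrite /decode /root_index ltnNge leq_addr /= addKn.
by rewrite mulnK // modnMl.
Qed.

Lemma decode_leaf g b q : b < 2 -> q < D -> decode (leaf_index g b q) = Leaf g b q.
Proof.
move=> lb lq; rewrite /decode /leaf_index ltnNge leq_addr /= addKn.
have ls : (b * D + q).+1 < gsize by rewrite /gsize; nia.
rewrite divnMDl // divn_small // addn0 modnMDl modn_small //=.
by rewrite divnMDl // divn_small // addn0 modnMDl modn_small.
Qed.

Variant index_spec i : node -> Prop :=
| IndexMain of i < m : index_spec i (Main i)
| IndexRoot g of g < gadgets & i = root_index g : index_spec i (Root g)
| IndexLeaf g b q of g < gadgets & b < 2 & q < D & i = leaf_index g b q :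
    index_spec i (Leaf g b q).

Lemma indexP i : i < order -> index_spec i (decode i).
Proof.
rewrite /order /decode => li; case: ltnP => [|le]; first exact: IndexMain.
have E := divn_eq (i - m) gsize; set g := _ %/ gsize in E *; set s := _ %% gsize in E *.
have ls : s < gsize by rewrite ltn_mod.
have lg : g < gadgets by rewrite ltn_divLR //; lia.
case: eqP => s0; first by apply: IndexRoot => //; rewrite /root_index; lia.
have E' := divn_eq s.-1 D; apply: IndexLeaf => //.
- by rewrite ltn_divLR // /gsize in ls *; lia.
- by rewrite ltn_mod.
- by rewrite /leaf_index -E'; lia.
Qed.

Lemma root_index_lt g : g < gadgets -> root_index g < order.
Proof. by move=> lg; rewrite ltn_add2l ltn_mul2r lg. Qed.

Lemma leaf_index_lt g b q : g < gadgets -> b < 2 -> q < D -> leaf_index g b q < order.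
Proof.
move=> lg lb lq; rewrite ltn_add2l.
have ls : (b * D + q).+1 < gsize by rewrite /gsize; nia.
by apply: (@leq_trans (g.+1 * gsize)); [rewrite mulSnr; lia|rewrite leq_mul2r lg orbT].
Qed.

Lemma main_index_lt v : v < m -> v < order.
Proof. by move=> l; apply: leq_trans l (leq_addr _ _). Qed.

Lemma sum_order (F : nat -> nat) : \sum_(i < order) F i = \sum_(v < m) F v +
  \sum_(g < gadgets) (F (root_index g) +
    \sum_(q < D) (F (leaf_index g 0 q) + F (leaf_index g 1 q))).
Proof.
rewrite /order sum_ord_add (sum_ord_mul _ _ (fun i => F (m + i))); congr (_ + _).
apply: eq_bigr => g _; rewrite [LHS]big_ord_recl; congr (F _ + _); first by rewrite /root_index /= addn0.
rewrite (sum_ord_mul 2 D (fun i => F (m + (g * gsize + i.+1)))).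
by rewrite big_ord_recr /= big_ord1 -big_split.
Qed.

Lemma owner_lt g : g < gadgets -> owner g < m.
Proof. by move=> lg; rewrite !ltn_divLR. Qed.

Lemma level_bounds g : 1 <= level g <= D.+1.
Proof. by rewrite /level /level_at; case: ifP => _ //=; have := ltn_pmod (g %/ D) (ltn0Sn (hues I)); lia. Qed.

Lemma sum_gadgets (F : nat -> nat -> nat) : \sum_(g < gadgets) F (owner g) (level g) =
  \sum_(v < m) \sum_(c < D) \sum_(t < D) F v (level_at v c t).
Proof.
rewrite (sum_ord_mul (m * D) D (fun g => F (owner g) (level g))).
rewrite (sum_ord_mul m D (fun k => \sum_(t < D) F (owner (k * D + t)) (level (k * D + t)))).
apply: eq_bigr => v _; apply: eq_bigr => c _; apply: eq_bigr => t _.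
have dm a b : b < D -> (a * D + b) %/ D = a /\ (a * D + b) %% D = b.
  by move=> l; rewrite divnMDl // divn_small // addn0 modnMDl modn_small.
have [e1 e2] := dm (v * D + c) _ (ltn_ord t); have [e3 e4] := dm v _ (ltn_ord c).
by rewrite /level /owner e1 e2 e3 e4.
Qed.

(** Level [x] occurs only at [c = x - 1], as the fallback level [D + 1] exceeds [x]. Together with
    the price [x] of the colour itself the total is [D], or [D + 1] for a forbidden colour. *)
Lemma penalty v x : 1 <= x <= D ->
  \sum_(c < D) \sum_(t < D) ((level_at v c t == x) : nat) = D - x + ~~ permitted v x.-1.
Proof.
move=> /andP[x1 xD]; have lx : x.-1 < D by lia.
rewrite (bigD1 (Ordinal lx)) //= [X in _ + X]big1 => [|c nc]; last first.
  apply: big1 => t _; apply/eqP; rewrite eqb0 /level_at.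
  have : c.+1 != x by apply: contraNneq nc => e; apply/eqP/val_inj; rewrite /= -e.
  by case: ifP => _ //; lia.
rewrite addn0 -[RHS](@sum_ltn_ord D); last by case: permitted => /=; lia.
apply: eq_bigr => t _; rewrite /level_at prednK //.
by case: ifP => _; rewrite ?eqxx //; case: eqP => //; lia.
Qed.

(** The optimum for a gadget of level [j]: [j] for the root, [(j - 1) * j] for two cliques coloured
    1 to [j - 1], and 1 for each pendant leaf. *)
Definition base j := j * j + 2 * (D.+1 - j).
Definition budget := m * D + \sum_(g < gadgets) base (level g).

(** * Colourings within the budget respect the lists *)

Section LowerBound.

Variable f : nat -> nat.
Hypothesis f_pos : forall i, i < order -> 0 < f i.
Hypothesis f_proper : forall i j, i < order -> j < order ->
  arc (decode i) (decode j) -> f i != f j.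

(** The first bound concerns the clique alone and serves when the root has colour at least [j]; the
    second concerns the complete graph of clique and root and serves when the root is below [j]. *)
Lemma block_cost g b : g < gadgets -> b < 2 ->
  let j := level g in let s := \sum_(q < D) f (leaf_index g b q) in
  j.-1 * j + 2 * (D - j.-1) <= 2 * s /\
  j * j.+1 + 2 * (D - j.-1) <= 2 * (s + f (root_index g)).
Proof.
move=> lg lb j s; have jb := level_bounds g; rewrite -/j in jb.
have split_s : s = \sum_(q < j.-1) f (leaf_index g b q) +
    \sum_(q < D - j.-1) f (leaf_index g b (j.-1 + q)).
  rewrite -(sum_ord_add _ _ (fun q => f (leaf_index g b q))) subnKC //; lia.
have pads : D - j.-1 <= \sum_(q < D - j.-1) f (leaf_index g b (j.-1 + q)).
  rewrite -[X in X <= _]card_ord -sum1_card; apply: leq_sum => q _.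
  by apply/f_pos/leaf_index_lt => //; have := ltn_ord q; lia.
have lt q : q < j.-1 -> leaf_index g b q < order.
  by move=> lq; apply: leaf_index_lt => //; lia.
have dec q : q < j.-1 -> decode (leaf_index g b q) = Leaf g b q.
  by move=> lq; apply: decode_leaf => //; lia.
have leaf2 i k : i < k < j.-1 -> f (leaf_index g b i) != f (leaf_index g b k).
  move=> /andP[lik lk]; have li : i < j.-1 by lia.
  by apply: f_proper; rewrite ?lt ?dec //= !eqxx -/j; lia.
split.
  have := @sum_distinct j.-1 (fun q => f (leaf_index g b q)).
  rewrite prednK; last by lia.
  by move=> /(_ (fun i l => f_pos (lt i l)) leaf2); lia.
pose f' q := if q < j.-1 then f (leaf_index g b q) else f (root_index g).
have jj : j.-1.+1 = j by lia.
have fj : f' j.-1 = f (root_index g) by rewrite /f' ltnn.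
have H := @sum_distinct j.-1.+1 f'.
rewrite big_ord_recr /= fj (eq_bigr (fun q : 'I_j.-1 => f (leaf_index g b q))) ?jj in H; last first.
  by move=> q _; rewrite /f' ltn_ord.
suff : j * j.+1 <= 2 * (\sum_(q < j.-1) f (leaf_index g b q) + f (root_index g)) by lia.
apply: H => [i li|i k /andP[lik lk]]; rewrite /f'.
  by case: ifP => l; apply: f_pos; [apply: lt|apply: root_index_lt].
have li : i < j.-1 by lia.
rewrite li; case: ifP => lk'; first by apply: leaf2; rewrite lik.
rewrite eq_sym; apply: f_proper; rewrite ?lt ?dec ?decode_root ?root_index_lt //=.
by rewrite eqxx -/j; lia.
Qed.

Lemma gadget_cost g : g < gadgets -> base (level g) + (f (owner g) == level g) <=
  f (root_index g) + \sum_(q < D) (f (leaf_index g 0 q) + f (leaf_index g 1 q)).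
Proof.
move=> lg; have [b0 b0'] := @block_cost g 0 lg isT; have [b1 b1'] := @block_cost g 1 lg isT.
rewrite big_split /= in b0 b0' b1 b1' *; have jb := level_bounds g.
have lo := owner_lt lg; set j := level g in jb b0 b0' b1 b1' *.
have ne : f (owner g) != f (root_index g).
  apply: f_proper; [exact: main_index_lt|exact: root_index_lt|].
  by rewrite decode_main // decode_root /=.
rewrite /base; set r := f (root_index g) in ne b0 b0' b1 b1' *.
(* For [r < j] add the second bounds of both blocks, in which the root counts twice; for [r >= j]
   add the first ones. Either way [|r - j|] is left over. *)
have : j * j + 2 * (D.+1 - j) + (r != j) <= r + (\sum_(q < D) f (leaf_index g 0 q) +
    \sum_(q < D) f (leaf_index g 1 q)).
  have jj : j.-1 * j = j * j - j by rewrite -subn1 mulnBl mul1n.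
  have jj' : j <= j * j by rewrite leq_pmull //; lia.
  rewrite jj in b0 b1; rewrite mulnS in b0' b1'; case: (ltnP r j) => rj; [have := leq_b1 (r != j)|case: (eqVneq r j)]; clear f_pos f_proper; move: (\sum_(_ < _) _) (\sum_(_ < _) _) b0 b1 b0' b1' => *; lia.
(* Owner and root are adjacent, so an owner coloured [j] keeps the root from [j]. *)
have : (f (owner g) == j) <= (r != j).
  by case: (f (owner g) =P j) ne => [->|//] ne; rewrite eq_sym ne.
by move=> l; apply: leq_trans; rewrite leq_add2l.
Qed.

(** Once the base costs of the gadgets are paid, [D] per bipartite vertex is left. Each such vertex
    with its penalties costs at least [D], hence exactly [D], which only permitted colours up to [D]
    achieve. *)
Lemma cost_lower_bound : \sum_(i < order) f i <= budget ->
  forall v, v < m -> f v <= D /\ permitted v (f v).-1.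
Proof.
rewrite sum_order => le.
have main : \sum_(v < m) (f v + \sum_(c < D) \sum_(t < D) ((f v == level_at v c t) : nat)) <= m * D.
  rewrite big_split /= -(sum_gadgets (fun v j => f v == j)).
  have : \sum_(g < gadgets) (base (level g) + (f (owner g) == level g)) <=
    \sum_(g < gadgets) (f (root_index g) +
      \sum_(q < D) (f (leaf_index g 0 q) + f (leaf_index g 1 q))).
    by apply: leq_sum => g _; apply: gadget_cost.
  have add_le a b c p q : a + b <= c + p -> p + q <= b -> a + q <= c by lia.
  by rewrite [X in X <= _]big_split; exact: add_le le.
have pen v : v < m -> D < f v \/ f v + \sum_(c < D) \sum_(t < D) ((f v == level_at v c t) : nat) =
    D + ~~ permitted v (f v).-1.
  move=> lv; have fv := f_pos (main_index_lt lv); case: (leqP (f v) D) => lD; last by left.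
  right; under eq_bigr => c _ do under eq_bigr => t _ do rewrite eq_sym.
  by rewrite penalty ?fv ?lD //; case: permitted => /=; lia.
move=> v lv.
have lo u : u < m -> D <= f u + \sum_(c < D) \sum_(t < D) ((f u == level_at u c t) : nat).
  by move=> lu; case: (pen u lu) => [|->]; lia.
suff le' : f v + \sum_(c < D) \sum_(t < D) ((f v == level_at v c t) : nat) <= D.
  case: (pen v lv) => [|E]; first by move=> l; exfalso; lia.
  have l1 : f v <= D by apply: leq_trans le'; apply: leq_addr.
  by rewrite E in le'; case: (permitted v _) le' => //=; lia.
move: main; rewrite (bigD1 (Ordinal lv)) //= -[X in X * D](card_ord m) -sum_nat_const.
rewrite [X in _ <= X](bigD1 (Ordinal lv)) //=.
have : \sum_(i < m | i != Ordinal lv) D <= \sum_(i < m | i != Ordinal lv)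
   (f i + \sum_(c < D) \sum_(t < D) ((f i == level_at i c t) : nat)).
  by apply: leq_sum => i _; apply: lo.
have cancel a b c p : a + b <= c + p -> p <= b -> a <= c by lia.
by move=> l2 l1; exact: cancel l1 l2.
Qed.

End LowerBound.

(** * A list colouring attains the budget *)

Section UpperBound.

Variable h : nat -> nat.
Hypothesis h_allowed : forall v, v < m -> h v < hues I /\ allow I v (h v).
Hypothesis h_proper : forall u v, u < m -> v < m -> side I u -> ~~ side I v -> h u != h v.

(** Pendant leaves get colour 1, which the shift by 2 keeps away from the bipartite vertices. A root
    gives way to [j + 1] exactly when its owner has its preferred colour [j]. *)
Definition node_colour (x : node) : nat :=
  match x with
  | Main v => (h v).+2
  | Root g => level g + ((h (owner g)).+2 == level g)
  | Leaf g _ q => if q.+1 < level g then q.+1 else 1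
  end.

Lemma node_colour_proper i j : i < order -> j < order -> arc (decode i) (decode j) ->
  node_colour (decode i) != node_colour (decode j).
Proof.
move=> /indexP li /indexP lj.
case: li => [lu|g lg _|g b q lg lb lq _]; case: lj => [lv|g' lg' _|g' b' q' lg' lb' lq' _] //=.
- by move=> /andP[su sv]; rewrite !eqSS h_proper.
- by move=> /eqP ->; case: eqP; lia.
- by move=> /andP[/eqP ow l]; rewrite ltnNge l.
- by move=> /andP[/eqP <- l]; rewrite l; lia.
- by move=> /and5P[/eqP <- _ nq -> ->]; rewrite eqSS.
Qed.

Lemma node_colour_pos x : 0 < node_colour x.
Proof.
case: x => [v|g|g b q] //=; last by case: ifP.
by have := level_bounds g; lia.
Qed.

Lemma sum_leaves j : 1 <= j <= D.+1 ->
  2 * \sum_(q < D) (if q.+1 < j then q.+1 else 1) = j.-1 * j + 2 * (D - j.-1).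
Proof.
move=> jb; have -> : \sum_(q < D) (if q.+1 < j then q.+1 else 1) =
    \sum_(q < j.-1) q.+1 + \sum_(q < D - j.-1) 1.
  have E : D = j.-1 + (D - j.-1) by lia.
  rewrite [in LHS]E (sum_ord_add _ _ (fun q => if q.+1 < j then q.+1 else 1)).
  congr (_ + _); apply: eq_bigr => q _; case: ifP => //; have := ltn_ord q; lia.
rewrite sum1_card card_ord mulnDr; congr (_ + _).
have tri k : 2 * \sum_(q < k) q.+1 = k * k.+1.
  by elim: k => [|k IH]; [rewrite big_ord0|rewrite big_ord_recr /= mulnDr IH; lia].
by rewrite tri prednK //; lia.
Qed.

Lemma cost_upper_bound : \sum_(i < order) node_colour (decode i) = budget.
Proof.
rewrite (sum_order (fun i => node_colour (decode i))) (eq_bigr (fun v : 'I_m => (h v).+2)) => [|v _]; last by rewrite decode_main.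
rewrite [X in _ + X](eq_bigr (fun g : 'I_gadgets => base (level g) + ((h (owner g)).+2 == level g))).
  rewrite big_split /= (sum_gadgets (fun v j => (h v).+2 == j)) addnCA addnC /budget; congr (_ + _).
  rewrite -big_split -[X in X * D](card_ord m) -sum_nat_const; apply: eq_bigr => v _.
  have [lh ah] := h_allowed (ltn_ord v).
  under eq_bigr => c _ do under eq_bigr => t _ do rewrite eq_sym.
  by rewrite penalty /permitted /= ?ah //; lia.
move=> g _; rewrite decode_root /=.
rewrite (eq_bigr (fun q : 'I_D => 2 * (if q.+1 < level g then q.+1 else 1))) => [|q _]; last first.
  by rewrite !decode_leaf //= addnn mul2n.
rewrite -big_distrr /= sum_leaves ?level_bounds // /base; have := level_bounds g.
move: (level g) => j jb; have -> : j.-1 * j = j * j - j by rewrite -subn1 mulnBl mul1n.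
have jj : j <= j * j by rewrite leq_pmull //; lia.
by case: eqP => _; lia.
Qed.

End UpperBound.

Theorem list_graph_cost :
  (exists c, colouring list_graph c /\ \sum_v c v <= budget) <-> list_colourable I.
Proof.
split=> [[c [[c1 cp] lc]]|[h [h1 h2]]].
  pose f i := oapp c 0 (insub i : option 'I_order).
  have fE i (li : i < order) : f i = c (Ordinal li) by rewrite /f insubT.
  have fp i j : i < order -> j < order -> arc (decode i) (decode j) -> f i != f j.
    by move=> li lj a; rewrite (fE i li) (fE j lj); apply: cp; rewrite /= /edge a.
  have f0 i : i < order -> 0 < f i by move=> li; rewrite (fE i li).
  have le : \sum_(i < order) f i <= budget.
    by apply: leq_trans lc; apply: leq_sum => i _; rewrite /f valK.
  have H := cost_lower_bound f0 fp le.
  have f2 v : v < m -> f v = (f v - 2).+2 /\ f v - 2 = (f v).-1.-1.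
    by move=> lv; have [_ /andP[]] := H v lv; lia.
  exists (fun v => f v - 2); split=> [v lv|u v lu lv su sv].
    have [lf /andP[pf af]] := H v lv; have [e1 e2] := f2 v lv.
    by rewrite {2}e2 af; split=> //; lia.
  have : f u != f v by apply: fp; rewrite ?main_index_lt ?decode_main //= su.
  have [e1 _] := f2 u lu; have [e2 _] := f2 v lv.
  by apply: contraNneq => e; rewrite e1 e2 e.
exists (fun i : 'I_order => node_colour h (decode i)); split; last by rewrite cost_upper_bound.
split=> [v|u v]; first exact: node_colour_pos.
by case/orP => /(node_colour_proper h2); [|rewrite eq_sym]; apply.
Qed.
End ListColouring.

(** * Distance-hereditary graphs and clique-width *)

Lemma dh_by_order N (G : sgraph 'I_N) : 0 < N ->
  (forall i : 'I_N, 0 < i -> exists2 u : 'I_N, u < i &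
     (forall w : 'I_N, w < i -> G i w = (w == u)) \/
     (forall w : 'I_N, w < i -> G i w = (w == u) || G u w) \/
     (forall w : 'I_N, w < i -> G i w = G u w)) ->
  distance_hereditary G.
Proof.
move=> N0 H; suff B k : k < N -> dh_built G [set w : 'I_N | w < k.+1].
  rewrite /distance_hereditary (_ : [set: 'I_N] = [set w : 'I_N | w < N.-1.+1]).
    by apply: B; rewrite prednK.
  by apply/setP => w; rewrite !inE prednK // ltn_ord.
elim: k => [|k IH] lk.
  rewrite (_ : [set w : 'I_N | w < 1] = [set Ordinal lk]); first exact: dh_single.
  by apply/setP => w; rewrite !inE -val_eqE /=; case: (w : nat).
have [//|u uk Hu] := H (Ordinal lk).
have -> : [set w : 'I_N | w < k.+2] = Ordinal lk |: [set w : 'I_N | w < k.+1].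
  by apply/setP => w; rewrite !inE -val_eqE /= ltnS leq_eqVlt.
have uA : u \in [set w : 'I_N | w < k.+1] by rewrite inE.
have iA : Ordinal lk \notin [set w : 'I_N | w < k.+1] by rewrite inE ltnn.
have B := IH (ltnW lk).
case: Hu => [Hu|[Hu|Hu]].
- by apply: (dh_pendant B uA iA) => w; rewrite inE => /Hu.
- by apply: (dh_true_twin B uA iA) => w; rewrite inE => /Hu.
- by apply: (dh_false_twin B uA iA) => w; rewrite inE => /Hu.
Qed.

Section ListGraphDistanceHereditary.

Variables (I : lists) (C : nat).
Hypotheses (sizeI : 0 < lsize I) (C0 : 0 < C).
Hypothesis sideE : forall v, side I v = (0 < v <= C).
Notation m := (lsize I).
Notation D := (hues I).+1.

Lemma root_neq_main g v : v < m -> (root_index I g == v) = false.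
Proof. by move=> lv; apply/eqP; rewrite /root_index; lia. Qed.

Lemma leaf_neq_main g b q v : v < m -> (leaf_index I g b q == v) = false.
Proof. by move=> lv; apply/eqP; rewrite /leaf_index; lia. Qed.

(** Vertices 1 to [C] are pendant at 0, and the later bipartite vertices are false twins of 0. Roots
    and padding leaves are pendant at their owners. The first clique leaf of a row is pendant at the
    root, and each further one is a true twin of its predecessor. *)
Lemma list_graph_step i : 0 < i < order I -> exists2 u, u < i &
     (forall w, w < i -> edge I i w = (w == u)) \/
     (forall w, w < i -> edge I i w = (w == u) || edge I u w) \/
     (forall w, w < i -> edge I i w = edge I u w).
Proof.
move=> /andP[i0 li]; rewrite {1 2 4}/edge; case: (indexP li) => [lm|g lg ei|g b q lg lb lq ei].
- exists 0; first by [].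
  have [iC|iC] := leqP i C.
    left=> w lw; rewrite (decode_main (ltn_trans lw lm)) /= !sideE i0 iC /= andbF orbF.
    by case: w lw => [|w] //= lw; rewrite (leq_trans (ltnW lw) iC).
  right; right=> w lw; rewrite /edge (decode_main (ltn_trans lw lm)) (decode_main sizeI) /= !sideE.
  by rewrite i0 leqNgt iC /=.
- have lo := owner_lt lg; exists (owner I g); first by rewrite ei /root_index; lia.
  left=> w lw; have lw' := ltn_trans lw li; case: (indexP lw') lw => [lv|g' lg' ew|g' b' q' lg' lb' lq' ew] lw /=.
  + by rewrite eq_sym.
  + by rewrite ew root_neq_main.
  + rewrite orbF; have /negbTE -> : g != g'.
      by apply/eqP => e; move: lw; rewrite ei ew e /root_index /leaf_index; lia.
    by rewrite ew leaf_neq_main.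
- have lo := owner_lt lg.
  have [lev|lev] := leqP (level I g) q.+1.
    exists (owner I g); first by rewrite ei /leaf_index; lia.
    left=> w lw; have lw' := ltn_trans lw li; case: (indexP lw') lw => [lv|g' lg' ew|g' b' q' lg' lb' lq' ew] lw /=.
    + by rewrite lev andbT eq_sym.
    + rewrite (_ : _ && _ = false); last by apply/negbTE/negP => /andP[/eqP ->]; rewrite ltnNge lev.
      by rewrite ew root_neq_main.
    + rewrite ew leaf_neq_main //; apply/negbTE/negP => /orP[] /and5P[/eqP e _ _ l1 l2].
        by rewrite ltnNge lev in l1.
      by rewrite e ltnNge lev in l2.
  case: q lq ei lev => [|q] lq ei lev.
    exists (root_index I g); first by rewrite ei /leaf_index /root_index; lia.
    left=> w lw; have lw' := ltn_trans lw li; case: (indexP lw') lw => [lv|g' lg' ew|g' b' q' lg' lb' lq' ew] lw /=.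
    + by rewrite leqNgt lev andbF eq_sym root_neq_main.
    + rewrite ew /root_index eqn_add2l eqn_pmul2r //; case: eqP => // ->.
      by rewrite lev.
    + have -> : (w == root_index I g) = false.
        apply/eqP => e; move: (decode_root I g); rewrite -e ew decode_leaf //.
      apply/negbTE/negP => /orP[] /and5P[/eqP e1 /eqP e2 /eqP ne _ _].
        move: lw; rewrite ew ei e1 e2 /leaf_index; lia.
      move: lw; rewrite ew ei -e1 -e2 /leaf_index; lia.
  exists (leaf_index I g b q); first by rewrite ei /leaf_index; lia.
  right; left=> w lw; have lw' := ltn_trans lw li.
  rewrite /edge decode_leaf //; last by lia.
  case: (indexP lw') lw => [lv|g' lg' ew|g' b' q' lg' lb' lq' ew] lw /=.
  + rewrite (leqNgt (level I g)) lev (leqNgt (level I g)) (ltnW lev) !andbF.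
    by rewrite eq_sym leaf_neq_main.
  + have -> : (w == leaf_index I g b q) = false.
      apply/eqP => e; have := decode_root I g'; rewrite -ew e decode_leaf //; lia.
    by case: eqP => // ->; rewrite lev (ltnW lev).
  + have -> : (w == leaf_index I g b q) = [&& g' == g, b' == b & q' == q].
      apply/eqP/and3P => [e|[/eqP <- /eqP <- /eqP <-]] //.
      have := decode_leaf g' lb' lq'; rewrite -ew e decode_leaf //; last by lia.
      by case=> -> -> ->.
    have ni : ~~ [&& g' == g, b' == b & q' == q.+1].
      by apply/and3P => -[/eqP e1 /eqP e2 /eqP e3]; move: lw; rewrite ew ei e1 e2 e3 ltnn.
    rewrite (eq_sym g) (eq_sym b); case: eqP ni => //= e1; case: eqP => //= e2 ni.
    rewrite e1 lev (ltnW lev) /= !(eq_sym q') !(eq_sym _ q') ni /=.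
    by case: (eqVneq q' q) => [->|] /=; rewrite ?(ltnW lev) ?andbb ?orbb.
Qed.

Lemma list_graph_dh : distance_hereditary (list_graph I).
Proof.
apply: dh_by_order => [|i i0]; first by rewrite /order; lia.
have [|u lu H] := @list_graph_step i; first by rewrite i0 ltn_ord.
exists (Ordinal (ltn_trans lu (ltn_ord i))) => //.
case: H => [H|[H|H]]; [left|right; left|right; right] => w lw; exact: H.
Qed.

End ListGraphDistanceHereditary.

(* Label 2 is dead: never joined nor relabelled. A vertex attached to a leaf of
   an expression keeps the label of the leaf if it is a twin, and dies otherwise. *)
Definition dead : 'I_3 := inord 2.
Definition live0 : 'I_3 := inord 0.
Definition live1 : 'I_3 := inord 1.

Section Attach.

Variable T : finType.

Fixpoint dead_respecting (e : cwexpr T 3) : bool :=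
  match e with
  | cw_vertex _ _ => true
  | cw_union e1 e2 => dead_respecting e1 && dead_respecting e2
  | cw_join i j e1 => [&& i != dead, j != dead & dead_respecting e1]
  | cw_relabel i _ e1 => (i != dead) && dead_respecting e1
  end.

Variables (u v : T) (twin joined : bool).

Definition pair_expr : cwexpr T 3 :=
  let e := cw_union (cw_vertex u live0) (cw_vertex v live1) in
  if joined then cw_join live0 live1 e else e.

(** Inside the new leaf only [u] and [v] are present, so both live labels are free for deciding
    their adjacency. A twin is merged with [u] before [u] gets its label back; otherwise the dead
    label keeps [v] out of that relabelling. *)
Fixpoint attach (e : cwexpr T 3) : cwexpr T 3 :=
  match e with
  | cw_vertex w i => if w == u then
      cw_relabel live0 i (cw_relabel live1 (if twin then live0 else dead) pair_expr)
      else e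
  | cw_union e1 e2 => cw_union (attach e1) (attach e2)
  | cw_join i j e1 => cw_join i j (attach e1)
  | cw_relabel i j e1 => cw_relabel i j (attach e1)
  end.

Hypothesis uv : u != v.

Lemma labels_neq : [/\ (live0 == live1) = false, (live1 == live0) = false,
  (live0 == dead) = false, (live1 == dead) = false & (dead == live0) = false].
Proof. by split; apply/eqP => /(congr1 val); rewrite /= !inordK. Qed.

Definition attached_label (l : 'I_3) := if twin then l else dead.

Lemma cw_label_attach e : cw_wf e -> dead_respecting e -> cw_label e v = None ->
  (forall x, x != v -> cw_label (attach e) x = cw_label e x) /\
  cw_label (attach e) v = omap attached_label (cw_label e u).
Proof.
have [e1 e2 e3 e4 e5] := labels_neq; have vu : (v == u) = false by rewrite eq_sym (negbTE uv).
have some_eq (a b : 'I_3) : (Some a == Some b) = (a == b) by [].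
elim: e => [w i|a IHa b IHb|i j a IHa|i j a IHa] /=.
- move=> _ _; case: (v =P w) => // vw _; have [wu|wu] := eqVneq w u; rewrite ?wu.
    rewrite /pair_expr; split=> [x xv|].
      by case: joined; rewrite /= (negbTE xv); case: (x == u); rewrite /= ?some_eq ?e1 /= ?some_eq ?eqxx.
    rewrite /attached_label; case: joined twin => [] [];
      by rewrite /= vu eqxx ?some_eq ?eqxx /= ?some_eq ?eqxx ?e5.
  by split=> //=; case: eqP vw.
- move=> /and3P[wa wb /forallP dis] /andP[da db].
  case ea: (cw_label a v) => [//|] eb; have [ha ha'] := IHa wa da ea; have [hb hb'] := IHb wb db eb.
  split=> [x xv|]; first by rewrite ha // hb.
  by rewrite ha' hb'; case: (cw_label a u).
- by move=> /andP[_ wa] /and3P[_ _ da]; apply: IHa.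
- move=> wa /andP[di da]; case: eqP => // ne la; have [ha ha'] := IHa wa da la.
  split=> [x xv|]; first by rewrite ha.
  rewrite ha' /attached_label; case: (cw_label a u) => //= l; rewrite !some_eq.
  case: twin; first by case: (l == i).
  by rewrite eq_sym (negbTE di); case: (l == i).
Qed.

Lemma attach_wf e : cw_wf e -> dead_respecting e -> cw_label e v = None ->
  cw_wf (attach e) && dead_respecting (attach e).
Proof.
have [e1 e2 e3 e4 e5] := labels_neq; have vu : (v == u) = false by rewrite eq_sym (negbTE uv).
elim: e => [w i|a IHa b IHb|i j a IHa|i j a IHa] /=.
- move=> _ _ _; case: eqP => //= _; rewrite /pair_expr e3 e4.
  have dis : [forall x, ((if x == u then Some live0 else None) == None) ||
      ((if x == v then Some live1 else None) == None)].
    by apply/forallP => x; case: (eqVneq x u) => [->|] //; rewrite (negbTE uv).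
  by case: joined; rewrite /= ?e1 ?e3 ?e4 dis.
- move=> /and3P[wa wb /forallP dis] /andP[da db].
  case ea: (cw_label a v) => [//|] eb.
  have [ha ha'] := cw_label_attach wa da ea; have [hb hb'] := cw_label_attach wb db eb.
  have /andP[-> ->] := IHa wa da ea; have /andP[-> ->] := IHb wb db eb; rewrite /= andbT.
  apply/forallP => x; have [->|xv] := eqVneq x v; last by rewrite ha // hb.
  by rewrite ha' hb'; have := dis u; case: (cw_label a u); case: (cw_label b u).
- move=> /andP[-> wa] /and3P[-> -> da] la; by rewrite /= IHa.
- move=> wa /andP[-> da]; case: eqP => // _ la; by rewrite /= IHa.
Qed.

(** Outside the new leaf a twin shares the label of [u], so joins treat both alike and never join
    them to each other, the two labels of a join being distinct. A vertex that is not a twin is dead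
    and meets no join. *)
Lemma cw_adj_attach e x y : cw_wf e -> dead_respecting e -> cw_label e v = None ->
  cw_adj (attach e) x y =
    if x == v then if y == v then false else
      if y == u then joined && (cw_label e u != None) else twin && cw_adj e u y
    else if y == v then
      if x == u then joined && (cw_label e u != None) else twin && cw_adj e x u
    else cw_adj e x y.
Proof.
have [e1 e2 e3 e4 e5] := labels_neq; have vu : (v == u) = false by rewrite eq_sym (negbTE uv).
have some_eq (a b : 'I_3) : (Some a == Some b) = (a == b) by [].
elim: e => [w i|a IHa b IHb|i j a IHa|i j a IHa] /=.
- move=> _ _; case: (v =P w) => // vw _; have [wu|wu] := eqVneq w u; last first.
    by case: (x == v); case: (y == v); case: (x == u); case: (y == u); rewrite /= ?andbF.
  rewrite /= /pair_expr; case: joined => /=; last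
    by case: (x == v); case: (y == v); case: (x == u); case: (y == u); rewrite /= ?andbF.
  have [->|xv] := eqVneq x v; have [->|yv] := eqVneq y v.
  + by rewrite ?vu ?(negbTE uv) ?some_eq ?eqxx ?e1 ?e2 ?andbF.
  + by rewrite ?vu; case: (y == u); rewrite /= ?some_eq ?eqxx ?e1 ?e2 ?andbF.
  + by rewrite ?vu; case: (x == u); rewrite /= ?some_eq ?eqxx ?e1 ?e2 ?andbF.
  + by case: (x == u); case: (y == u); rewrite //= ?some_eq ?e1 ?e2 ?andbF.
- move=> /and3P[wa wb /forallP dis] /andP[da db].
  case ea: (cw_label a v) => [//|] eb; rewrite IHa // IHb //.
  case: (x == v); case: (y == v) => //; case: eqP => // _; rewrite -?andb_orr //;
    by case: joined => //=; case: (cw_label a u).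
- move=> /andP[ij wa] /and3P[di dj da] la; have [ha ha'] := cw_label_attach wa da la.
  have nd (l : 'I_3) (o : option 'I_3) : l != dead -> ~~ twin -> (omap attached_label o == Some l) = false.
    by move=> ld /negbTE nt; case: o => //= o; rewrite /attached_label nt some_eq eq_sym (negbTE ld).
  have tw (l : 'I_3) (o : option 'I_3) : twin -> (omap attached_label o == Some l) = (o == Some l).
    by move=> t; case: o => //= o; rewrite /attached_label t.
  have ij' (o : option 'I_3) : (o == Some i) && (o == Some j) = false.
    by apply/negbTE/andP => -[/eqP -> /eqP[e]]; rewrite e eqxx in ij.
  have ji' (o : option 'I_3) : (o == Some j) && (o == Some i) = false by rewrite andbC.
  rewrite IHa //; have [->|xv] := eqVneq x v; have [->|yv] := eqVneq y v.
  + by rewrite ij' ji'.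
  + rewrite ha' ha //; have [->|yu] := eqVneq y u.
      have [t|t] := boolP twin; first by rewrite !tw // ij' ji' !orbF.
      by rewrite !nd //= !orbF.
    have [t|t] := boolP twin; first by rewrite !tw.
    by rewrite !nd.
  + rewrite ha' ha //; have [->|xu] := eqVneq x u.
      have [t|t] := boolP twin; first by rewrite !tw // ij' ji' !orbF.
      by rewrite !nd //= !andbF !orbF.
    have [t|t] := boolP twin; first by rewrite !tw.
    by rewrite !nd //= !andbF.
  + by rewrite !ha.
- move=> wa /andP[di da]; case: eqP => // ne la; rewrite IHa //.
  have E : (if cw_label a u == Some i then Some j else cw_label a u) != None = (cw_label a u != None).
    by case: (cw_label a u) => //= l; case: (_ == Some i).
  by rewrite E.
Qed.

End Attach.

Lemma dh_expr (T : finType) (G : sgraph T) A : dh_built G A ->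
  exists e : cwexpr T 3, [/\ cw_wf e, dead_respecting e,
    forall x, (cw_label e x != None) = (x \in A) &
    {in A &, forall x y, cw_adj e x y = G x y}].
Proof.
have step twin joined (B : {set T}) u v : (exists e : cwexpr T 3, [/\ cw_wf e, dead_respecting e,
    forall x, (cw_label e x != None) = (x \in B) & {in B &, forall x y, cw_adj e x y = G x y}]) ->
    u \in B -> v \notin B ->
    {in B, forall w, G v w = if w == u then joined else twin && G u w} ->
    exists e : cwexpr T 3, [/\ cw_wf e, dead_respecting e,
    forall x, (cw_label e x != None) = (x \in v |: B) &
    {in v |: B &, forall x y, cw_adj e x y = G x y}].
  move=> [e [we de le ae]] uB vB Gv.
  have uv : u != v by apply: contraNneq vB => <-.
  have lv : cw_label e v = None by apply/eqP; rewrite -[_ == _]negbK le.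
  have lu : cw_label e u != None by rewrite le.
  have [h1 h2] := cw_label_attach twin joined uv we de lv.
  have /andP[wf dr] := attach_wf twin joined uv we de lv.
  exists (attach u v twin joined e); split=> // [x|x y].
    rewrite in_setU1; have [->|xv] := eqVneq x v; last by rewrite h1.
    by rewrite h2; case: (cw_label e u) lu.
  rewrite !in_setU1 cw_adj_attach // lu andbT.
  have [->|xv] := eqVneq x v; have [->|yv] := eqVneq y v => //=.
  - by rewrite adj_irr.
  - by move=> _ yB; rewrite Gv // ae.
  - by move=> xB _; rewrite adj_sym Gv // ae // adj_sym.
  - exact: ae.
elim=> {A} [v|A u v _ IH uA vA Gv|A u v _ IH uA vA Gv|A u v _ IH uA vA Gv].
- exists (cw_vertex v live0); split=> //= [x|x y]; first by rewrite inE; case: (x == v).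
  by rewrite !inE => /eqP -> /eqP ->; rewrite adj_irr.
- apply: (step false true _ u v IH) => // w wA; by rewrite Gv //; case: (w == u).
- apply: (step true true _ u v IH) => // w wA; by rewrite Gv //; case: (w == u).
- apply: (step true false _ u v IH) => // w wA; by rewrite Gv //; case: eqP => // ->; rewrite adj_irr.
Qed.

Lemma dh_cliquewidth (T : finType) (G : sgraph T) : distance_hereditary G -> cliquewidth_at_most 3 G.
Proof.
move=> /dh_expr[e [we _ le ae]].
have c3 : cw_constructible G 3.
  by exists e; split=> // [x|x y]; [rewrite le inE|apply: ae; rewrite inE].
(* The class asks for an exact clique-width, so a least [k] has to exist; constructibility is a mere
   proposition, hence the excluded middle. *)
have least n : (exists2 k, k <= n & cw_constructible G k) ->
    exists2 k, cliquewidth G k & k <= n.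
  elim: n => [|n IH] [k lk ck].
    by exists k => //; split=> // j cj; move: lk; rewrite leqn0 => /eqP ->.
  have [s|ns] := classic (exists2 k, k <= n & cw_constructible G k).
    by have [k' ck' lk'] := IH s; exists k' => //; apply: leqW.
  exists k => //; split=> // j cj; rewrite leqNgt; apply/negP => jk.
  by apply: ns; exists j => //; lia.
by apply: least; exists 3.
Qed.

(** * Constraint satisfaction and computation tableaux *)

Section Constraints.

(* Each of the cells [k < C] is to receive a symbol [s < S]; the constraint
   [b < B] forbids that all the pairs numbered [k * S + s] in [pat b] occur. *)
Variables (C S B : nat) (pat : nat -> seq nat) (trivial_pat : pred nat).

Definition csp_allow v y :=
  if v == 0 then true else if v <= C then y %/ S == v.-1 else
  trivial_pat (v - C.+1) || (y \in pat (v - C.+1)).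

(* The colours are the pairs. Cells are on one side, constraints on the other;
   vertex 0 is a trivial constraint. *)
Definition csp_lists := @Lists (1 + C + B) (C * S) (fun v => 0 < v <= C) csp_allow.

Hypotheses (C0 : 0 < C) (S2 : 1 < S).
Hypothesis patP : forall b y, b < B -> ~~ trivial_pat b -> y \in pat b -> y < C * S.

Lemma csp_list_colourable : list_colourable csp_lists <->
  exists a : nat -> nat, (forall k, k < C -> a k < S) /\
    forall b, b < B -> ~~ trivial_pat b -> exists2 y, y \in pat b & a (y %/ S) != y %% S.
Proof.
have S0 : 0 < S by apply: ltnW.
split=> [[h [h1 h2]]|[a [a1 a2]]].
  exists (fun k => h k.+1 %% S); split=> [k _|b lb nb]; first by rewrite ltn_mod.
  have lv : b + C.+1 < lsize csp_lists by rewrite /=; lia.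
  have [/= lh] := h1 _ lv; rewrite /csp_allow addnS /= ltnNge leq_addl /= -addnS addnK (negbTE nb) /=.
  move=> hp; exists (h (b + C.+1)) => //; set y := h _ in lh hp *.
  have lk : y %/ S < C by rewrite ltn_divLR.
  have lk' : (y %/ S).+1 < lsize csp_lists by rewrite /=; lia.
  have [_ /=] := h1 _ lk'; rewrite /csp_allow /= lk => /eqP e.
  have : h (y %/ S).+1 != y by apply: h2 => //=; lia.
  by apply: contra => /eqP e'; apply/eqP; rewrite (divn_eq (h _) S) e e' -divn_eq.
(* A colour no cell uses, for vertex 0 and the trivial constraints: numbers below [S] are pairs of
   cell 0, and [S > 1] leaves a symbol different from [a 0]. *)
pose free := if a 0 == 0 then 1 else 0.
have lfree : free < S by rewrite /free; case: ifP.
pose pick b := if trivial_pat b then free else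
  nth 0 (pat b) (find (fun y => a (y %/ S) != y %% S) (pat b)).
have pickP b : b < B -> ~~ trivial_pat b -> pick b \in pat b /\ a (pick b %/ S) != pick b %% S.
  move=> lb nb; rewrite /pick (negbTE nb).
  have hs : has (fun y => a (y %/ S) != y %% S) (pat b).
    by have [y yp ya] := a2 b lb nb; apply/hasP; exists y.
  by split; [rewrite mem_nth -?has_find|apply: (nth_find 0 hs)].
have free_ok : a (free %/ S) != free %% S.
  by rewrite divn_small // modn_small // /free; case: (eqVneq (a 0) 0) => [->|].
pose h v := if v == 0 then free else if v <= C then v.-1 * S + a v.-1 else pick (v - C.+1).
have hB v : v < 1 + C + B -> ~~ (0 < v <= C) ->
    [/\ h v < C * S, csp_allow v (h v) & a (h v %/ S) != h v %% S].
  move=> lv; rewrite /h /csp_allow; case: eqP => [->|/eqP v0].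
    by split=> //; apply: (leq_trans lfree); rewrite leq_pmull.
  rewrite lt0n v0 /= => /negbTE vC; rewrite vC.
  have lb : v - C.+1 < B by lia.
  have [tb|nb] := boolP (trivial_pat (v - C.+1)).
    by rewrite /pick tb; split=> //; apply: (leq_trans lfree); rewrite leq_pmull.
  by have [pp pa] := pickP _ lb nb; split=> //; apply: patP pp.
have hA v : 0 < v <= C -> [/\ h v < C * S, h v %/ S = v.-1 & h v %% S = a v.-1].
  move=> /andP[v0 vC]; have lv : v.-1 < C by lia.
  have := a1 _ lv; rewrite /h eqn0Ngt v0 vC /= => la.
  rewrite divnMDl // divn_small // addn0 modnMDl modn_small //; split=> //.
  by apply: (@leq_trans (v.-1.+1 * S)); [rewrite mulSnr ltn_add2l|rewrite leq_mul2r lv orbT].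
exists h; split=> [v|u v lu lv su sv] /=.
  rewrite /= => lv; have [sv|sv] := boolP (0 < v <= C); last by have [] := hB v lv sv.
  have [h1 h2 _] := hA v sv; split=> //; case/andP: sv => v0 vC.
  by rewrite /csp_allow eqn0Ngt v0 vC h2 eqxx.
have [_ e1 e2] := hA u su; have [_ _] := hB v lv sv.
by apply: contraNneq => <-; rewrite e1 e2.
Qed.

End Constraints.

(** * Tableaux in coordinates relative to the heads *)

Section Tableau.

Variable M : machine.

Definition slice : finType := (state M * {ffun 'I_(ntapes M).+1 -> symbol (aux M)})%type.

Variables (x : seq bool) (P T : nat).
Hypotheses (T0 : 0 < T) (PT : P <= T).

(* Position [q] of a tape is the one [q - centre] cells to the right of its head. *)
Definition centre := T.+2.
Arguments centre : simpl never.
Definition width := (2 * centre).+1.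

Definition tape_cell (t : tape (aux M)) q :=
  if centre <= q then nth None t.2 (q - centre) else nth None t.1 (centre - q).-1.

(** Every cell repeats the state and carries the symbols of all tapes at one offset from their
    heads, so the cell at the centre determines the whole transition. *)
Definition config_slice (c : config M) q : slice :=
  (c.1, [ffun i => tape_cell (c.2 i) q]).

(** The places where a written symbol can land: left of the centre after a move to the right (1), at
    the centre (2), right of it after a move to the left (3). *)
Definition zone q := if q.+1 == centre then 1 else if q == centre then 2 else
  if q == centre.+1 then 3 else 0.

Definition next_slice (k : nat) (c0 cl cm cr : slice) : slice :=
  if halting c0.1 then (c0.1, cm.2) else
  let: (q', a) := trans c0.1 c0.2 in
  (q', [ffun i => match (a i).2 with
     | Stay => if k == 2 then (a i).1 else cm.2 i
     | Rgt => if k == 1 then (a i).1 else cr.2 i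
     | Lft => if k == 3 then (a i).1 else cl.2 i
     end]).

Lemma tape_cellR t k : tape_cell t (centre + k) = nth None t.2 k.
Proof. by rewrite /tape_cell leq_addr addKn. Qed.

Lemma tape_cellL t k : k < centre -> tape_cell t (centre - k.+1) = nth None t.1 k.
Proof. by move=> lk; rewrite /tape_cell ifN; [congr (nth _ _ _)|]; lia. Qed.

Lemma step_slice c q : 0 < q -> config_slice (step c) q =
  next_slice (zone q) (config_slice c centre) (config_slice c q.-1)
    (config_slice c q) (config_slice c q.+1).
Proof.
case: c => s ts q0; rewrite /next_slice /step /=; case: ifP => // _.
have -> : [ffun i => scanned (ts i)] = [ffun i => tape_cell (ts i) centre].
  by apply/ffunP => i; rewrite !ffunE /tape_cell leqnn subnn /scanned nth0.
case: trans => s' a; congr (_, _); apply/ffunP => i; rewrite !ffunE.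
move: (ts i) (a i) => t [b mv] /=.
have [le|lt] := leqP centre q.
  have [k ->] : exists k, q = centre + k by exists (q - centre); lia.
  have -> : zone (centre + k) = if k is k'.+1 then (if k' is 0 then 3 else 0) else 2.
    by rewrite /zone; case: k => [|[|k]]; do ![case: eqP]; lia.
  rewrite -addnS !tape_cellR; case: t => l r; case: mv => /=.
  - case: k => [|[|k]] //=; last by rewrite addnS /= tape_cellR nth_behead.
    have -> : T.+1 + 0 = centre - 1 by rewrite /centre; lia.
    by rewrite tape_cellL //= nth0.
  - by case: k => [|[|k]] //=; rewrite nth_behead.
  - by rewrite nth_behead; case: k => [|[|k]].
have [k [-> lk]] : exists k, q = centre - k.+1 /\ k.+1 < centre.
  by exists (centre - q).-1; split; lia.
have -> : zone (centre - k.+1) = if k is 0 then 1 else 0.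
  by rewrite /zone; case: k lk => [|k] lk; do ![case: eqP]; lia.
have -> : (centre - k.+1).-1 = centre - k.+2 by lia.
have -> : (centre - k.+1).+1 = centre - k by lia.
rewrite !tape_cellL //; try lia; case: t => l r; case: mv => /=.
- by rewrite nth_behead; case: k lk.
- by case: k lk.
- by case: k lk => [|k] lk //=; rewrite tape_cellL //; lia.
Qed.

Definition input_kind q := if q < centre then 0 else
  if q - centre < size x then 1 + nth false x (q - centre) else 0.

Definition witness_zone q := (centre <= q) && (q - centre < P).

Definition is_bit (A : finType) (s : symbol A) := if s is Some (inl _) then true else false.

(** Nondeterminism enters here: in the witness zone tape 1 may hold any bit or a blank, but a blank
    must be followed by a blank, so the guess is a single string of at most [P] bits. A positive
    [kind] codes the input bit [kind - 1]. *)
Definition initial_slice (kind : nat) (wz : bool) (cm cr : slice) : bool :=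
  (cm.1 == start M) && [forall i, match val i with
    | 0 => cm.2 i == (if kind is b.+1 then Some (inl (b == 1)) else None)
    | 1 => if wz then is_bit (cm.2 i) || (cm.2 i == None) && (cr.2 i == None)
           else cm.2 i == None
    | _ => cm.2 i == None
    end].

Definition forbidden (first last : bool) (k kind : nat) (wz : bool) (c0 cl cm cr cd : slice) : bool :=
  [|| cd != next_slice k c0 cl cm cr,
      first && ~~ initial_slice kind wz cm cr,
      [&& last, k == 2 & ~~ (halting cd.1 && (cd.2 ord0 == Some (inl true)))] |
      [&& last, k == 3 & is_bit (cd.2 ord0)]].

Definition tableau (a : nat -> nat -> slice) := forall t q, t < T -> 0 < q < width.-1 ->
  ~~ forbidden (t == 0) (t.+1 == T) (zone q) (input_kind q) (witness_zone q)
       (a t centre) (a t q.-1) (a t q) (a t q.+1) (a t.+1 q).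

Lemma leading_bitsE (A : finType) (s : seq (symbol A)) :
  leading_bits s = [:: true] <-> nth None s 0 = Some (inl true) /\ ~~ is_bit (nth None s 1).
Proof.
case: s => [|[[[]|y]|] s] /=; try by split=> // -[].
by case: s => [|[[c|y]|] s] /=; split=> // -[].
Qed.

Lemma bits_of_tape (A : finType) (f : nat -> symbol A) n :
  (forall j, j < n -> ~~ is_bit (f j) -> f j = None /\ f j.+1 = None) -> f n = None ->
  exists2 w, size w <= n & forall j, j <= n -> f j = nth None [seq Some (inl b) | b <- w] j.
Proof.
elim: n f => [|n IH] f H fn; first by exists [::] => // -[|j].
case f0: (f 0) => [[b|c]|].
- have [|w sw fw] := IH (f \o succn) _ fn; first by move=> j lj; apply: (H j.+1).
  by exists (b :: w) => // -[|j] lj /=; [rewrite f0|apply: fw].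
- by have [] := H 0 isT; rewrite f0.
exists [::] => // j lj; rewrite nth_nil.
elim: j lj => // j IHj lj; have [|_ ->] // := H j lj.
by rewrite IHj // ltnW.
Qed.

Definition start_config w : config M := init M [:: x; w].

Lemma initial_sliceP w q : size w <= P -> 0 < q ->
  initial_slice (input_kind q) (witness_zone q)
    (config_slice (start_config w) q) (config_slice (start_config w) q.+1).
Proof.
move=> lw q0; rewrite /initial_slice eqxx /=; apply/forallP => i; rewrite !ffunE /=.
rewrite /input_kind /witness_zone; have [lt|le] := ltnP q centre.
  have E : tape_cell ([::], [seq Some (inl b) | b <- nth [::] [:: x; w] i]) q = None.
    by rewrite /tape_cell leqNgt lt /= nth_nil.
  by rewrite E /=; case: i {E} => -[|[|i]].
have [k ->] : exists k, q = centre + k by exists (q - centre); lia.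
rewrite -addnS !tape_cellR addKn /=; case: i => -[|[|i]] li /=; last by rewrite !nth_nil.
- case: ltnP => [lk|lk]; last by rewrite nth_default ?size_map.
  by rewrite (nth_map false) //; case: nth.
- case: ltnP => [lk|lk]; last by rewrite nth_default // size_map (leq_trans lw).
  have [lk'|lk'] := ltnP k (size w); first by rewrite (nth_map false).
  by rewrite !nth_default ?size_map ?eqxx ?orbT // ltnW.
Qed.

Theorem tableauP : (exists a, tableau a) <-> exists w, size w <= P /\
  let c := iter T (@step M) (start_config w) in
  halting c.1 /\ leading_bits (c.2 ord0).2 = [:: true].
Proof.
split=> [[a Ha]|[w [lw [hc lc]]]]; last first.
  exists (fun t q => config_slice (iter t (@step M) (start_config w)) q) => t q lt /andP[q0 lq].
  rewrite /forbidden -step_slice // -iterS eqxx; apply/or4P => -[//|||].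
  - by case: eqP => //= -> /negP; apply; apply: initial_sliceP.
  - case/and3P => /eqP -> z2 /negP; apply; rewrite ffunE hc.
    have {z2} -> : q = centre by move: z2; rewrite /zone; do ![case: eqP]; lia.
    by rewrite -[centre]addn0 tape_cellR; have [-> _] := (leading_bitsE _).1 lc.
  - case/and3P => /eqP -> z3; rewrite ffunE.
    have {z3} -> : q = centre + 1 by move: z3; rewrite /zone; do ![case: eqP]; lia.
    by rewrite tape_cellR; have [_ /negP] := (leading_bitsE _).1 lc.
have ok t q (lt : t < T) (lq : 0 < q < width.-1) := Ha t q lt lq.
have ini q : 0 < q < width.-1 ->
    initial_slice (input_kind q) (witness_zone q) (a 0 q) (a 0 q.+1).
  by move=> lq; have := ok 0 q T0 lq; rewrite /forbidden => /norP[_ /norP[]]; rewrite negbK.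
have cE : centre = T.+2 by [].
(* The guessed content of tape 1; for a machine with tape 0 only it is blank throughout. *)
pose f j := oapp (fun i => (a 0 (centre + j)).2 i) None (insub 1 : option 'I_(ntapes M).+1).
have fE (i : 'I_(ntapes M).+1) j : val i = 1 -> f j = (a 0 (centre + j)).2 i.
  move=> i1; rewrite /f; case: insubP => [i' _ i1'|]; last by rewrite -i1 ltn_ord.
  by congr ((a 0 _).2 _); apply/val_inj; rewrite i1 i1'.
have f_out j : [exists i : 'I_(ntapes M).+1, val i == 1] = false -> f j = None.
  by rewrite /f; case: insubP => // i _ i1 /existsP[]; exists i; apply/eqP.
have ini_off j (i : 'I_(ntapes M).+1) : j <= T -> val i = 1 ->
    if j < P then is_bit (f j) || (f j == None) && (f j.+1 == None) else f j == None.
  move=> lj i1; rewrite !(fE i) //.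
  have l : 0 < centre + j < width.-1 by rewrite /width; lia.
  have /andP[_ /forallP /(_ i)] := ini _ l.
  by rewrite i1 /witness_zone leq_addr addKn -addnS.
have [||w sw Hw] := @bits_of_tape _ f P.
- move=> j lj nb; case e1: [exists i : 'I_(ntapes M).+1, val i == 1]; last by rewrite !f_out.
  have /existsP[i /eqP i1] := e1; have jT : j <= T by lia.
  by have := ini_off j i jT i1; rewrite lj (negbTE nb) => /andP[/eqP -> /eqP ->].
- case e1: [exists i : 'I_(ntapes M).+1, val i == 1]; last by rewrite f_out.
  have /existsP[i /eqP i1] := e1; have := ini_off P i PT i1.
  by rewrite ltnn => /eqP.
exists w; split=> //.
have row0 q : 0 < q < width.-1 -> a 0 q = config_slice (start_config w) q.
  move=> lq; have /andP[/eqP s0 /forallP t0] := ini q lq.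
  rewrite /config_slice [LHS]surjective_pairing s0; congr (_, _); apply/ffunP => i.
  have {t0} := t0 i; rewrite !ffunE /= /input_kind /witness_zone.
  have [lt|le] := ltnP q centre.
    have -> : tape_cell ([::], [seq Some (inl b) | b <- nth [::] [:: x; w] i]) q = None.
      by rewrite /tape_cell leqNgt lt /= nth_nil.
    by case: i => -[|[|i]] li /= /eqP.
  have [k ek] : exists k, q = centre + k by exists (q - centre); lia.
  rewrite ek tape_cellR addKn /=.
  case ei: (val i) => [|[|j]] /=.
  - case: ltnP => [lk|lk] /eqP ->; last by rewrite nth_default ?size_map.
    by rewrite (nth_map false) //; case: nth.
  - rewrite -!(fE i) // -addnS -!(fE i) //.
    have [lk|lk] := leqP k P; first by rewrite Hw.
    by rewrite ltnNge (ltnW lk) /= => /eqP ->; rewrite nth_default // size_map (leq_trans sw (ltnW lk)).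
  - by rewrite !nth_nil => /eqP.
(* The border of the tableau is unconstrained, and errors spread inwards by one cell per step. With
   [centre = T + 2] the centre and its right neighbour are still correct in row [T]. *)
have cone t q : t <= T -> t < q <= 2 * centre - t.+1 ->
    a t q = config_slice (iter t (@step M) (start_config w)) q.
  elim: t q => [|t IH] q lt lq; first by apply: row0; rewrite /width; lia.
  have lq' : 0 < q < width.-1 by rewrite /width; lia.
  have := ok t q lt lq'; rewrite /forbidden negb_or negbK => /andP[/eqP -> _].
  rewrite iterS step_slice; last by lia.
  by rewrite !IH //; lia.
have lT : T.-1 < T by lia.
have ez : zone centre = 2 by rewrite /zone eqxx; case: eqP; lia.
have ez1 : zone centre.+1 = 3 by rewrite /zone eqxx; do ![case: eqP]; lia.
split.
  have lq : 0 < centre < width.-1 by rewrite /width; lia.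
  have := ok T.-1 centre lT lq; rewrite prednK // eqxx ez => /norP[_ /norP[_ /norP[]]].
  by rewrite /= negbK cone //; [case/andP|lia].
apply/leading_bitsE; split.
  have lq : 0 < centre < width.-1 by rewrite /width; lia.
  have := ok T.-1 centre lT lq; rewrite prednK // eqxx ez => /norP[_ /norP[_ /norP[]]].
  rewrite /= negbK cone //; last by lia.
  by rewrite ffunE -[centre]addn0 tape_cellR => /andP[_ /eqP].
have lq : 0 < centre.+1 < width.-1 by rewrite /width; lia.
have := ok T.-1 centre.+1 lT lq; rewrite prednK // eqxx ez1 => /norP[_ /norP[_ /norP[_]]].
by rewrite /= cone; [rewrite ffunE -[centre.+1]addn1 tape_cellR| |lia].
Qed.

End Tableau.

(** * Numbering the constraints of a tableau *)

Section TableauConstraints.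

Variable M : machine.
Notation S := #|slice M|.

Definition slice0 : slice M := (start M, [ffun=> None]).
Definition slice_num (c : slice M) : nat := enum_rank c.
Definition num_slice (a : nat) : slice M := nth slice0 (enum (slice M)) a.

Lemma slice_num_lt c : slice_num c < S. Proof. exact: ltn_ord. Qed.

Lemma slice_numK c : num_slice (slice_num c) = c.
Proof. by rewrite /num_slice /slice_num nth_enum_rank. Qed.

Lemma card_slice : 1 < S.
Proof.
have ne : slice0 != (start M, [ffun=> Some (inl true)]).
  by apply/eqP => -[/ffunP /(_ ord0)]; rewrite !ffunE.
by have := cards2 slice0 (start M, [ffun=> Some (inl true)]); rewrite ne => <-; apply: max_card.
Qed.

Let S0 : 0 < S := ltnW card_slice.

Variables (x : seq bool) (P T : nat).
Notation Q := (width T).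

(* A constraint number consists of a time, a position, and five slices. *)
Definition digit (i b : nat) := iter i (fun b => b %/ S) b %% S.
Definition place b := iter 5 (fun b => b %/ S) b.
Definition pat_time b := place b %/ Q.
Definition pat_pos b := place b %% Q.

Definition forbidden_num (first last : bool) k kind wz a0 a1 a2 a3 a4 :=
  forbidden first last k kind wz (num_slice a0) (num_slice a1) (num_slice a2)
    (num_slice a3) (num_slice a4).

(** Every combination of time, position and five slices has a number, so that decoding needs only
    division; combinations that are harmless or at the border are declared free. *)
Definition free_pattern b := let t := pat_time b in let q := pat_pos b in
  ~~ ((0 < q < Q.-1) && forbidden_num (t == 0) (t.+1 == T) (zone T q) (input_kind x T q)
    (witness_zone P T q) (digit 4 b) (digit 3 b) (digit 2 b) (digit 1 b) (digit 0 b)).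

Definition pattern b := let t := pat_time b in let q := pat_pos b in
  [:: (t * Q + centre T) * S + digit 4 b; (t * Q + q.-1) * S + digit 3 b;
      (t * Q + q) * S + digit 2 b; (t * Q + q.+1) * S + digit 1 b;
      (t.+1 * Q + q) * S + digit 0 b].

Definition cells := T.+1 * Q.
Definition patterns := T * Q * S ^ 5.

Definition tableau_lists := csp_lists cells S patterns pattern free_pattern.

Lemma digit_lt i b : digit i b < S. Proof. by rewrite ltn_mod. Qed.

Lemma pat_pos_lt b : pat_pos b < Q. Proof. by rewrite ltn_mod. Qed.

Lemma pat_time_lt b : b < patterns -> pat_time b < T.
Proof.
by rewrite /patterns !expnS expn0 muln1 !mulnA => lb; rewrite /pat_time /place /= !ltn_divLR.
Qed.

Lemma cell_lt t q : t <= T -> q < Q -> t * Q + q < cells.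
Proof.
move=> lt lq; apply: (@leq_trans (t.+1 * Q)); first by rewrite mulSnr ltn_add2l.
by rewrite leq_mul2r ltnS lt orbT.
Qed.

Lemma tableau_list_colourable : 0 < T ->
  list_colourable tableau_lists <-> exists a, @tableau M x P T a.
Proof.
move=> T0; have sub n y s : y < n -> s < S -> y * S + s < n * S.
  move=> ly ls; apply: (@leq_trans (y.+1 * S)); first by rewrite mulSnr ltn_add2l.
  by rewrite leq_mul2r ly orbT.
have dm y s : s < S -> (y * S + s) %/ S = y /\ (y * S + s) %% S = s.
  by move=> ls; rewrite divnMDl // divn_small // addn0 modnMDl modn_small.
have range b y : b < patterns -> ~~ free_pattern b -> y \in pattern b -> y < cells * S.
  move=> /pat_time_lt lt; rewrite negbK => /andP[/andP[q0 q1] _].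
  have cQ : centre T < Q by rewrite /width; lia.
  have lq := pat_pos_lt b; rewrite !inE.
  by do 4?[case/orP]; move=> /eqP ->; apply: sub (digit_lt _ _); apply: cell_lt => //; lia.
have c0 : 0 < cells by rewrite /cells /width.
split.
  case/(csp_list_colourable c0 card_slice range) => a [a1 a2].
  exists (fun t q => num_slice (a (t * Q + q))) => t q lt /andP[q0 q1].
  apply/negP => forb.
  have cQ : centre T < Q by rewrite /width; lia.
  have lc t' q' : t' <= T -> q' < Q -> a (t' * Q + q') < S by move=> *; apply/a1/cell_lt.
  have v0 := lc t (centre T) (ltnW lt) cQ; have v1 := lc t q.-1 (ltnW lt).
  have v2 := lc t q (ltnW lt); have v3 := lc t q.+1 (ltnW lt); have v4 := lc t.+1 q lt.
  have {}v1 := v1 ltac:(lia); have {}v2 := v2 ltac:(lia); have {}v3 := v3 ltac:(lia); have {}v4 := v4 ltac:(lia).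
  (* The constraint whose digits are the symbols actually placed: being forbidden it is not free,
     yet all its pairs occur. *)
  pose b := ((((((t * Q + q) * S + a (t * Q + centre T)) * S + a (t * Q + q.-1)) * S
     + a (t * Q + q)) * S + a (t * Q + q.+1)) * S + a (t.+1 * Q + q)).
  have dg : [/\ digit 4 b = a (t * Q + centre T), digit 3 b = a (t * Q + q.-1),
      digit 2 b = a (t * Q + q), digit 1 b = a (t * Q + q.+1) & digit 0 b = a (t.+1 * Q + q)] /\
      place b = t * Q + q.
    by rewrite /place /digit /= /b; do ![rewrite divnMDl // | rewrite (divn_small (m := a _)) // addn0 | rewrite modnMDl modn_small //].
  have [[d4 d3 d2 d1 d0] pl] := dg.
  have lb : b < patterns.
    rewrite /patterns !expnS expn0 muln1 !mulnA.
    by do 5![apply: (sub _ _ _) => //]; apply: (@leq_trans (t.+1 * Q)); [lia|rewrite leq_mul2r lt orbT].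
  have lq : q < Q by lia.
  have pt : pat_time b = t by rewrite /pat_time pl divnMDl // divn_small // addn0.
  have pq : pat_pos b = q by rewrite /pat_pos pl modnMDl modn_small.
  have nb : ~~ free_pattern b.
    by rewrite negbK pt pq d4 d3 d2 d1 d0 q0 q1 /forbidden_num forb.
  have [y yp] := a2 b lb nb; move: yp; rewrite /pattern pt pq d4 d3 d2 d1 d0 !inE.
  have key k : a k < S -> ~~ (a ((k * S + a k) %/ S) != (k * S + a k) %% S).
    by move=> l; have [-> ->] := dm k _ l; rewrite eqxx.
  by do 4?[case/orP]; move=> /eqP ->; apply/negP; apply: key.
case=> A HA; apply/(csp_list_colourable c0 card_slice range).
pose a k := slice_num (A (k %/ Q) (k %% Q)).
exists a; split=> [k _|b lb nb]; first exact: slice_num_lt.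
have [al|/allPn[y yp ya]] := boolP (all (fun y => a (y %/ S) == y %% S) (pattern b)); last by exists y.
move: nb; rewrite negbK => /andP[/andP[q0 q1]].
have lt := pat_time_lt lb; have := HA _ (pat_pos b) lt; rewrite q0 q1 => /(_ isT) /negP nf.
have cQ : centre T < Q by rewrite /width; lia.
have lq := pat_pos_lt b.
have aE t q : q < Q -> a (t * Q + q) = slice_num (A t q).
  by move=> l; rewrite /a divnMDl // divn_small // addn0 modnMDl modn_small.
have dE t q i : q < Q -> a (((t * Q + q) * S + digit i b) %/ S) == ((t * Q + q) * S + digit i b) %% S ->
    num_slice (digit i b) = A t q.
  move=> l; have [-> ->] := dm (t * Q + q) _ (digit_lt i b).
  by rewrite aE // => /eqP <-; rewrite slice_numK.
move: al => /= /and5P[/dE e4 /dE e3 /dE e2 /dE e1 /andP[/dE e0 _]].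
move=> forb; case: nf; move: forb; rewrite /forbidden_num.
by rewrite e4 // e3 ?e2 ?e1 ?e0 //; lia.
Qed.

End TableauConstraints.

(** * The reduction as an expression *)

Lemma pureOne : pure One. Proof. by []. Qed.
Lemma pureZero : pure Zero. Proof. by []. Qed.
Lemma pureVar i : pure (Var i). Proof. by []. Qed.
Lemma pureLen t : pure (Len t). Proof. by []. Qed.
Lemma pureBit t a : pure a -> pure (Bit t a). Proof. by []. Qed.
Lemma pureAdd a b : pure a -> pure b -> pure (Add a b). Proof. by move=> /= -> ->. Qed.
Lemma pureMonus a b : pure a -> pure b -> pure (Monus a b). Proof. by move=> /= -> ->. Qed.
Lemma pureSum y a b : pure a -> pure b -> pure (Sum y a b). Proof. by move=> /= -> ->. Qed.
Lemma pureNot a : pure a -> pure (Not a). Proof. by move=> /= ->. Qed.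
Lemma pureAnd a b : pure a -> pure b -> pure (And a b). Proof. by move=> /= -> ->. Qed.
Lemma pureOr a b : pure a -> pure b -> pure (Or a b). Proof. by move=> /= -> ->. Qed.
Lemma pureLe a b : pure a -> pure b -> pure (Le a b). Proof. by move=> /= -> ->. Qed.
Lemma pureLt a b : pure a -> pure b -> pure (Lt a b). Proof. by move=> /= -> ->. Qed.
Lemma pureEq a b : pure a -> pure b -> pure (Eq a b). Proof. by move=> /= -> ->. Qed.
Lemma pureMul a b : pure a -> pure b -> pure (Mul a b). Proof. by move=> /= -> ->. Qed.
Lemma pureDiv a b : pure a -> pure b -> pure (Div a b). Proof. by move=> /= -> ->. Qed.
Lemma pureMod a b : pure a -> pure b -> pure (Mod a b).
Proof. by move=> pa pb; rewrite pureMonus // pureMul // pureDiv. Qed.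
Lemma pureIf a b c : pure a -> pure b -> pure c -> pure (If a b c).
Proof. by move=> pa pb pc; rewrite pureAdd // pureMul // ?pureNot // pureNot. Qed.
Lemma purePow2E a : pure a -> pure (Pow2E a).
Proof.
by move=> pa; rewrite pureAnd // pureNot // pureSum ?pureAdd // pureAnd // ?pureLt // pureAnd ?pureMod ?pureConst // pureNot // pureMod.
Qed.

Lemma pureLocked a : pure a -> pure (locked a). Proof. by rewrite -lock. Qed.

Create HintDb purity discriminated.
#[local] Hint Constants Opaque : purity.
#[local] Hint Resolve pureOne pureZero pureVar pureLen pureBit pureAdd pureMonus pureSum pureNot pureAnd
  pureOr pureLe pureLt pureEq pureMul pureDiv pureMod pureIf pureConst pureExp pureTable
  purePow2E pureLocked : purity.

Section Reduction.

Variables (M : machine) (c d c' d' : nat).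
Notation S := #|slice M|.

Definition PolyE c d a := Mul (Const c) (Exp (Add a One) d).
Definition WitnessE := PolyE c d (Len true).
(* Locking prevents [rewrite] from unfolding the closed expressions. *)
Definition TimeE := locked (Add (Add (PolyE c' d' (Add (Len true) WitnessE)) WitnessE) One).
Definition CentreE := locked (Add TimeE (Const 2)).
Definition WidthE := locked (Add (Mul (Const 2) CentreE) One).
Definition CellsE := locked (Mul (Add TimeE One) WidthE).
Definition PatternsE := locked (Mul (Mul TimeE WidthE) (Const (S ^ 5))).
Definition HuesE := locked (Add (Mul CellsE (Const S)) One).
Definition MainsE := locked (Add (Add One CellsE) PatternsE).

Definition DigitE i b := Mod (iter i (fun b => Div b (Const S)) b) (Const S).
Definition PlaceE b := iter 5 (fun b => Div b (Const S)) b.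
Definition PatTimeE b := Div (PlaceE b) WidthE.
Definition PatPosE b := Mod (PlaceE b) WidthE.

Definition ZoneE q := If (Eq (Add q One) CentreE) One (If (Eq q CentreE) (Const 2)
  (If (Eq q (Add CentreE One)) (Const 3) Zero)).
Definition InputKindE q := If (Lt q CentreE) Zero
  (If (Lt (Monus q CentreE) (Len true)) (Add One (Bit true (Monus q CentreE))) Zero).
Definition WitnessZoneE q := And (Le CentreE q) (Lt (Monus q CentreE) WitnessE).

(** For a fixed machine all ten arguments range over constant finite sets, so nested tables of
    constants suffice. *)
Definition ForbiddenE b :=
  Table 2 (fun first => Table 2 (fun last => Table 4 (fun k => Table 3 (fun kind =>
  Table 2 (fun wz => Table S (fun a0 => Table S (fun a1 => Table S (fun a2 =>
  Table S (fun a3 => Table S (fun a4 =>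
    Const (forbidden_num M (first == 1) (last == 1) k kind (wz == 1) a0 a1 a2 a3 a4))
  (DigitE 0 b)) (DigitE 1 b)) (DigitE 2 b)) (DigitE 3 b)) (DigitE 4 b))
  (WitnessZoneE (PatPosE b))) (InputKindE (PatPosE b))) (ZoneE (PatPosE b)))
  (Eq (Add (PatTimeE b) One) TimeE)) (Eq (PatTimeE b) Zero).

Definition FreeE b :=
  Not (And (And (Lt Zero (PatPosE b)) (Lt (PatPosE b) (Monus WidthE One))) (ForbiddenE b)).

Definition PairE t q a := Add (Mul (Add (Mul t WidthE) q) (Const S)) a.

Definition InPatternE y b :=
  let t := PatTimeE b in let q := PatPosE b in
  Or (Eq y (PairE t CentreE (DigitE 4 b)))
 (Or (Eq y (PairE t (Monus q One) (DigitE 3 b)))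
 (Or (Eq y (PairE t q (DigitE 2 b)))
 (Or (Eq y (PairE t (Add q One) (DigitE 1 b)))
     (Eq y (PairE (Add t One) q (DigitE 0 b)))))).

Definition AllowE v y :=
  If (Eq v Zero) One (If (Le v CellsE) (Eq (Div y (Const S)) (Monus v One))
    (Or (FreeE (Monus v (Add CellsE One))) (InPatternE y (Monus v (Add CellsE One))))).

Definition SideE v := And (Lt Zero v) (Le v CellsE).
Definition PermittedE v a := And (Lt Zero a) (AllowE v (Monus a One)).
Definition LevelAtE v a t :=
  If (Lt t (Add (Monus HuesE (Add a One)) (Not (PermittedE v a)))) (Add a One) (Add HuesE One).
Definition OwnerE g := Div (Div g HuesE) HuesE.
Definition LevelE g := LevelAtE (OwnerE g) (Mod (Div g HuesE) HuesE) (Mod g HuesE).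
Definition GadgetsE := locked (Mul (Mul MainsE HuesE) HuesE).
Definition GsizeE := locked (Add (Mul (Const 2) HuesE) One).
Definition OrderE := Add MainsE (Mul GadgetsE GsizeE).

Definition GadgetE i := Div (Monus i MainsE) GsizeE.
Definition PartE i := Mod (Monus i MainsE) GsizeE.
Definition BlockE i := Div (Monus (PartE i) One) HuesE.
Definition RankE i := Mod (Monus (PartE i) One) HuesE.

Definition ArcE i j :=
  If (Lt i MainsE)
    (If (Lt j MainsE) (And (SideE i) (Not (SideE j)))
    (If (Eq (PartE j) Zero) (Eq (OwnerE (GadgetE j)) i)
      (And (Eq (OwnerE (GadgetE j)) i) (Le (LevelE (GadgetE j)) (Add (RankE j) One)))))
 (If (Or (Lt j MainsE) (Eq (PartE j) Zero)) Zero
 (If (Eq (PartE i) Zero)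
    (And (Eq (GadgetE i) (GadgetE j)) (Lt (Add (RankE j) One) (LevelE (GadgetE i))))
    (And (Eq (GadgetE i) (GadgetE j)) (And (Eq (BlockE i) (BlockE j))
    (And (Not (Eq (RankE i) (RankE j))) (And (Lt (Add (RankE i) One) (LevelE (GadgetE i)))
      (Lt (Add (RankE j) One) (LevelE (GadgetE i))))))))).

Definition EdgeE i j := Or (ArcE i j) (ArcE j i).
Definition BaseE j := Add (Mul j j) (Mul (Const 2) (Monus (Add HuesE One) j)).
Definition BudgetE := Add (Mul MainsE HuesE) (Sum 2 GadgetsE (BaseE (LevelE (Var 2)))).

Variable x : seq bool.
Notation ev e r := (eval x [::] e r).

Definition witness_len := poly_bound c d (size x).
(** Dominates the time of the verifier on every witness of admissible length; the last summand and
    the successor guarantee [P <= T] and [0 < T]. *)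
Definition run_time := (poly_bound c' d' (size x + witness_len) + witness_len).+1.
Notation P := witness_len.
Notation T := run_time.
Notation I := (tableau_lists M x P T).

Lemma evalPolyE k l a r : ev (PolyE k l a) r = poly_bound k l (ev a r).
Proof. by rewrite /PolyE !evalE addn1. Qed.

Lemma evalWitnessE r : ev WitnessE r = P.
Proof. by rewrite evalPolyE. Qed.

Lemma evalTimeE r : ev TimeE r = T.
Proof. by rewrite /TimeE -lock !evalAdd evalPolyE evalAdd evalWitnessE evalOne addn1. Qed.

Lemma evalCentreE r : ev CentreE r = centre T.
Proof. by rewrite /CentreE -lock evalAdd evalTimeE evalConst addn2. Qed.

Lemma evalWidthE r : ev WidthE r = width T.
Proof. by rewrite /WidthE -lock evalAdd evalMul evalConst evalCentreE evalOne addn1. Qed.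

Lemma evalCellsE r : ev CellsE r = cells T.
Proof. by rewrite /CellsE -lock evalMul evalAdd evalTimeE evalWidthE evalOne addn1. Qed.

Lemma evalPatternsE r : ev PatternsE r = patterns M T.
Proof. by rewrite /PatternsE -lock !evalMul evalTimeE evalWidthE evalConst. Qed.

Lemma evalHuesE r : ev HuesE r = (hues I).+1.
Proof. by rewrite /HuesE -lock evalAdd evalMul evalCellsE evalConst evalOne addn1. Qed.

Lemma evalMainsE r : ev MainsE r = lsize I.
Proof. by rewrite /MainsE -lock !evalAdd evalCellsE evalPatternsE evalOne. Qed.

Lemma eval_shift i b r : ev (iter i (fun b => Div b (Const S)) b) r = iter i (fun b => b %/ S) (ev b r).
Proof. by elim: i => // i IH; rewrite !iterS evalDiv IH evalConst. Qed.

Lemma evalDigitE i b r : ev (DigitE i b) r = digit M i (ev b r).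
Proof. by rewrite evalMod eval_shift evalConst. Qed.

Lemma evalPatTimeE b r : ev (PatTimeE b) r = pat_time M T (ev b r).
Proof. by rewrite evalDiv eval_shift evalWidthE. Qed.

Lemma evalPatPosE b r : ev (PatPosE b) r = pat_pos M T (ev b r).
Proof. by rewrite evalMod eval_shift evalWidthE. Qed.

Lemma evalZoneE q r : ev (ZoneE q) r = zone T (ev q r).
Proof.
by rewrite !evalIf !evalEq !evalConst !evalAdd !evalCentreE !evalOne evalZero !addn1 !eqb0 !negbK.
Qed.

Lemma evalInputKindE q r : ev (InputKindE q) r = input_kind x T (ev q r).
Proof.
rewrite !evalIf !evalLt !evalZero evalAdd evalBit !evalMonus !evalCentreE evalLen evalOne !eqb0 !negbK.
by [].
Qed.

Lemma evalWitnessZoneE q r : ev (WitnessZoneE q) r = witness_zone P T (ev q r).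
Proof. by rewrite evalAnd evalLe evalLt evalMonus !evalCentreE evalWitnessE !eqb0 !negbK. Qed.

Lemma zone_lt q : zone T q < 4.
Proof. by rewrite /zone; do ![case: ifP]. Qed.

Lemma input_kind_lt q : input_kind x T q < 3.
Proof. by rewrite /input_kind; do ![case: ifP] => // _ _; case: nth. Qed.

Lemma evalForbiddenE b r : let t := pat_time M T (ev b r) in let q := pat_pos M T (ev b r) in
  ev (ForbiddenE b) r = forbidden_num M (t == 0) (t.+1 == T) (zone T q) (input_kind x T q)
    (witness_zone P T q) (digit M 4 (ev b r)) (digit M 3 (ev b r)) (digit M 2 (ev b r))
    (digit M 1 (ev b r)) (digit M 0 (ev b r)).
Proof.
move=> t q.
rewrite /ForbiddenE evalTable evalEq evalPatTimeE evalZero ltnS leq_b1 eqb1.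
rewrite evalTable evalEq evalAdd evalPatTimeE evalTimeE evalOne addn1 ltnS leq_b1 eqb1.
rewrite evalTable evalZoneE evalPatPosE zone_lt.
rewrite evalTable evalInputKindE evalPatPosE input_kind_lt.
rewrite evalTable evalWitnessZoneE evalPatPosE ltnS leq_b1 eqb1.
by do 5![rewrite evalTable evalDigitE digit_lt]; rewrite evalConst.
Qed.

Lemma evalFreeE b r : ev (FreeE b) r = free_pattern M x P T (ev b r).
Proof.
rewrite evalNot !evalAnd !evalLt evalForbiddenE evalZero evalMonus evalPatPosE evalWidthE evalOne.
by rewrite !eqb0 !negbK subn1.
Qed.

Lemma evalPairE t q a r :
  ev (PairE t q a) r = (ev t r * width T + ev q r) * S + ev a r.
Proof. by rewrite evalAdd evalMul evalAdd evalMul evalWidthE evalConst. Qed.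

Lemma evalInPatternE y b r : ev (InPatternE y b) r = (ev y r \in pattern M T (ev b r)).
Proof.
rewrite /InPatternE evalOr evalEq evalOr evalEq evalOr evalEq evalOr evalEq evalEq 5!evalPairE 5!evalDigitE.
rewrite evalCentreE evalMonus !(evalAdd _ _ _ One) !evalPatTimeE !evalPatPosE.
by rewrite !evalOne !addn1 !subn1 !eqb0 !negbK !inE.
Qed.

Lemma evalAllowE v y r : ev (AllowE v y) r = allow I (ev v r) (ev y r).
Proof.
rewrite /AllowE evalIf evalEq evalZero evalIf evalLe evalEq evalOr evalFreeE evalInPatternE.
rewrite evalDiv !evalMonus (evalAdd _ _ _ One) evalCellsE evalConst !evalOne addn1 subn1.
by rewrite !eqb0 !negbK /= /csp_allow; do ![case: ifP].
Qed.

Lemma evalSideE v r : ev (SideE v) r = side I (ev v r).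
Proof. by rewrite evalAnd evalLt evalLe evalCellsE evalZero !eqb0 !negbK. Qed.

Lemma evalPermittedE v a r : ev (PermittedE v a) r = permitted I (ev v r) (ev a r).
Proof. by rewrite evalAnd evalLt evalZero evalAllowE evalMonus evalOne subn1 !eqb0 !negbK. Qed.

Lemma evalLevelAtE v a t r : ev (LevelAtE v a t) r = level_at I (ev v r) (ev a r) (ev t r).
Proof.
rewrite evalIf evalLt !evalAdd evalNot evalMonus evalAdd evalPermittedE !evalHuesE evalOne.
by rewrite !addn1 !eqb0 negbK.
Qed.

Lemma evalOwnerE g r : ev (OwnerE g) r = owner I (ev g r).
Proof. by rewrite !evalDiv !evalHuesE. Qed.

Lemma evalLevelE g r : ev (LevelE g) r = level I (ev g r).
Proof. by rewrite evalLevelAtE evalOwnerE !evalMod evalDiv !evalHuesE. Qed.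

Lemma evalGadgetsE r : ev GadgetsE r = gadgets I.
Proof. by rewrite /GadgetsE -lock !evalMul evalMainsE !evalHuesE. Qed.

Lemma evalGsizeE r : ev GsizeE r = gsize I.
Proof. by rewrite /GsizeE -lock evalAdd evalMul evalConst evalHuesE evalOne addn1. Qed.

Lemma evalOrderE r : ev OrderE r = order I.
Proof. by rewrite evalAdd evalMul evalMainsE evalGadgetsE evalGsizeE. Qed.

Lemma evalGadgetE i r : ev (GadgetE i) r = (ev i r - lsize I) %/ gsize I.
Proof. by rewrite evalDiv evalMonus evalMainsE evalGsizeE. Qed.

Lemma evalPartE i r : ev (PartE i) r = (ev i r - lsize I) %% gsize I.
Proof. by rewrite evalMod evalMonus evalMainsE evalGsizeE. Qed.

Lemma evalBlockE i r : ev (BlockE i) r = ((ev i r - lsize I) %% gsize I).-1 %/ (hues I).+1.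
Proof. by rewrite evalDiv evalMonus evalPartE evalHuesE evalOne subn1. Qed.

Lemma evalRankE i r : ev (RankE i) r = ((ev i r - lsize I) %% gsize I).-1 %% (hues I).+1.
Proof. by rewrite evalMod evalMonus evalPartE evalHuesE evalOne subn1. Qed.

Lemma evalArcE i j r : ev (ArcE i j) r = arc I (decode I (ev i r)) (decode I (ev j r)).
Proof.
have evm e : ev (Lt e MainsE) r = (ev e r < lsize I) by rewrite evalLt evalMainsE.
have evp e : ev (Eq (PartE e) Zero) r = ((ev e r - lsize I) %% gsize I == 0).
  by rewrite evalEq evalPartE evalZero.
have evo e e' : ev (Eq (OwnerE (GadgetE e)) e') r = (owner I ((ev e r - lsize I) %/ gsize I) == ev e' r).
  by rewrite evalEq evalOwnerE evalGadgetE.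
have evl e : ev (LevelE (GadgetE e)) r = level I ((ev e r - lsize I) %/ gsize I).
  by rewrite evalLevelE evalGadgetE.
have evr e : ev (Add (RankE e) One) r =
    (((ev e r - lsize I) %% gsize I).-1 %% (hues I).+1).+1.
  by rewrite evalAdd evalRankE evalOne addn1.
have evg e e' : ev (Eq (GadgetE e) (GadgetE e')) r =
    ((ev e r - lsize I) %/ gsize I == (ev e' r - lsize I) %/ gsize I).
  by rewrite evalEq !evalGadgetE.
rewrite /ArcE evalIf evm evalIf evm evalAnd evalSideE evalNot evalSideE.
rewrite evalIf evp evo evalAnd evo evalLe evl evr.
rewrite evalIf evalOr evm evp evalZero evalIf evp evalAnd evg evalLt evr evl.
rewrite evalAnd evg evalAnd evalEq 2!evalBlockE evalAnd evalNot evalEq 2!evalRankE.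
rewrite evalAnd evalLt evr evl evalLt evr evl !eqb0 !negbK /decode.
case: (ev i r < _); case: (ev j r < _) => //=.
- by case: (_ %% gsize I == 0).
- by case: (_ %% gsize I == 0).
- by case: ((ev j r - _) %% gsize I == 0); case: ((ev i r - _) %% gsize I == 0).
Qed.

Lemma evalEdgeE i j r : ev (EdgeE i j) r = edge I (ev i r) (ev j r).
Proof. by rewrite /EdgeE evalOr 2!evalArcE !eqb0 !negbK. Qed.

Lemma evalBudgetE r : ev BudgetE r = budget I.
Proof.
rewrite evalAdd evalMul evalMainsE evalHuesE evalSum evalGadgetsE; congr (_ + _).
apply: eq_bigr => g _; rewrite evalAdd !evalMul evalConst evalMonus evalAdd evalHuesE evalOne addn1.
by rewrite evalLevelE evalVar upd_eq.
Qed.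

End Reduction.

(** * NP-hardness *)

Lemma flatten_filter (S T : Type) (p : pred S) (f : S -> T) s :
  flatten [seq if p y then [:: f y] else [::] | y <- s] = [seq f y | y <- s & p y].
Proof. by elim: s => //= y s ->; case: (p y). Qed.

Lemma flatten_map1 (S T : Type) (f : S -> T) s : flatten [seq [:: f y] | y <- s] = [seq f y | y <- s].
Proof. by elim: s => //= y s ->. Qed.

Lemma map_const_iota (T : Type) (a : T) k n : [seq a | _ <- iota k n] = nseq n a.
Proof. by elim: n k => //= n IH k; rewrite IH. Qed.

(** * Output of the reduction *)

Section ReductionOutput.

Variables (M : machine) (c d c' d' : nat).
Notation orderE := (OrderE M c d c' d').
Notation edgeE := (EdgeE M c d c' d').
Notation budgetE := (BudgetE M c d c' d').

(** The two [Out Zero] are the separator and the sign of the target. A [Sum] whose range is the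
    truth value [Pow2E] is a conditional: digits are emitted at powers of 2 only. *)
Definition ReductionE :=
  Add (Sum 0 orderE (Out One))
 (Add (Out Zero)
 (Add (Sum 0 orderE (Sum 1 orderE (Out (edgeE (Var 0) (Var 1)))))
 (Add (Out Zero)
      (Sum 0 budgetE (Sum 1 (Pow2E (Add (Var 0) One))
        (Out (Mod (Div budgetE (Add (Var 0) One)) (Const 2)))))))).

Lemma pureWitnessE : pure (WitnessE c d).
Proof. by rewrite /WitnessE /PolyE; auto 20 with purity. Qed.
#[local] Hint Resolve pureWitnessE : purity.

Lemma pureTimeE : pure (TimeE c d c' d').
Proof. by rewrite /TimeE /PolyE; auto 20 with purity. Qed.
#[local] Hint Resolve pureTimeE : purity.

Lemma pureCentreE : pure (CentreE c d c' d').
Proof. by rewrite /CentreE; auto 20 with purity. Qed.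
#[local] Hint Resolve pureCentreE : purity.

Lemma pureWidthE : pure (WidthE c d c' d').
Proof. by rewrite /WidthE; auto 20 with purity. Qed.
#[local] Hint Resolve pureWidthE : purity.

Lemma pureCellsE : pure (CellsE c d c' d').
Proof. by rewrite /CellsE; auto 20 with purity. Qed.
#[local] Hint Resolve pureCellsE : purity.

Lemma pureHuesE : pure (HuesE M c d c' d').
Proof. by rewrite /HuesE; auto 20 with purity. Qed.
#[local] Hint Resolve pureHuesE : purity.

Lemma pureMainsE : pure (MainsE M c d c' d').
Proof. by rewrite /MainsE /PatternsE; auto 20 with purity. Qed.
#[local] Hint Resolve pureMainsE : purity.

Lemma pureGadgetsE : pure (GadgetsE M c d c' d').
Proof. by rewrite /GadgetsE; auto 20 with purity. Qed.
#[local] Hint Resolve pureGadgetsE : purity.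

Lemma pureGsizeE : pure (GsizeE M c d c' d').
Proof. by rewrite /GsizeE; auto 20 with purity. Qed.
#[local] Hint Resolve pureGsizeE : purity.

Lemma pureOrderE : pure orderE.
Proof. by rewrite /OrderE; auto 20 with purity. Qed.
#[local] Hint Resolve pureOrderE : purity.

Lemma pure_shift i b : pure b -> pure (iter i (fun b => Div b (Const #|slice M|)) b).
Proof. by move=> pb; elim: i => [//|i IH]; rewrite iterS; auto with purity. Qed.
#[local] Hint Resolve pure_shift : purity.

Lemma pureDigitE i b : pure b -> pure (DigitE M i b).
Proof. by move=> pb; rewrite /DigitE; auto with purity. Qed.
#[local] Hint Resolve pureDigitE : purity.

Lemma purePatTimeE b : pure b -> pure (PatTimeE M c d c' d' b).
Proof. by move=> pb; apply: pureDiv pureWidthE; apply: pure_shift. Qed.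
#[local] Hint Resolve purePatTimeE : purity.

Lemma purePatPosE b : pure b -> pure (PatPosE M c d c' d' b).
Proof. by move=> pb; apply: pureMod pureWidthE; apply: pure_shift. Qed.
#[local] Hint Resolve purePatPosE : purity.

Lemma pureForbiddenE b : pure b -> pure (ForbiddenE M c d c' d' b).
Proof.
move=> pb; rewrite /ForbiddenE /WitnessZoneE /InputKindE /ZoneE.
by do 10!(apply: pureTable; [auto 20 with purity|move=> ?]); apply: pureConst.
Qed.
#[local] Hint Resolve pureForbiddenE : purity.

Lemma pureAllowE v y : pure v -> pure y -> pure (AllowE M c d c' d' v y).
Proof. by move=> pv py; rewrite /AllowE /InPatternE /PairE /FreeE; auto 40 with purity. Qed.
#[local] Hint Resolve pureAllowE : purity.

Lemma pureLevelE g : pure g -> pure (LevelE M c d c' d' g).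
Proof. by move=> pg; rewrite /LevelE /LevelAtE /PermittedE /OwnerE; auto 40 with purity. Qed.
#[local] Hint Resolve pureLevelE : purity.

Lemma pureArcE i j : pure i -> pure j -> pure (ArcE M c d c' d' i j).
Proof.
move=> pi pj; rewrite /ArcE /SideE /OwnerE.
have pg e : pure e -> pure (GadgetE M c d c' d' e) by rewrite /GadgetE; auto 20 with purity.
have pp e : pure e -> pure (PartE M c d c' d' e) by rewrite /PartE; auto 20 with purity.
have pb e : pure e -> pure (BlockE M c d c' d' e) by rewrite /BlockE; auto 20 with purity.
have pr e : pure e -> pure (RankE M c d c' d' e) by rewrite /RankE; auto 20 with purity.
by auto 40 with purity.
Qed.

Lemma pureEdgeE i j : pure i -> pure j -> pure (edgeE i j).
Proof. by move=> pi pj; rewrite pureOr // pureArcE. Qed.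

Lemma pureBudgetE : pure budgetE.
Proof. by rewrite /BudgetE /BaseE; auto 40 with purity. Qed.

Variable x : seq bool.
Notation I := (tableau_lists M x (witness_len c d x) (run_time c d c' d' x)).

Lemma outputAdd a b r : output x [::] (Add a b) r = output x [::] a r ++ output x [::] b r.
Proof. by []. Qed.

Lemma outputSum y a b r : pure a -> output x [::] (Sum y a b) r =
  flatten [seq output x [::] b (upd r y i) | i <- iota 0 (eval x [::] a r)].
Proof. by move=> pa; rewrite -[LHS]/(output x [::] a r ++ _) output_pure. Qed.

Lemma outputOut a r : pure a -> output x [::] (Out a) r = [:: eval x [::] a r != 0].
Proof. by move=> pa; rewrite -[LHS]/(rcons (output x [::] a r) _) output_pure. Qed.

Lemma output_matrix r :
  output x [::] (Sum 0 orderE (Sum 1 orderE (Out (edgeE (Var 0) (Var 1))))) r =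
  [seq list_graph I u v | u <- enum 'I_(order I), v <- enum 'I_(order I)].
Proof.
rewrite (outputSum _ _ _ pureOrderE) evalOrderE -val_enum_ord -map_comp.
congr flatten; apply: eq_map => u; rewrite [LHS](outputSum _ _ _ pureOrderE) evalOrderE.
rewrite -val_enum_ord -map_comp -[RHS]flatten_map1; congr flatten; apply: eq_map => v.
rewrite [LHS]outputOut; last exact: pureEdgeE.
by rewrite evalEdgeE eqb0 negbK.
Qed.

Lemma output_bits r : output x [::] (Sum 0 budgetE (Sum 1 (Pow2E (Add (Var 0) One))
  (Out (Mod (Div budgetE (Add (Var 0) One)) (Const 2))))) r = bits (budget I).
Proof.
rewrite (outputSum _ _ _ pureBudgetE) evalBudgetE bits_pow2 -flatten_filter.
rewrite (iotaDl 1 0) -map_comp; congr flatten; apply: eq_map => i.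
rewrite [LHS]outputSum; last by apply: purePow2E.
rewrite [RHS]/= add1n evalPow2E evalAdd evalVar upd_eq evalOne addn1.
case: (pow2 i.+1); last by [].
have pB : pure (Mod (Div budgetE (Add (Var 0) One)) (Const 2)).
  by apply: pureMod (pureConst _); apply: pureDiv pureBudgetE _.
rewrite [LHS]cats0 (outputOut _ pB) evalMod evalDiv evalBudgetE evalConst evalAdd evalVar evalOne modn2.
by rewrite /upd /= addn1; case: odd.
Qed.

Lemma output_ReductionE (C : graph_class) (CI : C _ (list_graph I)) :
  output x [::] ReductionE (fun=> 0) =
  encode_instance (@ChromaticSumInstance C (order I) (list_graph I) CI (Posz (budget I))).
Proof.
rewrite /ReductionE !outputAdd output_matrix output_bits !(outputOut _ pureZero).
rewrite (outputSum _ _ _ pureOrderE) evalOrderE evalZero; congr (_ ++ _).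
rewrite (eq_map (g := fun=> [:: true])); last by move=> i; rewrite (outputOut _ pureOne).
by rewrite flatten_map1 map_const_iota.
Qed.

End ReductionOutput.

Lemma tableau_graph_dh M x P T : distance_hereditary (list_graph (tableau_lists M x P T)).
Proof. by apply: (@list_graph_dh _ (cells T)). Qed.

(** All graphs produced are distance-hereditary, so one reduction serves every larger class. *)
Theorem chromatic_sum_NP_hard (C : graph_class) :
  (forall T (G : sgraph T), distance_hereditary G -> C T G) -> NP_hard (chromatic_sum C).
Proof.
move=> CD Q [V [c [d [[M [c' [d' HV]]] HQ]]]].
exists (fun s => output s [::] (ReductionE M c d c' d') (fun=> 0)); split.
  exact: polytime_output1.
move=> z; set x := encode z.
pose P := witness_len c d x; pose T := run_time c d c' d' x.
have CI := CD _ _ (tableau_graph_dh M x P T).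
exists (@ChromaticSumInstance C _ (list_graph (tableau_lists M x P T)) CI (Posz (budget (tableau_lists M x P T)))); split.
  exact: output_ReductionE.
rewrite HQ -/x; apply: iff_trans (iff_trans _ (iff_sym (list_graph_cost _))) _; last first.
  by split=> -[col [colP le]]; exists col; split.
apply: iff_trans (iff_sym (tableau_list_colourable M x P (ltn0Sn _))).
have PT : P <= T by rewrite /T /run_time leqW // leq_addl.
apply: iff_trans (iff_sym (tableauP M x (ltn0Sn _) PT)).
(* [T] covers all witness lengths up to [P], and halting configurations persist; at time [T] the
   output is the verdict of [V]. *)
have run w : size w <= P -> let e := iter T (@step M) (start_config M x w) in
    halting e.1 /\ leading_bits (e.2 ord0).2 = [:: V x w].
  move=> lw; have := HV x w; rewrite /computes_within -/(start_config M x w).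
  set t := poly_bound c' d' _ => H.
  have tT : t <= T.
    rewrite /T /run_time leqW //; apply: leq_trans (leq_addr _ _).
    by apply: leq_poly_bound; rewrite // leq_add2l.
  rewrite -(subnK tT) iterD; move: H; case E: (iter t _ _) => [q ts] [hq lq].
  by rewrite iter_halting.
split=> -[w [lw H]]; exists w; split=> //; have [h1 h2] := run w lw.
  by rewrite H in h2; split.
by case: H => _; rewrite h2 => -[->].
Qed.

Theorem theorem24 :
  NP_complete (chromatic_sum distance_hereditary) /\
  NP_complete (chromatic_sum (cliquewidth_at_most 3)).
Proof.
split; split; try exact: chromatic_sum_in_NP; apply: chromatic_sum_NP_hard => // T G.
exact: dh_cliquewidth.
Qed.
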